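(* Let $(\Omega,\mathcal F,\mu)$ be a complete probability space with $\mu$ non-atomic, let $X$ be a complete separable metric space with Borel $\sigma$-field $\mathcal B(X)$, and let $A$ be a correspondence from $\Omega$ to $X$ with $A(\omega)\neq\emptyset$ for each $\omega\in\Omega$ and with graph $Gr(A)=\{(\omega,x):\omega\in\Omega,\ x\in A(\omega)\}\in\mathcal F\otimes\mathcal B(X)$. Let $c_i:Gr(A)\to\mathbb R_+=[0,+\infty)$, $i=1,\dots,m$, and $u:Gr(A)\to\mathbb R$ be $\mathcal F\otimes\mathcal B(X)$-measurable functions such that $c_1(\omega,\cdot),\dots,c_m(\omega,\cdot),-u(\omega,\cdot)$ are inf-compact on $A(\omega)$ for each $\omega\in\Omega$, and suppose there is a $\mu$-integrable function $\Lambda:\Omega\to\mathbb R_+$ with $|u(\omega,x)|\le\Lambda(\omega)$ for all $(\omega,x)\in Gr(A)$. Let $\mathcal P$ be a given set of parameters and, for every $p\in\mathcal P$, let $q(\cdot|p)$ be a probability distribution on $(\Omega,\mathcal F)$ that is absolutely continuous with respect to $\mu$, with density $\rho(\cdot,p)$. Let $\mathcal G$ be the sub-$\sigma$-field of $\mathcal F$ generated by the family of functions $\{\rho(\cdot,p)\}_{p\in\mathcal P}$. Let $a_1,\dots,a_m\in\mathbb R_+$ be such that the set of $\varphi\in\Phi$ for which $$\sup_{p\in\mathcal P}\int_\Omega\int_{A(\omega)}c_i(\omega,x)\,\varphi(\omega)(dx)\,\rho(\omega,p)\,\mu(d\omega)\le a_i,\quad i=1,\dots,m,$$ is non-empty.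 Moreover, assume that $\mathcal F$ has no $\mathcal G$-atoms. Then there exists a non-randomized decision function $f_*\in F$ solving the problem (RVP) $$\sup_{f\in F}\ \inf_{p\in\mathcal P}\int_\Omega u(\omega,f(\omega))\,\rho(\omega,p)\,\mu(d\omega)$$ $$\text{subject to}\quad \sup_{p\in\mathcal P}\int_\Omega c_i(\omega,f(\omega))\,\rho(\omega,p)\,\mu(d\omega)\le a_i,\quad i=1,\dots,m;$$ that is, $f_*$ satisfies the constraints and attains the supremum of the objective over all $f\in F$ satisfying the constraints.
   Context: $P(X)$ is the space of all probability measures on $(X,\mathcal B(X))$ with the topology of weak convergence and its Borel $\sigma$-field. A randomized decision function is a measurable mapping $\varphi:\Omega\to P(X)$ (with respect to $\mathcal F$) such that $\varphi(\omega)(A(\omega))=1$ for all $\omega\in\Omega$; $\Phi$ denotes the set of all of them. A non-randomized (pure) decision function is a measurable mapping $f:\Omega\to X$ such that $f(\omega)\in A(\omega)$ for all $\omega\in\Omega$; $F$ denotes the set of all of them. A function $c(\omega,\cdot):A(\omega)\to\mathbb R$ is inf-compact on $A(\omega)$ if the set $\{x\in A(\omega): c(\omega,x)\le\beta\}$ is compact for each $\beta\in\mathbb R$. For a sub-$\sigma$-field $\mathcal G\subset\mathcal F$, a set $D\in\mathcal F$ is called a $\mathcal G$-atom if $\mu(D)>0$ and for any $D_1\in\mathcal F$ there exists $D_2\in\mathcal G$ such that $\mu((D\cap D_1)\triangle(D\cap D_2))=0$.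
   Formalization: Added assumption: for every f in F and every p, the function u(ω,f(ω))ρ(ω,p) is μ-integrable, so the objective integrals are finite; μ-integrability of Λ alone does not give this when ρ is unbounded, and the claim then fails. *)

(* Defs.v *)
From HB Require Import structures.
From mathcomp Require Import all_boot all_order all_algebra.
From mathcomp Require Import all_classical all_reals all_analysis.

Set Implicit Arguments.
Unset Strict Implicit.
Unset Printing Implicit Defensive.

Import Order.TTheory GRing.Theory Num.Theory.
Import numFieldNormedType.Exports.

Local Open Scope classical_set_scope.
Local Open Scope ring_scope.

#[short(type="completeMetricType")]
HB.structure Definition CompleteMetric (K : numDomainType) :=
  {T of CompletePseudoMetric K T & Metric K T}.

Definition separable_space (T : topologicalType) : Prop :=
  exists D : set T, countable D /\ dense D.

(* Type alias of [T] whose measurable sets are the Borel sets. *)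
Notation borel T := (g_sigma_algebraType (@open T)).

Definition bounded_continuous (R : realType) (X : topologicalType) :
    set (X -> R) :=
  [set g | continuous g /\ bounded_fun g].

Section weak_convergence.
Context (R : realType) (X : ptopologicalType).

Definition integral_against (P : probability (borel X) R) :
    {ptws set_type (@bounded_continuous R X) -> R} :=
  fun g => (\int[P]_x (set_val g x))%R.

(* The coarsest topology making [P |-> \int[P]_x g x] continuous for every
   bounded continuous [g], i.e. the topology of weak convergence. *)
Definition weak_probability := initial_topology integral_against.

Definition prob_of (P : weak_probability) : probability (borel X) R := P.

End weak_convergence.

Section measure_notions.
Context (d : measure_display) (T : measurableType d) (R : realType).
Implicit Type mu : {measure set T -> \bar R}.

Definition atom mu (D : set T) : Prop :=
  [/\ measurable D, (0 < mu D)%E &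
      forall B, measurable B -> B `<=` D -> mu B = 0%E \/ mu (D `\` B) = 0%E].

Definition nonatomic mu : Prop := forall D, ~ atom mu D.

(* [`+`] is the symmetric difference. *)
Definition relative_atom mu (G : set (set T)) (D : set T) : Prop :=
  [/\ measurable D, (0 < mu D)%E &
      forall D1, measurable D1 ->
        exists2 D2, G D2 & mu ((D `&` D1) `+` (D `&` D2)) = 0%E].

Definition is_density mu (nu : set T -> \bar R) (r : T -> R) : Prop :=
  [/\ measurable_fun setT r, (forall w, 0 <= r w) &
      forall B, measurable B -> nu B = (\int[mu]_(w in B) (r w)%:E)%E].

Definition sigma_generated_by (I : Type) (r : I -> T -> R) : set (set T) :=
  <<s \bigcup_(i in [set: I]) preimage_set_system setT (r i) measurable >>.

End measure_notions.

Definition inf_compact (R : realType) (X : topologicalType) (A : set X)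
    (g : X -> R) : Prop :=
  forall beta : R, compact [set x | A x /\ g x <= beta].

Definition corr_graph (Omega X : Type) (A : Omega -> set X) : set (Omega * X) :=
  [set z | A z.1 z.2].

(* Functions on the graph of [A] are total functions on [Omega * X]; their
   values outside the graph are never used. *)
Section decision_problem.
Context (R : realType) (d : measure_display) (Omega : measurableType d).
Context (X : completeMetricType R) (A : Omega -> set X).
Context (mu : probability Omega R).
Context (Par : Type) (rho : Par -> Omega -> R).

Definition randomized_decisions : set (Omega -> weak_probability R X) :=
  [set phi | measurable_fun setT (phi : Omega -> borel (weak_probability R X))
           /\ forall w, prob_of (phi w) (A w) = 1%E].

Definition pure_decisions : set (Omega -> X) :=
  [set f | measurable_fun setT (f : Omega -> borel X)
         /\ forall w, A w (f w)].

Definition randomized_worst_cost (c : Omega * X -> R)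
    (phi : Omega -> weak_probability R X) : \bar R :=
  ereal_sup [set (\int[mu]_w
      ((\int[prob_of (phi w)]_(x in A w) (c (w, x))%:E) * (rho p w)%:E))%E
    | p in [set: Par]].

Definition pure_worst_cost (c : Omega * X -> R) (f : Omega -> X) : \bar R :=
  ereal_sup [set (\int[mu]_w (c (w, f w) * rho p w)%:E)%E | p in [set: Par]].

Definition worst_utility (u : Omega * X -> R) (f : Omega -> X) : \bar R :=
  ereal_inf [set (\int[mu]_w (u (w, f w) * rho p w)%:E)%E | p in [set: Par]].

Definition randomized_feasible (m : nat) (c : 'I_m -> Omega * X -> R)
    (a : 'I_m -> R) : set (Omega -> weak_probability R X) :=
  [set phi | randomized_decisions phi
           /\ forall i, (randomized_worst_cost (c i) phi <= (a i)%:E)%E].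

Definition pure_feasible (m : nat) (c : 'I_m -> Omega * X -> R)
    (a : 'I_m -> R) : set (Omega -> X) :=
  [set f | pure_decisions f
         /\ forall i, (pure_worst_cost (c i) f <= (a i)%:E)%E].

(* The objective is a finite integral for every pure decision function and every
   parameter. A [mu]-integrable bound on [u] does not give this, since
   [rho p] may be unbounded. *)
Definition objective_well_defined (u : Omega * X -> R) : Prop :=
  forall (f : Omega -> X) (p : Par), pure_decisions f ->
    mu.-integrable setT (fun w => (u (w, f w) * rho p w)%:E).

End decision_problem.

(* Main.v *)
(* A sub-sigma-field G is given by a measurable map [pi]: its members are the
   sets [pi @^-1` B]. Boundedness of u and inf-compactness of -u make every A(w)
   compact, so with b(w) = max u(w, .) the functions c_1, ..., c_m, b - u are
   nonnegative and lower semicontinuous on A(w); call them v = (v_i).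

   Purification: let w |-> y(w) be measurable, y(w) being bounded below by a
   point of the convex hull of v(w, A(w)) in every direction al >= 0. By
   compactness and Caratheodory, y(w) >= sum_j l_j v(w, x_j) with x_j in A(w),
   and by the measurable projection theorem x_j and l_j can be selected
   measurably. Without G-atoms the weights l_j can be moved to 0/1 values while
   the G-conditional means of all sum_j l_j v_i(w, x_j) are kept: one moves a
   mass +-eta between two weights, with eta times each difference of
   coordinates conditionally centred, which increases the energy
   sum_j int l_j^2, and Fatou handles the limit. This yields a pure f with
   E[v_i(f) | G] <= E[y_i | G], hence int v_i(f) rho_p <= int y_i rho_p for all p
   simultaneously, because the densities are G-measurable.

   With y the mean of v under a feasible randomized decision, this gives a
   feasible pure decision. For the optimum, the functions y as above satisfying
   the constraints up to 1/k form nested convex sets; near-minimisers y_k of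
   int exp(-y) are such that exp(-y_k / 2) converges almost everywhere, and by
   Fatou the limit of the y_k satisfies all the constraints, so it can be
   purified. Where the limit is infinite all the densities vanish. *)
Require Import Defs.
From HB Require Import structures.
From mathcomp Require Import all_boot all_order all_algebra.
From mathcomp Require Import all_classical all_reals all_analysis.
From mathcomp Require Import measurable_realfun simple_functions.
From mathcomp Require Import measurable_fun_approximation metric_structure.
From mathcomp Require Import zify ring lra.

Set Implicit Arguments.
Unset Strict Implicit.
Unset Printing Implicit Defensive.

Import Order.TTheory GRing.Theory Num.Theory.
Import numFieldNormedType.Exports.

Local Open Scope classical_set_scope.
Local Open Scope ring_scope.

(** * Conditional expectation along a measurable map *)

(** The parameters form an arbitrary set, so the constraints cannot be treated one density at a
    time. Purification is therefore done on G-conditional means, and a G-measurable weight is pulled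
    out only afterwards. What shapes the proof is that y need not be integrable: only its products
    with the densities are known to have finite integrals. Purification is thus carried out on
    countably many G-measurable pieces on which y is integrable, and off these pieces each density
    vanishes almost everywhere. For the same reason weak compactness in L^1 is not at hand for the
    passage to the limit. The function exp(-y) is bounded whatever y is, and exp(-y/2) behaves like
    a minimising sequence in a Hilbert space, which produces one almost everywhere limit serving all
    parameters at once. Since v is only lower semicontinuous, limits give inequalities and no
    equalities; this suffices because every coordinate, the utility deficit included, is a cost to
    be bounded from above. The hull is described by directions and not by its points because that
    description survives midpoints and limits. *)

Section factor.
Context d e (T : measurableType d) (S : measurableType e) (R : realType).
Variables (mu : {finite_measure set T -> \bar R}) (pi : T -> S).
Hypothesis mpi : measurable_fun setT pi.

Let mpre B : measurable B -> measurable (pi @^-1` B).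
Proof. by move=> mB; rewrite -[X in measurable X]setTI; exact: mpi. Qed.

Import HBNNSimple.

Lemma pullout_nnsfun (g : T -> R) (h : {nnsfun S >-> R}) :
  measurable_fun setT g -> (forall x, 0 <= g x) ->
  (\int[mu]_x (h (pi x) * g x)%:E =
  \sum_(r \in range h) r%:E * \int[mu]_(x in pi @^-1` (h @^-1` [set r])) (g x)%:E)%E.
Proof.
move=> mg g0.
have E x : (h (pi x) * g x)%:E =
    (\sum_(r \in range h) (r * \1_(pi @^-1` (h @^-1` [set r])) x * g x)%:E)%E.
  rewrite fsumEFin//; congr EFin.
  rewrite [in LHS](fimfunE h) /= -mulr_fsuml.
  by congr (_ * _).
under eq_integral do rewrite E.
rewrite ge0_integral_fsum//; last 2 first.
- move=> r; apply/measurable_EFinP; apply: measurable_funM => //.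
  apply: measurable_funM => //; apply: measurable_indic.
  exact/mpre/(measurable_sfunP h).
- move=> r x _; rewrite lee_fin mulr_ge0//.
  have [r0|r0] := leP 0 r; first by rewrite mulr_ge0.
  by rewrite preimage_nnfun0// preimage_set0 indic0 mulr0.
apply/eq_fsbigr => r /[!inE] -[y _ rE].
rewrite [in RHS]integral_mkcond -ge0_integralZl_EFin//; last 3 first.
- by move=> x _; rewrite erestrict_ge0// => *; rewrite lee_fin.
- have mD : measurable (pi @^-1` (h @^-1` [set r])).
    exact/mpre/(measurable_sfunP h).
  by apply/(measurable_restrictT _ mD)/measurable_funTS/measurable_EFinP.
- by rewrite -rE.
apply: eq_integral => x _; rewrite patchE indicE/=.
by case: ifPn => _; rewrite ?mulr1 ?mulr0 ?mul0r ?mule0.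
Qed.

Lemma pullout_le (g1 g2 : T -> R) :
  measurable_fun setT g1 -> (forall x, 0 <= g1 x) ->
  measurable_fun setT g2 -> (forall x, 0 <= g2 x) ->
  (forall B, measurable B ->
    \int[mu]_(x in pi @^-1` B) (g1 x)%:E <=
    \int[mu]_(x in pi @^-1` B) (g2 x)%:E)%E ->
  forall th : S -> R, measurable_fun setT th -> (forall y, 0 <= th y) ->
  (\int[mu]_x (th (pi x) * g1 x)%:E <= \int[mu]_x (th (pi x) * g2 x)%:E)%E.
Proof.
move=> mg1 g10 mg2 g20 g12 th mth th0.
have mth' : measurable_fun setT (EFin \o th) by exact/measurable_EFinP.
pose h n := nnsfun_approx measurableT mth' n.
have hE (g : T -> R) : measurable_fun setT g -> (forall x, 0 <= g x) ->
    (\int[mu]_x (((h n) (pi x)) * g x)%:E)%E @[n --> \oo] -->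
    (\int[mu]_x (th (pi x) * g x)%:E)%E.
  move=> mg g0.
  have hc x : ((h n (pi x)) * g x)%:E @[n --> \oo] --> (th (pi x) * g x)%:E.
    rewrite EFinM; under eq_fun do rewrite EFinM.
    apply: cvgeZr => //; apply: cvg_nnsfun_approx => // y _; rewrite lee_fin//.
  under [in X in _ --> X]eq_integral => x _ do rewrite -(cvg_lim _ (hc x))//.
  apply: cvg_monotone_convergence => //.
  - move=> n; apply/measurable_EFinP; apply: measurable_funM => //.
    exact: measurableT_comp.
  - by move=> n x _; rewrite lee_fin mulr_ge0.
  - move=> x _ m n mn; rewrite lee_fin ler_wpM2r//.
    exact/lefP/nd_nnsfun_approx.
apply: (lee_cvg_to (hE g1 mg1 g10) (hE g2 mg2 g20)).
apply: nearW => n; rewrite !pullout_nnsfun//.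
apply: lee_fsum => // r _; have [r0|r0] := leP 0 r.
  rewrite lee_wpmul2l//; apply: g12; exact: measurable_sfunP.
by rewrite preimage_nnfun0// preimage_set0 !integral_set0.
Qed.

(** Radon-Nikodym on [S], for the image under [pi] of the charge with density [g] against the image
    of [mu], yields the conditional expectation directly in the factored form [b \o pi]. *)
Lemma cond_exp_exists (g : T -> R) : mu.-integrable setT (EFin \o g) ->
  exists b : S -> R, [/\ measurable_fun setT b,
    mu.-integrable setT (EFin \o (b \o pi)) &
    forall B, measurable B ->
      (\int[mu]_(x in pi @^-1` B) (b (pi x))%:E =
       \int[mu]_(x in pi @^-1` B) (g x)%:E)%E].
Proof.
move=> ig.
pose m0 : {measure set S -> \bar R} := pushforward mu pi.
pose m := m0 mpi.
pose n0 : {charge set S -> \bar R} := pushforward (induced_charge ig) pi.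
pose n := n0 mpi.
have mfin : fin_num_fun m.
  by move=> B mB; apply: fin_num_measure; exact: mpre.
have msig : sigma_finite setT m.
  by apply: fin_num_fun_sigma_finite => //; rewrite measure0.
(* [m'] is the image measure repackaged as a finite measure, the form in which [Radon_Nikodym] takes
   it. *)
pose m1 := isFinite.Build _ _ _ _ mfin.
pose m2 := isSFinite.Build _ _ _ _ (sfinite_measure_sigma_finite msig).
pose m3 := isSigmaFinite.Build _ _ _ _ msig.
pose m' := HB.pack_for (FiniteMeasure.type S R) (Measure.sort m) m1 m2 m3.
have nm : n `<< m'.
  apply/null_content_dominatesP => B mB mB0.
  apply: null_set_integral => //; first exact: mpre.
  by apply: measurable_funTS; exact: (measurable_int mu).
pose b := Radon_Nikodym n m'.
have bfin y : b y \is a fin_num by exact: Radon_Nikodym_fin_num.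
have ib : m'.-integrable setT b by exact: Radon_Nikodym_integrable.
have bE : b = EFin \o (fine \o b) by apply/funext => y /=; rewrite fineK.
have mb := measurable_int m' ib.
have ibpi : mu.-integrable setT (b \o pi).
  apply/integrableP; split; first exact: measurableT_comp.
  case/integrableP : ib => _; rewrite ge0_integral_pushforward//.
  exact: measurableT_comp.
exists (fine \o b); split.
- by apply/measurable_EFinP; rewrite -bE.
- by rewrite -[EFin \o _]/((EFin \o (fine \o b)) \o pi) -bE.
move=> B mB; rewrite -[RHS]/(n B) (Radon_Nikodym_integral nm mB).
rewrite integral_pushforward//.
  by apply: eq_integral => x _ /=; rewrite -/b fineK.
by apply: integrableS ibpi => //; exact: mpre.
Qed.

(** The conditional mean of [g] given [pi] is zero. *)
Definition cond_centered (g : T -> R) : Prop :=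
  mu.-integrable setT (EFin \o g) /\
  forall B, measurable B -> (\int[mu]_(x in pi @^-1` B) (g x)%:E = 0)%E.

Lemma integrable_bounded_mul (g h : T -> R) (M : R) :
  mu.-integrable setT (EFin \o g) -> measurable_fun setT h ->
  (forall x, `|h x| <= M) ->
  mu.-integrable setT (fun x => (h x * g x)%:E).
Proof.
move=> ig mh hM; suff hb : [bounded h x | x in setT].
  exact: (integrableMr measurableT mh hb ig).
exists M; split; first by rewrite num_real.
by move=> y My x _ /=; rewrite (le_trans (hM x))// ltW.
Qed.

Lemma cond_centered_integral0 (g : T -> R) (th : S -> R) (M : R) :
  cond_centered g -> measurable_fun setT th -> (forall y, 0 <= th y <= M) ->
  (\int[mu]_x (th (pi x) * g x)%:E = 0)%E.
Proof.
move=> [ig g0] mth thM.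
have th0 y : 0 <= th y by case/andP: (thM y).
have mg : measurable_fun setT g by apply/measurable_EFinP; exact: measurable_int ig.
have mn : measurable_fun setT (Num.norm \o g) by exact: measurableT_comp.
have ing : mu.-integrable setT (EFin \o (Num.norm \o g)) by exact: integrable_norm.
(* Twice the positive and negative parts of [g]. They have the same conditional means, so
   [pullout_le] applies to them in both directions. *)
pose p x := `|g x| + g x; pose n x := `|g x| - g x.
have ip : mu.-integrable setT (EFin \o p) by exact: (integrableD _ ing ig).
have in_ : mu.-integrable setT (EFin \o n) by exact: (integrableB _ ing ig).
have p0 x : 0 <= p x by rewrite /p; have := ler_norm (- g x); rewrite normrN; lra.
have n0 x : 0 <= n x by rewrite /n subr_ge0 ler_norm.
have mp : measurable_fun setT p by exact: measurable_funD.
have mn' : measurable_fun setT n by exact: measurable_funB.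
have pn B : measurable B -> (\int[mu]_(x in pi @^-1` B) (p x)%:E =
    \int[mu]_(x in pi @^-1` B) (n x)%:E)%E.
  move=> mB; have mpB := mpre mB.
  have igB := integrableS measurableT mpB (@subsetT _ _) ig.
  have ingB := integrableS measurableT mpB (@subsetT _ _) ing.
  rewrite /p /n; under eq_integral do rewrite EFinD.
  under [in RHS]eq_integral do rewrite EFinB.
  by rewrite integralD_EFin// integralB_EFin//= g0// adde0 sube0.
have thp : (\int[mu]_x (th (pi x) * p x)%:E = \int[mu]_x (th (pi x) * n x)%:E)%E.
  by apply/eqP; rewrite eq_le !pullout_le// => B /pn ->.
have mthpi : measurable_fun setT (th \o pi) by exact: measurableT_comp.
have thM' x : `|(th \o pi) x| <= M.
  by case/andP: (thM (pi x)) => ? ? /=; rewrite ger0_norm.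
have ithp := integrable_bounded_mul ip mthpi thM'.
have ithn := integrable_bounded_mul in_ mthpi thM'.
have E : (fun x => (th (pi x) * g x)%:E) =
    (fun x => (2^-1)%:E * ((th (pi x) * p x)%:E - (th (pi x) * n x)%:E))%E.
  by apply/funext => x; rewrite -EFinB -EFinM; congr EFin; rewrite /p /n; field.
rewrite E integralZl//; last exact: integrableB.
rewrite integralB_EFin// thp subee ?mule0//.
exact: integrable_fin_num.
Qed.

Lemma cond_centeredM (g : T -> R) (xi : S -> R) (M : R) :
  cond_centered g -> measurable_fun setT xi -> (forall y, `|xi y| <= M) ->
  cond_centered (fun x => xi (pi x) * g x).
Proof.
move=> cg mxi xiM; have [ig _] := cg.
have mxipi : measurable_fun setT (xi \o pi) by exact: measurableT_comp.
have igx : mu.-integrable setT (fun x => (xi (pi x) * g x)%:E).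
  by apply: (integrable_bounded_mul ig mxipi (M := M)) => x /=.
split=> // B mB.
pose K := `|M|; have xiK y : `|xi y| <= K.
  by rewrite (le_trans (xiM y))// ler_norm.
have K0 : 0 <= K by exact: normr_ge0.
have mB1 : measurable_fun setT (\1_B : S -> R) by exact: measurable_indic.
(* Shifting by the bound [K] writes the signed weight [xi] on [B] as a difference of two bounded
   nonnegative weights. *)
pose th1 := (xi \+ cst K) \* \1_B; pose th2 y := K * \1_B y.
have mth1 : measurable_fun setT th1.
  by apply: measurable_funM => //; exact: measurable_funD.
have mth2 : measurable_fun setT th2 by exact: measurable_funM.
have th1K y : 0 <= th1 y <= K + K.
  move: (xiK y); rewrite ler_norml => /andP[h1 h2].
  by rewrite /th1 /= indicE; case: (_ \in _) => /=; lra.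
have th2K y : 0 <= th2 y <= K + K.
  by rewrite /th2 /= indicE; case: (_ \in _) => /=; lra.
rewrite integral_mkcond.
have E : ((fun x => (xi (pi x) * g x)%:E) \_ (pi @^-1` B)) =
  (fun x => ((th1 (pi x) * g x)%:E - (th2 (pi x) * g x)%:E))%E.
  apply/funext => x; rewrite patchE -EFinB/= /th1 /th2 /= indicE.
  have -> : (x \in pi @^-1` B) = (pi x \in B) by [].
  by case: ifPn => _ /=; congr EFin; ring.
have ith (th : S -> R) : measurable_fun setT th -> (forall y, 0 <= th y <= K + K) ->
    mu.-integrable setT (fun x => (th (pi x) * g x)%:E).
  move=> mth thK; have mt : measurable_fun setT (th \o pi) by exact: measurableT_comp.
  apply: (integrable_bounded_mul ig mt (M := K + K)) => x /=.
  by case/andP: (thK (pi x)) => ? ?; rewrite ger0_norm.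
rewrite E integralB_EFin//; [|exact: ith..].
by rewrite (cond_centered_integral0 cg mth1 th1K) (cond_centered_integral0 cg mth2 th2K) sube0.
Qed.

Lemma cond_centeredD g1 g2 : cond_centered g1 -> cond_centered g2 ->
  cond_centered (fun x => g1 x + g2 x).
Proof.
move=> [i1 g10] [i2 g20]; split; first exact: (integrableD _ i1 i2).
move=> B mB; under eq_integral do rewrite EFinD.
have mpB := mpre mB.
by rewrite integralD_EFin// ?g10 ?g20 ?adde0//; exact: (integrableS measurableT mpB (@subsetT _ _)).
Qed.

End factor.

(** * Splitting sets in the absence of relative atoms *)

Lemma dependent_choice_nat (X : Type) (P : X -> Prop) (Q : nat -> X -> X -> Prop)
    (x0 : X) : P x0 -> (forall n x, P x -> exists y, P y /\ Q n x y) ->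
  exists v : nat -> X, [/\ v 0%N = x0, forall n, P (v n) &
                           forall n, Q n (v n) (v n.+1)].
Proof.
move=> Px0 PQ.
have /choice[F hF] : forall nx : nat * X, exists y, P nx.2 -> P y /\ Q nx.1 nx.2 y.
  move=> [n x]; have [/PQ-/(_ n)[y ?]|nPx] := pselect (P x); first by exists y.
  by exists x.
pose v := fix v n := if n is m.+1 then F (m, v m) else x0.
have Pv n : P (v n) by elim: n => // n /(hF (n, _))[].
by exists v; split => // n; have [] := hF (n, v n) (Pv n).
Qed.

(** Each step passes to an extension whose value is within [1/(n+1)] of the supremum over all
    extensions. An extension of the union extends every member of the sequence, so its value exceeds
    that of the union by at most every [1/(n+1)]. *)
Lemma exhaustion (R : realType) (T : Type) (C : set (set T)) (s : set T -> R) (K : R) :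
  C !=set0 -> (forall D, C D -> s D <= K) ->
  (forall D E, C D -> C E -> D `<=` E -> s D <= s E) ->
  (forall F : nat -> set T, (forall n, C (F n)) ->
    (forall n, F n `<=` F n.+1) -> C (\bigcup_n F n)) ->
  exists2 D, C D & forall E, C E -> D `<=` E -> s E <= s D.
Proof.
move=> [D0 CD0] sK smono Ccup.
pose up D := [set s E | E in [set E | C E /\ D `<=` E]].
have [|n D CD|F [_ CF QF]] := @dependent_choice_nat _ C (fun n D D' => D `<=` D' /\
    forall E, C E -> D `<=` E -> s E <= s D' + n.+1%:R^-1) D0.
- by [].
- have sup_up : has_sup (up D).
    split; first by exists (s D), D => //; split => //; exact: subset_refl.
    by exists K => _ [E [CE _] <-]; exact: sK.
  have n0 : (0 : R) < n.+1%:R^-1 by rewrite invr_gt0.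
  have [_ [E [CE DE] <-] hE] := sup_adherent n0 sup_up.
  exists E; split => //; split => // E' CE' DE'.
  rewrite -lerBlDr; apply: ltW; apply: le_lt_trans hE; rewrite lerB//.
  by apply: sup_upper_bound => //; exists E'.
have FS n : F n `<=` F n.+1 by have [] := QF n.
have CU := Ccup F CF FS.
exists (\bigcup_n F n) => // E CE UE.
apply/ler_addgt0Pr => e e0.
have [n ne] : exists n, n.+1%:R^-1 <= e.
  have [N _ HN] := near_infty_natSinv_lt (PosNum e0).
  by exists N; apply/ltW/(HN N) => /=.
have FU m : F m `<=` \bigcup_n F n by exact: bigcup_sup.
have [_ /(_ E CE (subset_trans (FU n) UE)) h] := QF n.
by rewrite (le_trans h)// lerD// smono.
Qed.

Section halving.
Context d e (T : measurableType d) (S : measurableType e) (R : realType).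
Variables (mu : {finite_measure set T -> \bar R}) (pi : T -> S).
Hypothesis mpi : measurable_fun setT pi.
Hypothesis noatom : forall D, measurable D -> (0 < mu D)%E ->
  exists2 D1, measurable D1 & forall B, measurable B ->
    mu ((D `&` D1) `+` (D `&` pi @^-1` B)) != 0%E.

Let mpre B : measurable B -> measurable (pi @^-1` B).
Proof. by move=> mB; rewrite -[X in measurable X]setTI; exact: mpi. Qed.

(** A Hahn decomposition on [S]: [C] is where the conditional mean of [g] is nonpositive. *)
Lemma cond_sign (g : T -> R) : mu.-integrable setT (EFin \o g) ->
  exists C : set S, [/\ measurable C,
    forall B, measurable B -> B `<=` C -> \int[mu]_(x in pi @^-1` B) g x <= 0 &
    forall B, measurable B -> B `<=` ~` C -> 0 <= \int[mu]_(x in pi @^-1` B) g x].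
Proof.
move=> ig; have [b [mb ib bE]] := cond_exp_exists mpi ig.
exists [set y | b y <= 0]; split.
- rewrite -[X in measurable X]setTI.
  have -> : [set y | b y <= 0] = b @^-1` `]-oo, 0]%classic.
    by apply/seteqP; split=> y /=; rewrite in_itv.
  exact: mb.
- move=> B mB BC; rewrite /Rintegral -bE// -/(Rintegral mu _ (fun x => b (pi x))).
  rewrite -oppr_ge0 -mulN1r -RintegralZl//; [|exact: mpre|]; last first.
    exact: (integrableS measurableT (mpre mB)).
  by apply: Rintegral_ge0 => x /BC/=; rewrite mulN1r oppr_ge0.
- move=> B mB BC; rewrite /Rintegral -bE// -/(Rintegral mu _ (fun x => b (pi x))).
  by apply: Rintegral_ge0 => x /BC/= /negP; rewrite -ltNge => /ltW.
Qed.

Section weight.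
Variable f : T -> R.
Hypotheses (intf : mu.-integrable setT (EFin \o f)) (f0 : forall x, 0 <= f x).

Let I E := \int[mu]_(x in E) f x.

Let mf : measurable_fun setT (EFin \o f). Proof. exact: measurable_int intf. Qed.

Let iS E : measurable E -> mu.-integrable E (EFin \o f).
Proof. by move=> mE; exact: (integrableS measurableT mE). Qed.

Let I_ge0 E : 0 <= I E. Proof. by apply: Rintegral_ge0. Qed.

Let I_split E F : measurable E -> measurable F ->
  I E = I (E `&` F) + I (E `\` F).
Proof.
move=> mE mF; rewrite -{1}(setUIDK E F) /I Rintegral_setU//.
- exact: measurableI.
- exact: measurableD.
- by apply: iS; apply: measurableU; [exact: measurableI|exact: measurableD].
- by apply/eqP/seteqP; split => // x [[_ ?] []].
Qed.

Let I_le E F : measurable E -> measurable F -> E `<=` F -> I E <= I F.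
Proof.
by move=> mE mF EF; rewrite (I_split mF mE) (setIidr EF) lerDl.
Qed.

Let I_cvg (F : nat -> set T) : (forall n, measurable (F n)) ->
  (forall n, F n `<=` F n.+1) -> I (F n) @[n --> \oo] --> I (\bigcup_n F n).
Proof.
move=> mF FS; apply: fine_cvg.
rewrite fineK; last by (apply: integrable_fin_num; [exact: bigcupT_measurable|exact/iS/bigcupT_measurable]).
apply: ge0_nondecreasing_set_cvg_integral => //.
- by apply/nondecreasing_seqP => n; rewrite subsetEset.
- by move=> n; exact: measurable_funTS.
- by move=> n x _; rewrite lee_fin.
Qed.

Let I_eq0 E : measurable E -> (forall x, E x -> 0 < f x) -> I E = 0 -> mu E = 0%E.
Proof.
move=> mE Ef IE0.
have : (\int[mu]_(x in E) `|(EFin \o f) x| = 0)%E.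
  under eq_integral do rewrite gee0_abs ?lee_fin//=.
  rewrite -[LHS]fineK; last exact: (integrable_fin_num mE (iS mE)).
  by rewrite -[fine _]/(I E) IE0.
move/(ae_eq_integral_abs _ mE (measurable_funTS mf)) => [N [mN N0 EN]].
apply/eqP; rewrite -measure_le0 -N0 le_measure ?inE// => x Ex; apply: EN => /= /(_ Ex) /eqP.
by rewrite eqe gt_eqF// Ef.
Qed.

(** [cond_sign] for [f 1_D - a f 1_D']: on [C] the conditional mean of [f 1_D] is at most [a] times
    that of [f 1_D']. *)
Lemma cond_compare (D D' : set T) (a : R) : measurable D -> measurable D' ->
  exists C : set S, [/\ measurable C,
    forall B, measurable B -> B `<=` C ->
      I (pi @^-1` B `&` D) <= a * I (pi @^-1` B `&` D') &
    forall B, measurable B -> B `<=` ~` C ->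
      a * I (pi @^-1` B `&` D') <= I (pi @^-1` B `&` D)].
Proof.
move=> mD mD'.
have iI E : measurable E -> mu.-integrable setT (EFin \o (f \_ E)).
  move=> mE; rewrite -restrict_EFin; apply/integrable_restrict => //.
  by rewrite setTI; exact: iS.
have IE E B : measurable E -> \int[mu]_(x in B) (f \_ E) x = I (B `&` E).
  by move=> mE; rewrite /I Rintegral_mkcondr.
have ig : mu.-integrable setT (EFin \o (f \_ D \- (fun x => a * (f \_ D') x))).
  exact: (integrableB measurableT (iI D mD) (integrableZl measurableT a (iI D' mD'))).
have [C [mC C1 C2]] := cond_sign ig.
have E B : measurable B -> \int[mu]_(x in pi @^-1` B)
    (f \_ D \- (fun x => a * (f \_ D') x)) x =
    I (pi @^-1` B `&` D) - a * I (pi @^-1` B `&` D').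
  move=> mB; have mpB := mpre mB.
  have iD := integrableS measurableT mpB (@subsetT _ _) (iI D mD).
  have iD' := integrableS measurableT mpB (@subsetT _ _) (iI D' mD').
  rewrite RintegralB//; last exact: (integrableZl mpB a iD').
  by rewrite RintegralZl// !IE.
exists C; split => // B mB /[dup] BC.
- by move/(C1 B mB); rewrite E// subr_le0.
- by move/(C2 B mB); rewrite E// subr_ge0.
Qed.

(* Take [D] maximal with [E(f 1_D | pi) <= 3/4 E(f | pi)]. If [E(f 1_D | pi)] were
   below [1/4 E(f | pi)] on a set, a part [D1] of its complement not of the form
   [pi @^-1` B] or the corresponding remainder, cut to where it carries at most
   half of [f], could be added to [D]. *)
Lemma halving : exists2 D, measurable D & forall B, measurable B ->
  4^-1 * I (pi @^-1` B) <= I (pi @^-1` B `&` D) /\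
  4^-1 * I (pi @^-1` B) <= I (pi @^-1` B `\` D).
Proof.
pose C_ := [set D | measurable D /\
  forall B, measurable B -> I (pi @^-1` B `&` D) <= 3/4 * I (pi @^-1` B)].
have [|D [mD _]||F CF FS|D [mD CD] maxD] := @exhaustion _ T C_ I (I setT).
- exists set0; split => // B mB; rewrite setI0 {1}/I Rintegral_set0.
  by rewrite mulr_ge0// ?divr_ge0.
- exact: I_le.
- by move=> D E [mD _] [mE _]; exact: I_le.
- have mF n : measurable (F n) by have [] := CF n.
  split; first exact: bigcupT_measurable.
  move=> B mB; rewrite setI_bigcupr.
  have mBF n : measurable (pi @^-1` B `&` F n) by apply: measurableI => //; exact: mpre.
  apply: (cvgr_to_le (I_cvg mBF (fun n => setIS (FS n)))).
  by apply: nearW => n; have [_ /(_ B mB)] := CF n.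
exists D => // B0 mB0; split; last first.
  have mpB := mpre mB0; have mI := measurableI _ _ mpB mD.
  have := I_split mpB mD; have := CD B0 mB0; lra.
rewrite leNgt; apply/negP => B0lt.
have [C0 [mC0 C01 C02]] := cond_compare 4^-1 mD measurableT.
pose B2 := B0 `&` C0.
have mB2 : measurable B2 by exact: measurableI.
have pI (B B' : set S) E : pi @^-1` (B `&` B') `&` E = (pi @^-1` B `&` E) `&` pi @^-1` B'.
  by rewrite preimage_setI -!setIA [_ `&` E]setIC.
have pD (B B' : set S) E : pi @^-1` (B `\` B') `&` E = (pi @^-1` B `&` E) `\` pi @^-1` B'.
  by rewrite !setDE preimage_setI -!setIA [_ `&` E]setIC.
have splitB B B' E : measurable B -> measurable B' -> measurable E ->
    I (pi @^-1` B `&` E) = I (pi @^-1` (B `&` B') `&` E) + I (pi @^-1` (B `\` B') `&` E).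
  move=> mB mB' mE; rewrite pI pD; apply: I_split; last exact: mpre.
  by apply: measurableI => //; exact: mpre.
have B2lt : I (pi @^-1` B2 `&` D) < 4^-1 * I (pi @^-1` B2).
  have := C02 (B0 `\` C0) (measurableD mB0 mC0) (@subIsetr _ _ _).
  have := splitB B0 C0 D mB0 mC0 mD; have := splitB B0 C0 setT mB0 mC0 measurableT.
  rewrite !setIT -/B2; move: B0lt; lra.
have B2le B : measurable B -> I (pi @^-1` (B `&` B2) `&` D) <= 4^-1 * I (pi @^-1` (B `&` B2)).
  move=> mB; have := C01 (B `&` B2) (measurableI _ _ mB mB2).
  by rewrite setIT; apply => x [_ []].
(* Keeping only the points with [0 < f x] makes a subset on which [f] integrates to zero negligible
   for [mu]. *)
pose D0 := (pi @^-1` B2 `\` D) `&` [set x | 0 < f x].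
have mf0 : measurable [set x | 0 < f x].
  rewrite -[X in measurable X]setTI.
  have -> : [set x | 0 < f x] = f @^-1` `]0, +oo[%classic.
    by apply/seteqP; split=> y /=; rewrite in_itv/= andbT.
  by move/measurable_EFinP : mf; apply.
have mD0 : measurable D0.
  by apply: measurableI => //; apply: measurableD => //; exact: mpre.
have If0 E : measurable E -> I (E `&` [set x | 0 < f x]) = I E.
  move=> mE; rewrite [RHS](I_split mE mf0) [X in _ = _ + X](_ : _ = 0) ?addr0//.
  rewrite /I; under eq_Rintegral => x.
    rewrite inE => -[_ /=] /negP; rewrite -leNgt => fx0.
    have -> : f x = 0 by apply/eqP; rewrite eq_le fx0 f0.
    over.
  by rewrite Rintegral_cst ?mul0r//; exact: measurableD.
have muD0 : (0 < mu D0)%E.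
  rewrite lt0e measure_ge0 andbT; apply/eqP => D00.
  have : I D0 = 0 by rewrite /I /Rintegral null_set_integral//; exact: measurable_funTS.
  rewrite If0; last by apply: measurableD => //; exact: mpre.
  have := I_split (mpre mB2) mD; have := I_ge0 (pi @^-1` B2 `&` D).
  move: B2lt; lra.
have [D1 mD1 D1P] := noatom mD0 muD0.
have mD' := measurableI _ _ mD0 mD1; have mD'' := measurableD mD0 mD1.
have [C [mC C1 C2]] := cond_compare 1 mD' mD''.
(* A piece carrying conditionally at most half of [f] may be adjoined to [D], since 1/4 + 1/2 = 3/4;
   maximality of [D] then makes it negligible. *)
have IP (P : set T) : measurable P -> P `<=` D0 ->
    (forall B, measurable B -> I (pi @^-1` B `&` P) <= 2^-1 * I (pi @^-1` (B `&` B2))) ->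
    mu P = 0%E.
  move=> mP PD0 hP.
  have PD : P `&` D = set0.
    by apply/seteqP; split => // x [/PD0[[_ ?] _]].
  have IU E : measurable E -> I (E `&` (D `|` P)) = I (E `&` D) + I (E `&` P).
    move=> mE; rewrite (I_split (measurableI _ _ mE (measurableU _ _ mD mP)) mD).
    congr (I _ + I _); apply/seteqP; split => x /=.
    - by move=> [[]].
    - by move=> [? ?]; split => //; split => //; left.
    - by move=> [[? []]].
    - move=> [? Px]; split; first by split => //; right.
      by move=> Dx; rewrite -[False]/(set0 x) -PD.
  apply: I_eq0 => //; first by move=> x /PD0[].
  apply/eqP; rewrite eq_le I_ge0 andbT.
  have := maxD (D `|` P) _ (@subsetUl _ _ _).
  have := IU setT measurableT; rewrite !setTI => ->.
  suff CDP : C_ (D `|` P) by move=> /(_ CDP); lra.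
  split; first exact: measurableU.
  move=> B mB; rewrite (IU _ (mpre mB)).
  have := hP B mB; have := B2le B mB; have := CD (B `\` B2) (measurableD mB mB2).
  have := splitB B B2 D mB mB2 mD; have := splitB B B2 setT mB mB2 measurableT.
  rewrite !setIT; lra.
have half B : measurable B -> I (pi @^-1` B `&` (D0 `&` D1)) + I (pi @^-1` B `&` (D0 `\` D1)) <=
    I (pi @^-1` (B `&` B2)).
  move=> mB; have mpB := mpre mB.
  have -> : pi @^-1` B `&` (D0 `&` D1) = (pi @^-1` B `&` D0) `&` D1 by rewrite setIA.
  have -> : pi @^-1` B `&` (D0 `\` D1) = (pi @^-1` B `&` D0) `\` D1 by rewrite setIDA.
  rewrite -I_split//; last exact: measurableI.
  apply: I_le; [exact: measurableI|exact: mpre (measurableI _ _ mB mB2)|].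
  by move=> x [Bx [[B2x _] _]].
have mpC := mpre mC.
have P1 : mu ((D0 `&` D1) `&` pi @^-1` C) = 0%E.
  apply: IP; [exact: measurableI|by move=> x [[]]|move=> B mB].
  have -> : pi @^-1` B `&` (D0 `&` D1 `&` pi @^-1` C) = pi @^-1` (B `&` C) `&` (D0 `&` D1).
    by apply/seteqP; split => x; [move=> [? [[? ?] ?]]|move=> [[? ?] [? ?]]].
  have mBC := measurableI _ _ mB mC.
  have := C1 _ mBC (@subIsetr _ _ _); have := half _ mBC.
  have : I (pi @^-1` (B `&` C `&` B2)) <= I (pi @^-1` (B `&` B2)).
    apply: I_le; [exact: mpre (measurableI _ _ mBC mB2)|exact: mpre (measurableI _ _ mB mB2)|].
    by move=> x [[]].
  lra.
have P2 : mu ((D0 `\` D1) `\` pi @^-1` C) = 0%E.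
  apply: IP; [exact: measurableD|by move=> x [[]]|move=> B mB].
  have -> : pi @^-1` B `&` (D0 `\` D1 `\` pi @^-1` C) = pi @^-1` (B `\` C) `&` (D0 `\` D1).
    by apply/seteqP; split => x; [move=> [? [[? ?] ?]]|move=> [[? ?] [? ?]]].
  have mBC := measurableD mB mC.
  have := C2 _ mBC (@subIsetr _ _ _); have := half _ mBC.
  have : I (pi @^-1` ((B `\` C) `&` B2)) <= I (pi @^-1` (B `&` B2)).
    apply: I_le; [exact: mpre (measurableI _ _ mBC mB2)|exact: mpre (measurableI _ _ mB mB2)|].
    by move=> x [[]].
  lra.
(* By [P1] and [P2], up to a null set [D1] agrees on [D0] with the preimage of the complement of
   [C], which the choice of [D1] forbids. *)
have := D1P _ (measurableC mC); rewrite preimage_setC; apply/negP; rewrite negbK.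
rewrite (_ : _ `+` _ = ((D0 `&` D1) `&` pi @^-1` C) `|` ((D0 `\` D1) `\` pi @^-1` C)).
  rewrite measureU//.
  - by apply/eqP; rewrite [X in (X + _)%E]P1 [X in (_ + X)%E]P2 adde0.
  - exact: measurableI.
  - exact: measurableD.
  - by apply/seteqP; split => // x [[[_ ?] _] [[_ ?] _]].
rewrite /setY; apply/seteqP; split => x /=.
- move=> [[[D0x D1x] h]|[[D0x Cx] h]].
  + by left; split => //; apply: contrapT => ?; apply: h.
  + by right; split => //; split => // ?; apply: h.
- move=> [[[D0x D1x] Cx]|[[D0x D1x] Cx]].
  + by left; split => // -[].
  + by right; split => // -[].
Qed.
End weight.
End halving.

Lemma measurable_fun_invr d (T : measurableType d) (R : realType) (f : T -> R) :
  measurable_fun setT f -> measurable_fun setT (fun x => (f x)^-1).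
Proof.
(* Writing the inverse as [f] times the inverse of its square allows the use of [powR] on
   nonnegative bases; at a zero of [f] both sides are 0. *)
move=> mf; have -> : (fun x => (f x)^-1) = (fun x => f x * ((f x ^+ 2) `^ (-1))).
  apply/funext => x; rewrite powR_inv1 ?sqr_ge0//.
  by have [->|fx0] := eqVneq (f x) 0; [rewrite invr0 mul0r|field].
apply: measurable_funM => //.
have m1 : measurable_fun setT (fun x => f x ^+ 2) by exact: measurable_funX.
exact: (measurableT_comp (measurable_powR (-1)) m1).
Qed.

(** * Conditionally centred perturbations with a lower bound on their energy *)

Section perturbation.
Context d e (T : measurableType d) (S : measurableType e) (R : realType).
Variables (mu : {finite_measure set T -> \bar R}) (pi : T -> S).
Hypothesis mpi : measurable_fun setT pi.
Hypothesis noatom : forall D, measurable D -> (0 < mu D)%E ->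
  exists2 D1, measurable D1 & forall B, measurable B ->
    mu ((D `&` D1) `+` (D `&` pi @^-1` B)) != 0%E.

Let mpre B : measurable B -> measurable (pi @^-1` B).
Proof. by move=> mB; rewrite -[X in measurable X]setTI; exact: mpi. Qed.

Lemma bounded_integrable (h : T -> R) (M : R) : measurable_fun setT h ->
  (forall x, `|h x| <= M) -> mu.-integrable setT (EFin \o h).
Proof.
move=> mh hM.
have i1 : mu.-integrable setT (EFin \o (cst 1 : T -> R)).
  exact: finite_measure_integrable_cst.
have := integrable_bounded_mul i1 mh hM.
by under eq_fun do rewrite mulr1.
Qed.

Lemma cond_centeredB_cexp (g : T -> R) (b : S -> R) :
  mu.-integrable setT (EFin \o g) ->
  mu.-integrable setT (EFin \o (b \o pi)) ->
  (forall B, measurable B -> (\int[mu]_(x in pi @^-1` B) (b (pi x))%:E =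
       \int[mu]_(x in pi @^-1` B) (g x)%:E)%E) ->
  cond_centered mu pi (fun x => g x - b (pi x)).
Proof.
move=> ig ib bg; split; first exact: (integrableB _ ig ib).
move=> B mB; have mpB := mpre mB.
have igB := integrableS measurableT mpB (@subsetT _ _) ig.
have ibB := integrableS measurableT mpB (@subsetT _ _) ib.
under eq_integral do rewrite EFinB.
rewrite integralB_EFin//= bg// subee//.
exact: (integrable_fin_num mpB igB).
Qed.

(* Induction on [k]: [b] is cut into two halves by [halving], and the two
   perturbations obtained are combined with [pi]-measurable coefficients, one of
   them equal to 1, that cancel the conditional mean against [g k]. *)
Lemma perturbation (k : nat) (g : nat -> T -> R) (b : T -> R) :
  (forall j, (j < k)%N -> measurable_fun setT (g j)) ->
  measurable_fun setT b -> (forall x, 0 <= b x <= 1) ->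
  (forall j, (j < k)%N -> mu.-integrable setT (EFin \o (fun x => g j x * b x))) ->
  exists eta : T -> R, [/\ measurable_fun setT eta,
    forall x, `|eta x| <= b x,
    forall j, (j < k)%N -> cond_centered mu pi (fun x => g j x * eta x) &
    forall B, measurable B -> 4^-1 ^+ k * \int[mu]_(x in pi @^-1` B) (b x ^+ 2) <=
      \int[mu]_(x in pi @^-1` B) (eta x ^+ 2)].
Proof.
elim: k b => [|k IH] b mg mb b01 igb.
  exists b; split => // [x|B mB]; first by rewrite ger0_norm//; case/andP: (b01 x).
  by rewrite expr0 mul1r.
have b1 x : `|b x| <= 1 by case/andP: (b01 x) => ? ?; rewrite ger0_norm.
have sq1 (h : T -> R) x : `|h x| <= 1 -> `|h x ^+ 2| <= 1.
  by move=> ?; rewrite normrX exprn_ile1.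
have msq (h : T -> R) : measurable_fun setT h -> measurable_fun setT (fun x => h x ^+ 2).
  by move=> mh; exact: measurable_funX.
have isq (h : T -> R) : measurable_fun setT h -> (forall x, `|h x| <= 1) ->
    mu.-integrable setT (EFin \o (fun x => h x ^+ 2)).
  by move=> mh h1; apply: (bounded_integrable (msq _ mh) (M := 1)) => x; exact: sq1.
(* The square of [b] is halved, and not [b], because the lower bound to be propagated concerns the
   integral of [eta ^+ 2]. *)
have [D mD hD] := halving mpi noatom (isq b mb b1) (fun x => sqr_ge0 (b x)).
have sub E : measurable E -> exists eta : T -> R, [/\ measurable_fun setT eta,
    forall x, `|eta x| <= b x * \1_E x,
    forall j, (j < k)%N -> cond_centered mu pi (fun x => g j x * eta x) &
    forall B, measurable B -> 4^-1 ^+ k * \int[mu]_(x in pi @^-1` B `&` E) (b x ^+ 2) <=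
      \int[mu]_(x in pi @^-1` B) (eta x ^+ 2)].
  move=> mE; have m1 : measurable_fun setT (\1_E : T -> R) by exact: measurable_indic.
  have m1b : measurable_fun setT (fun x => b x * \1_E x) by exact: measurable_funM.
  have [|x|j jk|eta [e1 e2 e3 e4]] := IH _ _ m1b.
  - by move=> j jk; apply: mg; rewrite ltnS ltnW.
  - by case/andP: (b01 x) => ? ?; rewrite indicE; case: (_ \in _); rewrite ?mulr1 ?mulr0 ?lexx ?ler01//; apply/andP.
  - apply: le_integrable (igb j _) => //; last by rewrite ltnS ltnW.
    + apply/measurable_EFinP; apply: measurable_funM => //.
      by apply: mg; rewrite ltnS ltnW.
    + by move=> x _ /=; rewrite lee_fin indicE; case: (_ \in _); rewrite ?mulr1// !mulr0 normr0.
  exists eta; split => // B mB; apply: le_trans (e4 B mB).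
  rewrite ler_wpM2l ?exprn_ge0// Rintegral_mkcondr le_eqVlt; apply/orP; left; apply/eqP.
  apply: eq_Rintegral => x _; rewrite patchE indicE; case: ifPn => _; rewrite ?mulr1//.
  by rewrite mulr0 expr0n.
have [e1 [me1 e1b e1c e1E]] := sub D mD.
have [e2 [me2 e2b e2c e2E]] := sub (~` D) (measurableC mD).
have ig E (eta : T -> R) : measurable_fun setT eta -> (forall x, `|eta x| <= b x * \1_E x) ->
    mu.-integrable setT (EFin \o (fun x => g k x * eta x)).
  move=> me he; apply: le_integrable (igb k _) => //.
  - by apply/measurable_EFinP; apply: measurable_funM => //; exact: mg.
  - move=> x _ /=; rewrite lee_fin !normrM ler_wpM2l// (le_trans (he x))//.
    case/andP: (b01 x) => ? ?; rewrite [leRHS]ger0_norm//.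
    by rewrite indicE; case: (_ \in _); rewrite ?mulr1 ?mulr0.
have [c1 [mc1 ic1 c1E]] := cond_exp_exists mpi (ig _ _ me1 e1b).
have [c2 [mc2 ic2 c2E]] := cond_exp_exists mpi (ig _ _ me2 e2b).
pose C := [set y | `|c1 y| <= `|c2 y|].
have mcle : measurable_fun setT (fun y => `|c1 y| <= `|c2 y|).
  by apply: measurable_fun_ler; exact: measurableT_comp.
have mC : measurable C.
  by rewrite -[X in measurable X]setTI; exact: (mcle measurableT [set true]).
(* [x1] and [x2] solve [x1 c1 + x2 c2 = 0]. The coefficient 1 goes to the half with the smaller
   conditional mean, so the other one is at most 1 in absolute value; if both means vanish, the
   inverse of 0 being 0 does no harm. *)
pose x1 y := if `|c1 y| <= `|c2 y| then 1 else - c2 y / c1 y.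
pose x2 y := if `|c1 y| <= `|c2 y| then - c1 y / c2 y else 1.
have mx1 : measurable_fun setT x1.
  apply: measurable_fun_ifT => //; apply: measurable_funM; first exact: measurableT_comp.
  exact: measurable_fun_invr.
have mx2 : measurable_fun setT x2.
  apply: measurable_fun_ifT => //; apply: measurable_funM; first exact: measurableT_comp.
  exact: measurable_fun_invr.
have x1b y : `|x1 y| <= 1.
  rewrite /x1; case: ifPn; rewrite ?normr1// -ltNge => c21.
  rewrite normrM normrN normfV ler_pdivrMr ?mul1r; last exact: le_lt_trans c21.
  exact: ltW.
have x2b y : `|x2 y| <= 1.
  rewrite /x2; case: ifPn; rewrite ?normr1// => c21.
  rewrite normrM normrN normfV; have [->|c20] := eqVneq (c2 y) 0.
    by rewrite normr0 invr0 mulr0.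
  by rewrite ler_pdivrMr ?mul1r// normr_gt0.
have x12 y : x1 y * c1 y + x2 y * c2 y = 0.
  rewrite /x1 /x2; case: ifPn => c21 .
    have [c20|c20] := eqVneq (c2 y) 0; last by field.
    by move: c21; rewrite c20 normr0 normr_le0 => /eqP ->; rewrite !mulr0 addr0.
  have [c10|c10] := eqVneq (c1 y) 0; last by field.
  by move: c21; rewrite c10 normr0 normr_ge0.
pose eta x := x1 (pi x) * e1 x + x2 (pi x) * e2 x.
have mx1p : measurable_fun setT (x1 \o pi) by exact: measurableT_comp.
have mx2p : measurable_fun setT (x2 \o pi) by exact: measurableT_comp.
have meta : measurable_fun setT eta.
  by apply: measurable_funD; exact: measurable_funM.
(* The two perturbations live on [D] and on its complement, so their squares add up without a cross
   term. *)
have e12 x : (e1 x = 0 /\ `|e2 x| <= b x) \/ (e2 x = 0 /\ `|e1 x| <= b x).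
  move: (e1b x) (e2b x); rewrite !indicE in_setC; case: (_ \in _); rewrite ?mulr1 ?mulr0 normr_le0.
    by move=> ? /eqP; right.
  by move=> /eqP; left.
exists eta; split => //.
- move=> x; rewrite /eta; case: (e12 x) => -[-> ?]; rewrite mulr0 ?addr0 ?add0r normrM.
    by rewrite -[b x]mul1r ler_pM.
  by rewrite -[b x]mul1r ler_pM.
- move=> j; rewrite ltnS leq_eqVlt => /predU1P[->|jk].
  + have -> : (fun x => g k x * eta x) = (fun x =>
        x1 (pi x) * (g k x * e1 x - c1 (pi x)) + x2 (pi x) * (g k x * e2 x - c2 (pi x))).
      apply/funext => x; rewrite /eta -[LHS]subr0 -(x12 (pi x)); ring.
    apply: (cond_centeredD mpi); apply: (cond_centeredM mpi (M := 1)) => //.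
    * exact: (cond_centeredB_cexp (ig _ _ me1 e1b)).
    * exact: (cond_centeredB_cexp (ig _ _ me2 e2b)).
  + have -> : (fun x => g j x * eta x) = (fun x =>
        x1 (pi x) * (g j x * e1 x) + x2 (pi x) * (g j x * e2 x)).
      by apply/funext => x; rewrite /eta; ring.
    by apply: (cond_centeredD mpi); apply: (cond_centeredM mpi (M := 1)) => //; [exact: e1c|exact: e2c].
- move=> B mB.
  have split_ (h : T -> R) E F : measurable E -> measurable F ->
      mu.-integrable setT (EFin \o h) ->
      \int[mu]_(x in E) h x = \int[mu]_(x in E `&` F) h x + \int[mu]_(x in E `\` F) h x.
    move=> mE mF ih; rewrite -{1}(setUIDK E F) Rintegral_setU//.
    - exact: measurableI.
    - exact: measurableD.
    - apply: (integrableS measurableT) => //.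
      by apply: measurableU; [exact: measurableI|exact: measurableD].
    - by apply/eqP/seteqP; split => // x [[_ ?] []].
  have le1 (h : T -> R) x : `|h x| <= b x -> `|h x| <= 1.
    by move=> hb; rewrite (le_trans hb)//; case/andP: (b01 x).
  have eta1 x : `|eta x| <= 1.
    apply: le1; rewrite /eta; case: (e12 x) => -[-> ?]; rewrite mulr0 ?addr0 ?add0r normrM.
      by rewrite -[b x]mul1r ler_pM.
    by rewrite -[b x]mul1r ler_pM.
  have e11 x : `|e1 x| <= 1.
    by case: (e12 x) => -[h1 h2]; [rewrite h1 normr0|exact: le1].
  have e21 x : `|e2 x| <= 1.
    by case: (e12 x) => -[h1 h2]; [exact: le1|rewrite h1 normr0].
  have ieta := isq _ meta eta1; have ie1 := isq _ me1 e11; have ie2 := isq _ me2 e21.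
  have ib := isq _ mb b1.
  have mpB := mpre mB; have mpC := mpre mC.
  have mBC := measurableI _ _ mB mC; have mBD := measurableD mB mC.
  have mpBC := mpre mBC; have mpBD := mpre mBD.
  rewrite (split_ _ _ _ mpB mpC ieta) (split_ _ _ _ mpB mpC ib).
  have h1 : \int[mu]_(x in pi @^-1` (B `&` C)) (e1 x ^+ 2) <=
      \int[mu]_(x in pi @^-1` (B `&` C)) (eta x ^+ 2).
    apply: le_Rintegral => //; [exact: (integrableS measurableT)..|].
    move=> x [_ Cx]; rewrite /eta; have -> : x1 (pi x) = 1 by rewrite /x1 ifT.
    rewrite mul1r; case: (e12 x) => -[-> _]; last by rewrite mulr0 addr0.
    by rewrite expr0n sqr_ge0.
  have h2 : \int[mu]_(x in pi @^-1` (B `\` C)) (e2 x ^+ 2) <=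
      \int[mu]_(x in pi @^-1` (B `\` C)) (eta x ^+ 2).
    apply: le_Rintegral => //; [exact: (integrableS measurableT)..|].
    move=> x [_ /negP Cx]; rewrite /eta; have -> : x2 (pi x) = 1 by rewrite /x2 ifN.
    rewrite mul1r; case: (e12 x) => -[-> _]; first by rewrite mulr0 add0r.
    by rewrite expr0n sqr_ge0.
  have [h3 _] := hD _ mBC; have [_ h4] := hD _ mBD.
  have := e1E _ mBC; have := e2E _ mBD; rewrite -[_ `&` ~` D]/(_ `\` D).
  have q0 : 0 <= (4^-1 : R) ^+ k by exact: exprn_ge0.
  have := ler_wpM2l q0 h3; have := ler_wpM2l q0 h4.
  move: h1 h2; rewrite exprSr; lra.
Qed.
End perturbation.

(** * Purification of measurable weights *)

Lemma cvg_sumr (R : realType) (T : Type) (F : set_system T) (FF : Filter F)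
    (I : Type) (r : seq I) (P : pred I) (f : I -> T -> R) (l : I -> R) :
  (forall i, P i -> f i x @[x --> F] --> l i) ->
  \sum_(i <- r | P i) f i x @[x --> F] --> \sum_(i <- r | P i) l i.
Proof.
move=> fl; elim: r => [|i r IH].
  by under eq_fun do rewrite big_nil; rewrite big_nil; exact: cvg_cst.
rewrite big_cons; under eq_fun do rewrite big_cons.
by case: ifP => // Pi; apply: cvgD => //; exact: fl.
Qed.

Lemma measurable_fun_select d (T : measurableType d) (R : realType) (I : finType)
    (tau : T -> I) (g : I -> T -> R) : (forall j, measurable (tau @^-1` [set j])) ->
  (forall j, measurable_fun setT (g j)) -> measurable_fun setT (fun x => g (tau x) x).
Proof.
move=> mtau mg.
have -> : (fun x => g (tau x) x) = (fun x => \sum_j g j x * \1_(tau @^-1` [set j]) x).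
  apply/funext => x; rewrite (bigD1 (tau x))//= indicE mem_set//= mulr1 big1 ?addr0// => j jt.
  by rewrite indicE memNset ?mulr0//= => /esym/eqP; rewrite (negPf jt).
apply: measurable_sum => j; apply: measurable_funM => //; exact: measurable_indic.
Qed.

(** * Fatou's lemma and almost everywhere summability *)

Section fatou_le.
Context d (T : measurableType d) (R : realType).
Variables (mu : {measure set T -> \bar R}).

Lemma limn_einf_ge0 (f : nat -> \bar R) : (forall n, 0 <= f n)%E -> (0 <= limn_einf f)%E.
Proof.
move=> f0; rewrite limn_einf_lim; apply: lime_ge; first exact: is_cvg_einfs.
by apply: nearW => n; apply: le_ereal_inf_tmp => _ [m _ <-].
Qed.

Lemma measurable_fun_limn_einf (D : set T) (f : nat -> T -> \bar R) :
  (forall n, measurable_fun D (f n)) -> measurable_fun D (fun x => limn_einf (f ^~ x)).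
Proof.
move=> mf; rewrite /limn_einf; apply: measurableT_comp => //.
by apply: measurable_fun_limn_esup => n; exact: measurableT_comp.
Qed.

(** The limit function [h] is extended valued, since limits of hull functions may be infinite, and
    the bounds move with [n], since the constraints are relaxed along the sequence. *)
Lemma fatou_le (D : set T) (f : nat -> T -> R) (h : T -> \bar R) (K : nat -> \bar R)
    (k : \bar R) : measurable D ->
  (forall n, measurable_fun setT (f n)) -> (forall n x, 0 <= f n x) ->
  measurable_fun setT h -> (forall x, 0 <= h x)%E ->
  {ae mu, forall x, D x -> (h x <= limn_einf (fun n => (f n x)%:E))%E} ->
  (forall n, \int[mu]_(x in D) (f n x)%:E <= K n)%E -> K @ \oo --> k ->
  (\int[mu]_(x in D) h x <= k)%E.
Proof.
move=> mD mf f0 mh h0 hf fK Kk.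
have mfE n : measurable_fun D (fun x => (f n x)%:E).
  by apply/measurable_funTS/measurable_EFinP.
have f0E n x : D x -> (0 <= (f n x)%:E)%E by rewrite lee_fin.
have H := fatou mu mD mfE f0E.
apply: (@le_trans _ _ (\int[mu]_(x in D) limn_einf (fun n => (f n x)%:E))%E).
  apply: ae_ge0_le_integral => //.
  - exact: measurable_funTS.
  - by move=> x _; apply: limn_einf_ge0 => n; rewrite lee_fin.
  - by apply: measurable_fun_limn_einf => n; exact: mfE.
apply: (le_trans H); rewrite -(cvg_limn_einf_sup Kk).1 !limn_einf_lim.
apply: lee_lim; [exact: is_cvg_einfs..|].
apply: nearW => n; apply: le_ereal_inf_tmp => _ [m nm <-].
by apply: le_trans (fK m); apply: ereal_inf_lbound; exists m.
Qed.

Lemma limn_einf_cvg (f : nat -> R) (l : R) : f @ \oo --> l ->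
  limn_einf (fun n => (f n)%:E) = l%:E.
Proof.
move=> fl; apply: (cvg_limn_einf_sup _).1.
by apply: cvg_EFin; [exact: nearW|].
Qed.

End fatou_le.

Section ae_summable.
Context d (T : measurableType d) (R : realType).
Variables (mu : {measure set T -> \bar R}).

(** By monotone convergence the sum of the series has integral at most [K], hence is finite almost
    everywhere. *)
Lemma ae_summable (h : nat -> T -> R) (K : R) :
  (forall n, measurable_fun setT (h n)) -> (forall n x, 0 <= h n x) ->
  (forall n, \sum_(k < n) \int[mu]_x (h k x)%:E <= K%:E)%E ->
  {ae mu, forall x, cvgn (series (h ^~ x))}.
Proof.
move=> mh h0 hK.
have mhE n : measurable_fun setT (fun x => (h n x)%:E) by exact/measurable_EFinP.
have hE0 n x : [set: T] x -> (0 <= (h n x)%:E)%E by rewrite lee_fin.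
have E := integral_nneseries mu measurableT mhE hE0.
pose s x := (\sum_(n <oo) (h n x)%:E)%E.
have ms : measurable_fun setT s.
  apply: ge0_emeasurable_sum => [n x _ _|n _]; last exact: mhE.
  by rewrite lee_fin.
have si : mu.-integrable setT s.
  apply/integrableP; split => //.
  have s0 x : (0 <= s x)%E by apply: nneseries_ge0 => n _ _; rewrite lee_fin.
  under eq_integral do rewrite gee0_abs//.
  rewrite E; apply: le_lt_trans (ltry K); apply: lime_le.
    by apply: is_cvg_nneseries => n _ _; apply: integral_ge0 => x _; rewrite lee_fin.
  by apply: nearW => n; rewrite big_mkord.
have := integrable_ae measurableT si.
apply: filterS => x /(_ I) sfin.
apply: nondecreasing_is_cvgn.
  by apply/nondecreasing_seqP => n; rewrite seriesEnat/= !big_mkord big_ord_recr/= lerDl.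
exists (fine (s x)) => _ [n _ <-].
rewrite -lee_fin fineK// seriesEnat/= -sumEFin big_mkord.
have := @nneseries_lim_ge _ (fun n => (h n x)%:E) xpredT 0%N n.
by rewrite big_mkord; apply => k _; rewrite lee_fin.
Qed.

End ae_summable.

(** * Moving measurable weights to 0/1 values *)

Section purification.
Context d e (T : measurableType d) (S : measurableType e) (R : realType).
Variables (mu : {finite_measure set T -> \bar R}) (pi : T -> S).
Hypothesis mpi : measurable_fun setT pi.
Hypothesis noatom : forall D, measurable D -> (0 < mu D)%E ->
  exists2 D1, measurable D1 & forall B, measurable B ->
    mu ((D `&` D1) `+` (D `&` pi @^-1` B)) != 0%E.

Let mpre B : measurable B -> measurable (pi @^-1` B).
Proof. by move=> mB; rewrite -[X in measurable X]setTI; exact: mpi. Qed.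

Variables (J N : nat) (lam : 'I_J.+1 -> T -> R) (g : 'I_N -> 'I_J.+1 -> T -> R).
Hypotheses (mlam : forall j, measurable_fun setT (lam j))
  (lam0 : forall j x, 0 <= lam j x) (lam1 : forall x, \sum_j lam j x = 1)
  (mg : forall i j, measurable_fun setT (g i j))
  (g0 : forall i j x, 0 <= g i j x)
  (ig : forall i j, mu.-integrable setT (EFin \o (fun x => lam j x * g i j x))).

Let weights := 'I_J.+1 -> T -> R.

Let valid (L : weights) := [/\ forall j, measurable_fun setT (L j),
  forall j x, 0 <= L j x, forall x, \sum_j L j x = 1,
  forall i j, mu.-integrable setT (EFin \o (fun x => L j x * g i j x)) &
  forall i B, measurable B ->
    (\int[mu]_(x in pi @^-1` B) (\sum_j L j x * g i j x)%:E =
    \int[mu]_(x in pi @^-1` B) (\sum_j lam j x * g i j x)%:E)%E].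

(* Strictly convex in the weights, hence maximal at 0/1 weights. *)
Let energy (L : weights) := \int[mu]_x (\sum_j L j x ^+ 2).

(** The mass that may be moved between two distinct weights, in either direction, with both staying
    nonnegative. The weights at [x] are all 0 or 1 exactly when every gap vanishes there. *)
Let gap (L : weights) (p : 'I_J.+1 * 'I_J.+1) x :=
  if p.1 == p.2 then 0 else Num.min (L p.1 x) (L p.2 x).

Let le1 L j x : valid L -> L j x <= 1.
Proof.
move=> [_ L0 L1 _ _]; rewrite -(L1 x) (bigD1 j)//= lerDl.
by apply: sumr_ge0.
Qed.

Let gap_ge0 L p x : valid L -> 0 <= gap L p x.
Proof.
by move=> [_ L0 _ _ _]; rewrite /gap; case: ifPn => // _; rewrite le_min !L0.
Qed.

Let gap_le1 L p x : valid L -> gap L p x <= 1.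
Proof.
move=> V; rewrite /gap; case: ifPn => // _.
by rewrite ge_min le1.
Qed.

Let mgap L p : valid L -> measurable_fun setT (gap L p).
Proof.
move=> [mL _ _ _ _]; apply: measurable_fun_ifT => //.
exact: measurable_minr.
Qed.

Let bint (h : T -> R) : measurable_fun setT h -> (forall x, 0 <= h x <= 1) ->
  mu.-integrable setT (EFin \o (fun x => h x ^+ 2)).
Proof.
move=> mh h01; apply: (bounded_integrable _ (M := 1)) => [|x].
  exact: measurable_funX.
by case/andP: (h01 x) => ? ?; rewrite ger0_norm ?sqr_ge0// exprn_ile1.
Qed.

(** A perturbation [eta] bounded by the gap, with [eta] times each [g i j - g i l] conditionally
    centred, is transferred from weight [l] to weight [j]. The energy changes by a cross term plus
    twice the integral of [eta ^+ 2]; a global sign makes the cross term nonnegative. *)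
Let move_mass L p : valid L -> exists L' : weights, [/\ valid L',
  energy L + 4^-1 ^+ N * \int[mu]_x (gap L p x ^+ 2) <= energy L' &
  forall k x, `|L' k x - L k x| <= gap L p x].
Proof.
move=> V; have [mL L0 L1 iL LE] := V.
case: p => j l; have [->|jl] := eqVneq j l.
  exists L; split => [//||k x]; rewrite /gap/= eqxx ?subrr ?normr0//.
  rewrite expr0n/=.
  by rewrite Rintegral_cst// mul0r mulr0 addr0.
have gapE x : gap L (j, l) x = Num.min (L j x) (L l x) by rewrite /gap/= (negPf jl).
(* [perturbation] takes a sequence indexed by [nat]; past [N] it is padded with zeros. *)
pose dg (i : nat) x := if insub i is Some i' then g i' j x - g i' l x else 0.
have gap01 x : 0 <= gap L (j, l) x <= 1 by rewrite gap_ge0//= gap_le1.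
have gapj x : gap L (j, l) x <= L j x by rewrite gapE ge_min lexx.
have gapl x : gap L (j, l) x <= L l x by rewrite gapE ge_min lexx orbT.
have mgp := mgap (j, l) V.
have igap i : mu.-integrable setT (EFin \o (fun x => (g i j x - g i l x) * gap L (j, l) x)).
  have ii : mu.-integrable setT (EFin \o (fun x => L j x * g i j x + L l x * g i l x)).
    exact: (integrableD measurableT (iL i j) (iL i l)).
  apply: le_integrable ii => //.
    by apply/measurable_EFinP; apply: measurable_funM => //; exact: measurable_funB.
  move=> x _ /=; rewrite lee_fin.
  have p1 := mulr_ge0 (L0 j x) (g0 i j x); have p2 := mulr_ge0 (L0 l x) (g0 i l x).
  rewrite [leRHS]ger0_norm ?addr_ge0// normrM [X in _ * X]ger0_norm ?gap_ge0//.
  apply: (@le_trans _ _ ((g i j x + g i l x) * gap L (j, l) x)).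
    rewrite ler_wpM2r ?gap_ge0// ler_norml.
    by have := g0 i j x; have := g0 i l x; move=> ? ?; apply/andP; split; lra.
  by rewrite mulrDl lerD// mulrC ler_wpM2r.
have [i iN|i iN|eta [meta eta_gap eta_c eta_E]] := perturbation mpi noatom (k := N) (g := dg) _ mgp gap01.
- by rewrite /dg insubT; apply: measurable_funB.
- by rewrite /dg insubT; exact: igap.
have eta_ci i : cond_centered mu pi (fun x => (g i j x - g i l x) * eta x).
  by have := eta_c i (ltn_ord i); rewrite /dg valK.
(* Both [eta] and [- eta] are admissible; [s] selects the one for which the cross term does not
   lower the energy. *)
have [s [s2 sE]] : exists s : R, s ^+ 2 = 1 /\ 0 <= s * \int[mu]_x (eta x * (L j x - L l x)).
  have [h|h] := leP 0 (\int[mu]_x (eta x * (L j x - L l x))).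
    by exists 1; rewrite mul1r expr1n.
  by exists (-1); rewrite sqrrN expr1n mulN1r oppr_ge0 ltW.
have s1 : `|s| = 1.
  by apply/eqP; rewrite -(eqrXn2 (n := 2))// -normrX s2 normr1 expr1n.
pose L' k x := L k x + s * eta x * ((k == j)%:R - (k == l)%:R).
have seta x : `|s * eta x| <= gap L (j, l) x by rewrite normrM s1 mul1r.
have sumL' x (w : 'I_J.+1 -> R) : \sum_k L' k x * w k =
    \sum_k L k x * w k + s * eta x * (w j - w l).
  rewrite /L'; under eq_bigr do rewrite mulrDl.
  rewrite big_split/=; congr (_ + _).
  under eq_bigr do rewrite mulrBr mulrBl.
  rewrite sumrB mulrBr; congr (_ - _).
    rewrite (bigD1 j)//= eqxx mulr1 big1 ?addr0// => k kj.
    by rewrite (negPf kj) mulr0 mul0r.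
  rewrite (bigD1 l)//= eqxx mulr1 big1 ?addr0// => k kl.
  by rewrite (negPf kl) mulr0 mul0r.
exists L'; split.
- split.
  + move=> k; apply: measurable_funD => //; apply: measurable_funM => //.
    exact: measurable_funM.
  + move=> k x; rewrite /L'; move: (seta x); rewrite ler_norml => /andP[h1 h2].
    have [->|kj] := eqVneq k j; [rewrite (negPf jl)|have [->|kl] := eqVneq k l]; rewrite /=.
    * by rewrite subr0 mulr1; have := gapj x; lra.
    * by have := gapl x; lra.
    * by rewrite subr0 mulr0 addr0.
  + move=> x; have := sumL' x (fun=> 1); rewrite subrr mulr0 addr0.
    by under eq_bigr do rewrite mulr1; under [in RHS]eq_bigr do rewrite mulr1; rewrite L1.
  (* The gap is at most [L j] and at most [L l], so no weight is more than doubled and integrability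
     is kept. *)
  + move=> i k; have i2 := integrableZl measurableT 2 (iL i k).
    apply: le_integrable i2 => //.
      apply/measurable_EFinP; apply: measurable_funM => //; apply: measurable_funD => //.
      by apply: measurable_funM => //; exact: measurable_funM.
    move=> x _ /=; rewrite lee_fin [leRHS]ger0_norm ?mulr_ge0//.
    rewrite normrM [X in _ * X]ger0_norm// mulrA ler_wpM2r//.
    have sb := seta x; have hj := gapj x; have hl := gapl x.
    rewrite /L' (le_trans (ler_normD _ _))// [X in X + _]ger0_norm//.
    suff : `|s * eta x * ((k == j)%:R - (k == l)%:R)| <= L k x by lra.
    rewrite normrM; have [->|kj] := eqVneq k j; [rewrite (negPf jl)|have [->|kl] := eqVneq k l]; rewrite /=.
    * by rewrite subr0 normr1 mulr1; lra.
    * by rewrite sub0r normrN normr1 mulr1; lra.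
    * by rewrite subr0 normr0 mulr0.
  + move=> i B mB; rewrite -LE//.
    under eq_integral do rewrite sumL'.
    have mpB := mpre mB.
    have [iec ec0] := eta_ci i.
    have iS0 : mu.-integrable setT (EFin \o (fun x => \sum_k L k x * g i k x)).
      have := @integrable_sum _ _ _ mu setT measurableT _ (index_enum 'I_J.+1) xpredT
        (fun k x => (L k x * g i k x)%:E) (fun k _ => iL i k).
      by under eq_fun do rewrite sumEFin.
    have iSB := integrableS measurableT mpB (@subsetT _ _) iS0.
    have iEB := integrableS measurableT mpB (@subsetT _ _) (integrableZl measurableT s iec).
    have E x : (\sum_k L k x * g i k x + s * eta x * (g i j x - g i l x))%:E =
        ((\sum_k L k x * g i k x)%:E + s%:E * ((g i j x - g i l x) * eta x)%:E)%E.
      by rewrite -EFinM -EFinD; congr EFin; ring.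
    under eq_integral do rewrite E.
    rewrite integralD//= integralZl// ?ec0 ?mule0 ?adde0//.
    exact: (integrableS measurableT mpB (@subsetT _ _) iec).
- have bi (h : T -> R) (M : R) : measurable_fun setT h -> (forall x, `|h x| <= M) ->
      mu.-integrable setT (EFin \o h).
    by move=> mh h1; exact: (bounded_integrable mu mh h1).
  have eta1 x : `|eta x| <= 1 by case/andP: (gap01 x) => _; exact: le_trans.
  have Lb k x : `|L k x| <= 1 by rewrite ger0_norm// le1.
  have i2 : mu.-integrable setT (EFin \o (fun x => eta x ^+ 2)).
    by apply: (bi _ 1) => [|x]; [exact: measurable_funX|rewrite normrX exprn_ile1].
  have i1 : mu.-integrable setT (EFin \o (fun x => eta x * (L j x - L l x))).
    apply: (bi _ 2) => [|x]; first by apply: measurable_funM => //; exact: measurable_funB.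
    rewrite normrM -[leRHS]mul1r ler_pM// (le_trans (ler_normB _ _))//.
    by have := Lb j x; have := Lb l x; lra.
  have i0 : mu.-integrable setT (EFin \o (fun x => \sum_k L k x ^+ 2)).
    apply: (bi _ J.+1%:R) => [|x]; first by apply: measurable_sum => k; exact: measurable_funX.
    rewrite (le_trans (ler_norm_sum _ _ _))// //.
    have -> : J.+1%:R = \sum_(k < J.+1) (1 : R) by rewrite sumr_const card_ord.
    by apply: ler_sum => k _; rewrite normrX exprn_ile1.
  have E x : \sum_k L' k x ^+ 2 = \sum_k L k x ^+ 2 +
      ((2 * s) * (eta x * (L j x - L l x)) + 2 * eta x ^+ 2).
    under eq_bigr do rewrite expr2.
    rewrite (sumL' x (fun k => L' k x)) (eq_bigr (fun k => L' k x * L k x)) => [|k _]; last exact: mulrC.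
    rewrite (sumL' x (fun k => L k x)) /L' !eqxx (negPf jl) eq_sym (negPf jl) /=.
    under eq_bigr do rewrite -expr2.
    have -> : 2 * eta x ^+ 2 = s ^+ 2 * (2 * eta x ^+ 2) by rewrite s2 mul1r.
    by ring.
  rewrite {2}/energy; under [in leRHS]eq_Rintegral do rewrite E.
  have i1' := integrableZl measurableT (2 * s) i1.
  have i2' := integrableZl measurableT 2 i2.
  rewrite RintegralD//; last exact: (integrableD measurableT i1' i2').
  rewrite RintegralD// !RintegralZl// -/(energy L) lerD2l.
  have e0 : 0 <= \int[mu]_x (eta x ^+ 2) by apply: Rintegral_ge0 => x _; exact: sqr_ge0.
  have := eta_E setT measurableT; rewrite preimage_setT => hE.
  apply: (le_trans hE); rewrite -(mulrA 2 s); move: sE e0; lra.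
- move=> k x; rewrite /L' addrAC subrr add0r normrM -[leRHS]mulr1 ler_pM ?seta//.
  have [->|kj] := eqVneq k j; [rewrite (negPf jl)|have [_|kl] := eqVneq k l]; rewrite /=.
  + by rewrite subr0 normr1.
  + by rewrite sub0r normrN normr1.
  + by rewrite subr0 normr0.
Qed.

(** Mass is moved for the pair whose squared gap has the largest integral, so a single energy
    increment controls the gaps of all pairs at once. *)
Let improve L : valid L -> exists L' : weights, valid L' /\ [/\
  forall p, energy L + 4^-1 ^+ N * \int[mu]_x (gap L p x ^+ 2) <= energy L' &
  forall k x, `|L' k x - L k x| <= \sum_p gap L p x].
Proof.
move=> V.
pose F p := \int[mu]_x (gap L p x ^+ 2).
have [p hp] : exists p, forall q, F q <= F p.
  have [p _ hp] := @Order.TotalTheory.arg_maxP _ _ _ (ord0, ord0) xpredT F isT.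
  by exists p => q; exact: hp.
have [L' [V' E' d']] := move_mass p V.
exists L'; split=> //; split => [q|k x].
  apply: le_trans E'; rewrite lerD2l ler_wpM2l ?exprn_ge0//; exact: hp.
rewrite (le_trans (d' k x))// (bigD1 p)//= lerDl; apply: sumr_ge0 => q _.
exact: gap_ge0.
Qed.

(** The energy is bounded, so its increments are summable and the gaps tend to 0 almost everywhere.
    Gaps also bound the change of each weight per step, so once they are small the dominant weight
    keeps its index, and the weights converge to 0/1 values without passing to a subsequence. *)
Lemma purification : exists tau : T -> 'I_J.+1,
  (forall j, measurable (tau @^-1` [set j])) /\
  forall i B, measurable B ->
   (\int[mu]_(x in pi @^-1` B) (g i (tau x) x)%:E <=
    \int[mu]_(x in pi @^-1` B) (\sum_j lam j x * g i j x)%:E)%E.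
Proof.
have V0 : valid lam by [].
have [|L [_ V Q]] := @dependent_choice_nat _ valid (fun _ L L' =>
  (forall p, energy L + 4^-1 ^+ N * \int[mu]_x (gap L p x ^+ 2) <= energy L') /\
  forall k x, `|L' k x - L k x| <= \sum_p gap L p x) lam V0.
  by move=> _ L /improve[L' [V' [? ?]]]; exists L'.
have QE n p : energy (L n) + 4^-1 ^+ N * \int[mu]_x (gap (L n) p x ^+ 2) <= energy (L n.+1).
  by case: (Q n) => /(_ p).
have Qd n k x : `|L n.+1 k x - L n k x| <= \sum_p gap (L n) p x by case: (Q n) => _ /(_ k x).
have q0 : 0 < (4^-1 : R) ^+ N by rewrite exprn_gt0.
have energy_le n : energy (L n) <= \int[mu]_x (J.+1%:R).
  have Vn := V n; have [mL L0 _ _ _] := Vn.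
  have S_le x : \sum_j L n j x ^+ 2 <= J.+1%:R.
    have -> : J.+1%:R = \sum_(k < J.+1) (1 : R) by rewrite sumr_const card_ord.
    by apply: ler_sum => k _; rewrite exprn_ile1 ?L0 ?le1.
  have mS : measurable_fun setT (fun x => \sum_j L n j x ^+ 2).
    by apply: measurable_sum => k; exact: measurable_funX.
  apply: le_Rintegral => //.
  - apply: (bounded_integrable mu mS (M := J.+1%:R)) => x.
    by rewrite ger0_norm// sumr_ge0// => k _; exact: sqr_ge0.
  - exact: finite_measure_integrable_cst.
have gap_sum p : {ae mu, forall x, cvgn (series (fun n => gap (L n) p x ^+ 2))}.
  apply: (@ae_summable _ _ _ mu _ ((4^-1 ^+ N)^-1 * (\int[mu]_x (J.+1%:R) - energy (L 0%N)))).
  - by move=> n; apply: measurable_funX; exact: mgap.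
  - by move=> n x; exact: sqr_ge0.
  move=> n; have igap k : mu.-integrable setT (EFin \o (fun x => gap (L k) p x ^+ 2)).
    by apply: bint => [|x]; [exact: mgap|rewrite gap_ge0 ?gap_le1].
  rewrite (eq_bigr (fun k : 'I_n => (\int[mu]_x (gap (L k) p x ^+ 2))%:E)); last first.
    by move=> k _; rewrite /Rintegral fineK//; exact: (integrable_fin_num measurableT (igap k)).
  rewrite sumEFin lee_fin ler_pdivlMl//.
  apply: (@le_trans _ _ (energy (L n) - energy (L 0%N))); last by rewrite lerD2r energy_le.
  elim: n => [|n IHn]; first by rewrite big_ord0 mulr0 subrr.
  rewrite big_ord_recr/= mulrDr; have := QE n p; move: IHn; lra.
(* The points where the weight [j] is eventually above 1/2. Two such weights would sum to more than
   1, so these sets are disjoint. *)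
pose G j := \bigcup_m \bigcap_(n in [set n | (m <= n)%N]) [set x | 2^-1 < L n j x].
have mG j : measurable (G j).
  apply: bigcupT_measurable => m; apply: bigcap_measurable => [|n _].
    by exists m => /=.
  rewrite -[X in measurable X]setTI.
  have -> : [set x | 2^-1 < L n j x] = L n j @^-1` `]2^-1, +oo[%classic.
    by apply/seteqP; split=> y /=; rewrite in_itv/= andbT.
  by have [mL _ _ _ _] := V n; exact: mL.
have Guniq j l x : G j x -> G l x -> j = l.
  move=> [m1 _ h1] [m2 _ h2]; apply/eqP; apply/negPn/negP => jl.
  have := h1 (maxn m1 m2) (leq_maxl _ _); have := h2 (maxn m1 m2) (leq_maxr _ _).
  have [_ Ln0 Ln1 _ _] := V (maxn m1 m2).
  have := Ln1 x; rewrite (bigD1 j)//= (bigD1 l)/= 1?eq_sym//.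
  have : 0 <= \sum_(i | (i != j) && (i != l)) L (maxn m1 m2) i x by apply: sumr_ge0.
  set r := \sum_(i | _) _; move=> ? ? ? ?; lra.
(* The default [ord0] is taken only where no weight dominates, which happens on a null set. *)
pose tau x := odflt ord0 [pick j | `[< G j x >]].
have tauE j x : G j x -> tau x = j.
  rewrite /tau => Gj; case: pickP => [l /asboolP Gl /=|/(_ j)]; first exact: Guniq Gl Gj.
  by move=> /asboolP.
have mtau j : measurable (tau @^-1` [set j]).
  have [j0|j0] := eqVneq j ord0; last first.
    rewrite (_ : _ @^-1` _ = G j)//; apply/seteqP; split => x /=; last exact: tauE.
    rewrite /tau; case: pickP => [l /asboolP Gl /= <-//|_ /= /esym/eqP].
    by rewrite (negPf j0).
  rewrite (_ : _ @^-1` _ = ~` \bigcup_(l in [set l | l != ord0]) G l).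
    apply: measurableC; apply: fin_bigcup_measurable => // ; exact: finite_finset.
  apply/seteqP; split => x /=.
    move=> tx [l /= l0 Gl]; move: l0; by rewrite -(tauE _ _ Gl) tx j0 eqxx.
  move=> h; rewrite j0 /tau; case: pickP => //= l /asboolP Gl.
  by apply/eqP/negPn/negP => l0; apply: h; exists l.
exists tau; split => //.
have good : {ae mu, forall x, forall j, L n j x @[n --> \oo] --> ((j == tau x)%:R : R)}.
  have gap_ae : {ae mu, forall x, forall p, gap (L n) p x @[n --> \oo] --> (0 : R)}.
    have h p : {ae mu, forall x, gap (L n) p x @[n --> \oo] --> (0 : R)}.
      apply: filterS (gap_sum p) => x /cvg_series_cvg_0 h.
      apply/cvgrPdist_lt => eps eps0.
      move/cvgrPdist_lt : h => /(_ (eps ^+ 2) (exprn_gt0 _ eps0)).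
      apply: filterS => n; rewrite !sub0r !normrN normrX => h.
      by rewrite -(ltr_pXn2r (n := 2))// nnegrE ltW.
    exact: filter_forall.
  apply: filterS gap_ae => x gap0.
  have K0 : (0 : R) < J.+1%:R by rewrite ltr0n.
  (* Gaps below [del] sum to at most 1/4 over all [J.+1 ^ 2] pairs, and [J.+1] of them also sum to
     at most 1/4. *)
  pose del : R := (4 * J.+1%:R ^+ 2)^-1.
  have del0 : 0 < del by rewrite invr_gt0 mulr_gt0// exprn_gt0.
  have [m _ hm] : \forall n \near \oo, forall p, gap (L n) p x < del.
    apply: filter_forall => p; have /cvgrPdist_lt/(_ _ del0) := gap0 p.
    by apply: filterS => n; rewrite sub0r normrN ger0_norm// gap_ge0.
  have card_sum (c : R) : \sum_(k < J.+1) c = J.+1%:R * c.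
    by rewrite sumr_const card_ord mulr_natl.
  have delK : J.+1%:R * del <= 4^-1.
    rewrite /del invfM mulrCA -[leRHS]mulr1 ler_pM2l ?invr_gt0//.
    rewrite expr2 invfM mulrA divff ?gt_eqF// mul1r invf_le1// ler1n.
    by [].
  (* Some weight is at least [1 / J.+1], which exceeds [del]. In each of its pairs the other weight
     must then be the minimum, so it equals the gap, and the others leave 3/4 for the first. *)
  have big n : (m <= n)%N -> exists2 j, 3 / 4 <= L n j x & forall l, l != j -> L n l x = gap (L n) (j, l) x.
    move=> mn; have gapn := hm n mn; have Vn := V n; have [_ Ln0 Ln1 _ _] := Vn.
    have [j hj] : exists j, J.+1%:R^-1 <= L n j x.
      apply/not_existsP => h.
      have : \sum_j L n j x < \sum_(j < J.+1) J.+1%:R^-1.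
        apply: ltr_sum => [|k _]; last by rewrite ltNge; apply/negP/h.
        by apply/hasP; exists ord0 => //; rewrite mem_index_enum.
      by rewrite Ln1 card_sum divff ?gt_eqF// ltxx.
    have small l : l != j -> L n l x = gap (L n) (j, l) x.
      move=> lj; have gE : gap (L n) (j, l) x = Num.min (L n j x) (L n l x).
        by rewrite /gap/= eq_sym (negPf lj).
      have [jl|jl] := ltP (L n j x) (L n l x); last by rewrite gE (min_idPr jl).
      have jdel : L n j x < del by rewrite -(min_idPl (ltW jl)) -gE.
      have : J.+1%:R * J.+1%:R^-1 <= J.+1%:R * L n j x by rewrite ler_pM2l.
      have : J.+1%:R * L n j x < J.+1%:R * del by rewrite ltr_pM2l.
      by rewrite divff ?gt_eqF//; move: delK; lra.
    exists j => //.
    have := Ln1 x; rewrite (bigD1 j)//= => E1.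
    have : \sum_(l | l != j) L n l x <= \sum_(l < J.+1) del.
      rewrite [leRHS](bigD1 j)//= -[leLHS]add0r lerD ?(ltW del0)//.
      by apply: ler_sum => l lj; rewrite small//; exact/ltW/gapn.
    by rewrite card_sum; move: E1 delK; lra.
  have sumgap n : (m <= n)%N -> \sum_p gap (L n) p x <= 4^-1.
    move=> mn; apply: (@le_trans _ _ (\sum_(p : 'I_J.+1 * 'I_J.+1) del)).
      by apply: ler_sum => p _; apply/ltW/hm.
    rewrite sumr_const card_prod card_ord -[del *+ _]mulr_natl natrM /del.
    by rewrite invfM mulrCA -expr2 divff ?mulr1// gt_eqF// exprn_gt0.
  have [j hj hjl] := big m (leqnn m).
  (* A step changes a weight by at most 1/4. Were another index dominant after it, the two weights
     would be at least 1/2 and 3/4, whose sum exceeds 1. *)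
  have stay k : 3 / 4 <= L (m + k)%N j x.
    elim: k => [|k IH]; first by rewrite addn0.
    rewrite addnS; have [j' hj' _] := big (m + k).+1 (leqW (leq_addr _ _)).
    have [->|jj'] := eqVneq j j'; first by [].
    have [_ Ln0 Ln1 _ _] := V (m + k).+1.
    have := Ln1 x; rewrite (bigD1 j)//= (bigD1 j')/= 1?eq_sym//.
    have : 0 <= \sum_(i | (i != j) && (i != j')) L (m + k).+1 i x by apply: sumr_ge0.
    have := Qd (m + k)%N j x; have := sumgap _ (leq_addr k m).
    rewrite ler_norml => ? /andP[]; move=> *; lra.
  have tj : tau x = j.
    apply: tauE; exists m => //= n /= mn; have := stay (n - m)%N.
    by rewrite subnKC//; lra.
  have to0 l : l != j -> L n l x @[n --> \oo] --> (0 : R).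
    move=> lj; apply: cvg_trans (gap0 (j, l)); apply: near_eq_cvg.
    exists m => //= n mn; have [j' hj' h'] := big n mn.
    suff jj' : j = j' by rewrite h' -?jj'.
    apply/eqP/negPn/negP => jj'; have := stay (n - m)%N; rewrite subnKC//.
    have [_ Ln0 Ln1 _ _] := V n.
    have := Ln1 x; rewrite (bigD1 j)//= (bigD1 j')/= 1?eq_sym//.
    have : 0 <= \sum_(i | (i != j) && (i != j')) L n i x by apply: sumr_ge0.
    by move: hj' => *; lra.
  move=> k; rewrite tj; have [->|kj] := eqVneq k j; last exact: to0.
  have -> : (fun n => L n j x) = (fun n => 1 - \sum_(l | l != j) L n l x).
    apply/funext => n; have [_ _ Ln1 _ _] := V n.
    by rewrite -(Ln1 x) (bigD1 j)//= addrK.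
  rewrite -[X in _ --> X]subr0; apply: cvgB; first exact: cvg_cst.
  rewrite -[X in _ --> X](_ : \sum_(l | l != j) (0 : R) = 0); last exact: big1.
  by apply: cvg_sumr => l lj; exact: to0.
move=> i B mB.
have mgt := measurable_fun_select mtau (mg i).
have mpB := mpre mB.
apply: (@fatou_le _ _ _ mu _ (fun n x => \sum_j L n j x * g i j x)
  (fun x => (g i (tau x) x)%:E)
  (fun=> \int[mu]_(x in pi @^-1` B) (\sum_j lam j x * g i j x)%:E)%E) => //.
- move=> n; have [mL _ _ _ _] := V n.
  by apply: measurable_sum => j; exact: measurable_funM.
- by move=> n x; have [_ L0 _ _ _] := V n; rewrite sumr_ge0// => j _; rewrite mulr_ge0.
- exact/measurable_EFinP.
- by move=> x; rewrite lee_fin.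
- apply: filterS good => x hx _.
  rewrite (@limn_einf_cvg _ _ (g i (tau x) x))//.
  rewrite -[X in _ --> X](_ : \sum_j (j == tau x)%:R * g i j x = _); last first.
    by rewrite (bigD1 (tau x))//= eqxx mul1r big1 ?addr0// => j /negPf ->; rewrite mul0r.
  by apply: cvg_sumr => j _; apply: cvgMl; exact: hx.
- by move=> n; have [_ _ _ _ ->] := V n.
- exact: cvg_cst.
Qed.

End purification.

(** * Souslin sets and measurable selection *)

(** [t] is a cluster point of the sequence [s] in a product of finite sets. A prefix shared by
    infinitely many [s n] has finitely many one-term extensions within the bound, and by pigeonhole
    one of them is again shared by infinitely many. *)
Lemma konig (k : nat -> nat) (s : nat -> nat -> nat) :
  (forall n i, (s n i <= k i)%N) ->
  exists t : nat -> nat, (forall i, (t i <= k i)%N) /\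
    forall N n0, exists2 n, (n0 <= n)%N & forall i, (i < N)%N -> s n i = t i.
Proof.
move=> sk.
pose P (p : nat * (nat -> nat)) := forall n0, exists2 n, (n0 <= n)%N &
  forall i, (i < p.1)%N -> s n i = p.2 i.
have [||v [v0 Pv Qv]] := @dependent_choice_nat _ P (fun _ p q => q.1 = p.1.+1 /\
    forall i, (i < p.1)%N -> q.2 i = p.2 i) (0%N, fun=> 0%N).
- by move=> n0; exists n0.
- move=> _ [N t] Pt.
  have [a Pa] : exists a, P (N.+1, fun i => if i == N then a else t i).
    apply/not_existsP => h.
    have /choice[b hb] : forall a, exists n0, forall n, (n0 <= n)%N ->
        ~ (forall i, (i < N.+1)%N -> s n i = if i == N then a else t i).
      move=> a; have /existsNP[n0 hn0] := h a.
      by exists n0 => n nn0 hs; apply: hn0; exists n.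
    have [n nb hn] := Pt (\max_(a < (k N).+1) b a)%N.
    apply: (hb (s n N) n).
      apply: leq_trans nb; have sN : (s n N < (k N).+1)%N by rewrite ltnS.
      exact: (leq_bigmax (Ordinal sN)).
    move=> i; rewrite ltnS leq_eqVlt; case: eqVneq => [->//|_ /= iN]; exact: hn.
  exists (N.+1, fun i => if i == N then a else t i); split => //; split => //= i iN.
  by rewrite ltn_eqF.
have vN n : (v n).1 = n by elim: n => [|n IH]; [rewrite v0|case: (Qv n) => -> _; rewrite IH].
pose t i := (v i.+1).2 i.
have vt n i : (i < n)%N -> (v n).2 i = t i.
  elim: n => // n IH; rewrite ltnS leq_eqVlt => /predU1P[->//|iltn].
  by case: (Qv n) => _ /(_ i); rewrite vN => -> //; exact: IH.
exists t; split => [i|N n0].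
  by have [n _ hn] := Pv i.+1 0%N; rewrite /t -hn ?vN.
by have [n nn0 hn] := Pv N n0; exists n => // i iN; rewrite hn ?vN// vt.
Qed.

(** * The Souslin operation on rectangles *)

Section souslin.
Context d (T : measurableType d) (Z : topologicalType).

Definition rectangle (P : set (T * Z)) := exists F C,
  [/\ measurable F, closed C & P = F `*` C].

Lemma rectangleT : rectangle setT.
Proof. by exists setT, setT; split => //; rewrite setXTT. Qed.

(* The Souslin operation over rectangles: [Q n s] may only depend on the first
   [n] terms of [s]. *)
Definition souslin (M : set (T * Z)) := exists Q : nat -> (nat -> nat) -> set (T * Z),
  [/\ forall n s t, (forall i, (i < n)%N -> s i = t i) -> Q n s = Q n t,
      forall n s, rectangle (Q n s) &
      forall z, M z <-> exists s, forall n, Q n s z].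

Lemma souslin_rectangle P : rectangle P -> souslin P.
Proof.
move=> rP; exists (fun _ _ => P); split => // z; split => [Pz|[s /(_ 0%N)]//].
by exists (fun=> 0%N).
Qed.

(** The first term of the sequence names a set [M k], and the shifted sequence runs its scheme. *)
Lemma souslin_bigcup (M : nat -> set (T * Z)) :
  (forall k, souslin (M k)) -> souslin (\bigcup_k M k).
Proof.
move=> /choice[Q hQ].
exists (fun n s => if n is m.+1 then Q (s 0%N) m (s \o S) else setT); split.
- move=> [//|n] s t st; rewrite st//.
  by have [h _ _] := hQ (t 0%N); apply: h => i iltn /=; exact: st.
- by move=> [|n] s; [exact: rectangleT|case: (hQ (s 0%N))].
move=> z; split.
  move=> [k _]; have [_ _ ->] := hQ k => -[s hs].
  by exists (fun i => if i is j.+1 then s j else k) => -[|n] //=; exact: hs.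
move=> [s hs]; exists (s 0%N) => //; have [_ _ ->] := hQ (s 0%N).
by exists (s \o S) => n; exact: (hs n.+1).
Qed.

(** A bijection from pairs to positive integers, increasing in [i]: the first [i] terms of the
    subsequence [s \o code k] lie before position [code k i], as the prefix condition on schemes
    demands. *)
Let code (k i : nat) := (2 ^ k * (i.*2.+1))%N.

Let code1 k i : logn 2 (code k i) = k.
Proof.
rewrite /code lognM// ?expn_gt0// pfactorK// [X in (_ + X)%N](_ : _ = 0%N) ?addn0//.
by rewrite lognE /= dvdn2 /= odd_double.
Qed.

Let code2 k i : ((code k i) %/ 2 ^ k)./2 = i.
Proof. by rewrite /code mulKn ?expn_gt0//= uphalf_double. Qed.

Let code_lt k i j : (i < j)%N -> (code k i < code k j)%N.
Proof. by move=> ij; rewrite /code ltn_pmul2l ?expn_gt0// ltnS ltn_double. Qed.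

(** One sequence carries countably many interleaved sequences, the scheme of [M k] being run along
    [s \o code k]. Position 0 codes no pair and imposes no condition. *)
Lemma souslin_bigcap (M : nat -> set (T * Z)) :
  (forall k, souslin (M k)) -> souslin (\bigcap_k M k).
Proof.
move=> /choice[Q hQ].
pose k n := logn 2 n; pose j n := ((n %/ 2 ^ k n)./2)%N.
exists (fun n s => if n == code (k n) (j n) then
  Q (k n) (j n) (s \o code (k n)) else setT); split.
- move=> n s t st; case: eqVneq => // nE.
  have [h _ _] := hQ (k n); apply: h => i ij /=; apply: st.
  by rewrite [X in (_ < X)%N]nE; exact: code_lt.
- by move=> n s; case: eqVneq => _; [case: (hQ (k n))|exact: rectangleT].
move=> z; split.
  move=> hz; have /choice[s hs] : forall l, exists s, forall n, Q l n s z.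
    by move=> l; have [_ _ h] := hQ l; exact/h/hz.
  exists (fun n => s (k n) (j n)) => n; case: eqVneq => // _.
  have [h _ _] := hQ (k n).
  rewrite (h (j n) _ (s (k n))) => [|i _ /=]; first exact: hs.
  by rewrite /j /k code1 code2.
move=> [s hs] l _; have [_ _ ->] := hQ l.
exists (s \o code l) => n; have := hs (code l n).
by rewrite /j /k code1 code2 eqxx.
Qed.

End souslin.

Lemma open_bigcup_closed (R : realType) (Z : pseudoMetricType R) (U : set Z) :
  open U -> exists F : nat -> set Z, (forall n, closed (F n)) /\ U = \bigcup_n F n.
Proof.
(* Interiors are taken because a [ball] need not be open. *)
move=> oU; exists (fun n => ~` \bigcup_(y in ~` U) (ball y n.+1%:R^-1)^°); split.
  by move=> n; apply: open_closedC; apply: bigcup_open => y _; exact: open_interior.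
apply/seteqP; split => x.
  move=> Ux; have /nbhs_ballP[e /= e0 xeU] : nbhs x U by exact: open_nbhs_nbhs.
  have [n _ /(_ n (leqnn n)) /= ne] := near_infty_natSinv_lt (PosNum e0).
  exists n => // -[y Uy /interior_subset yx]; apply: Uy; apply: xeU.
  by apply: le_ball (ball_sym yx); exact: ltW.
move=> [n _ h]; apply: contrapT => Ux; apply: h; exists x => //.
apply: nbhsx_ballx; by rewrite invr_gt0.
Qed.

Section souslin_measurable.
Context d (T : measurableType d) (R : realType) (Z : pseudoPMetricType R).

(** Souslin sets are not stable under complement, so the induction over the product sigma-algebra
    carries the complement along. *)
Let both (M : set (T * Z)) := souslin M /\ souslin (~` M).

Let both_sigma : sigma_algebra setT both.
Proof.
split.
- split; last by rewrite setC0; exact/souslin_rectangle/rectangleT.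
  apply: souslin_rectangle; exists set0, set0; split; [by []|exact: closed0|].
  by rewrite setX0.
- by move=> M [h1 h2]; split; rewrite setTD ?setCK.
- move=> F hF; split; first by apply: souslin_bigcup => n; case: (hF n).
  by rewrite setC_bigcup; apply: souslin_bigcap => n; case: (hF n).
Qed.

Let bothI M M' : both M -> both M' -> both (M `&` M').
Proof.
move=> [h1 h2] [h3 h4]; split.
  rewrite (_ : _ `&` _ = \bigcap_n (if n is 0%N then M else M')).
    by apply: souslin_bigcap => -[].
  apply/seteqP; split => x; first by move=> [? ?] [|n] _.
  by move=> h; split; [exact: (h 0%N)|exact: (h 1%N)].
rewrite (_ : ~` _ = \bigcup_n (if n is 0%N then ~` M else ~` M')).
  by apply: souslin_bigcup => -[].
rewrite setCI; apply/seteqP; split => x.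
  by move=> [?|?]; [exists 0%N|exists 1%N].
by move=> [[|n] _ ?]; [left|right].
Qed.

Lemma souslin_measurable (M : set (T * Z)) :
  measurable (M : set (T * borel Z)) -> souslin M.
Proof.
suff : (@measurable _ (T * borel Z)%type) `<=` both by move=> h /h[].
rewrite measurable_prod_measurableType; apply: smallest_sub => //.
move=> _ [F mF] [B mB <-].
have -> : F `*` B = (F `*` setT) `&` (setT `*` B).
  by rewrite -setXI setIT setTI.
apply: bothI.
  split; apply: souslin_rectangle.
    by exists F, setT; split => //; exact: closedT.
  exists (~` F), setT; split; [exact: measurableC|exact: closedT|].
  by apply/seteqP; split => -[x y] /=; [move=> h; split => // Fx; apply: h|move=> [h _] []].
pose Bs := [set B : set Z | both (setT `*` B)].
suff : (@measurable _ (borel Z)) `<=` Bs by move=> h; exact: h.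
have [b0 bC bU] := both_sigma.
have closed_both C : closed C -> souslin (setT `*` C : set (T * Z)).
  by move=> cC; apply: souslin_rectangle; exists setT, C; split.
apply: smallest_sub.
  split.
  - by rewrite /Bs /= setX0.
  - move=> C hC; rewrite /Bs /= setTD.
    have := bC _ hC; rewrite setTD; congr both.
    by apply/seteqP; split => -[x y] /=; [move=> h; split => // Cy; apply: h|move=> [_ h] []].
  - move=> C hC; have := bU _ hC; congr both; rewrite /Bs/=.
    by apply/seteqP; split => -[x y] /=; [move=> [n _ [_ h]]; split => //; exists n|move=> [_ [n _ h]]; exists n].
move=> U oU; split; last first.
  rewrite (_ : ~` _ = setT `*` ~` U); first exact/closed_both/open_closedC.
  by apply/seteqP; split => -[x y] /=; [move=> h; split => // Uy; apply: h|move=> [_ h] []].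
have [C [cC ->]] := open_bigcup_closed oU.
rewrite (_ : _ `*` _ = \bigcup_n (setT `*` C n)).
  by apply: souslin_bigcup => n; exact: closed_both.
by apply/seteqP; split => -[x y] /=; [move=> [_ [n _ h]]; exists n|move=> [n _ [_ h]]; split => //; exists n].
Qed.

End souslin_measurable.

(** * Measurable hulls and outer measure *)

Section measurable_hull.
Context d (T : measurableType d) (R : realType).
Variable mu : {finite_measure set T -> \bar R}.

Let m B := fine (mu B).

Let mE B : measurable B -> mu B = (m B)%:E.
Proof. by move=> mB; rewrite fineK// fin_num_measure. Qed.

Let m_le A B : measurable A -> measurable B -> A `<=` B -> m A <= m B.
Proof. by move=> mA mB AB; rewrite -lee_fin -!mE// le_measure ?inE. Qed.

(** The complement of a maximal measurable set disjoint from [A]: adjoining to that set the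
    complement of a competing cover cannot increase its measure. *)
Lemma measurable_hull (A : set T) : exists B, [/\ measurable B, A `<=` B &
  forall B', measurable B' -> A `<=` B' -> m B <= m B'].
Proof.
have [||||D [mD DA] maxD] := @exhaustion R T [set D | measurable D /\ D `&` A = set0] m (m setT).
- by exists set0; split; rewrite ?set0I.
- by move=> D [mD _]; exact: m_le.
- by move=> D E [mD _] [mE' _]; exact: m_le.
- move=> F hF _; split; first by apply: bigcupT_measurable => n; case: (hF n).
  by rewrite setI_bigcupl; apply: bigcup0 => n _; case: (hF n).
exists (~` D); split; first exact: measurableC.
  by move=> x Ax Dx; rewrite -[False]/(set0 x) -DA.
move=> B mB AB.
have mDB : measurable (D `|` ~` B) by apply: measurableU => //; exact: measurableC.
have := maxD (D `|` ~` B) _ (@subsetUl _ _ _).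
have h : measurable (D `|` ~` B) /\ (D `|` ~` B) `&` A = set0.
  split => //; apply/seteqP; split => // x [[Dx|Bx] Ax]; last exact/Bx/AB.
  by rewrite -DA.
move=> /(_ h) h1.
have h2 : m (~` B) <= m (D `|` ~` B) by apply: m_le => //; exact: measurableC.
have mC E : measurable E -> m (~` E) = m setT - m E.
  move=> mE'; apply/EFin_inj; rewrite EFinB -!mE//; last exact: measurableC.
  rewrite -[X in (X - _)%E](_ : mu E + mu (~` E) = _)%E; last first.
    by rewrite -measureU ?setUv// ?setICr//; exact: measurableC.
  by rewrite addeAC subee ?add0e// fin_num_measure.
by move: h1 h2; rewrite !mC//; lra.
Qed.

Definition outer (A : set T) : R := m (sval (cid (measurable_hull A))).

Lemma outer_le A B : measurable B -> A `<=` B -> outer A <= m B.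
Proof. by rewrite /outer; case: cid => H [mH AH hH] mB AB; exact: hH. Qed.

Lemma outer_hull A : exists B, [/\ measurable B, A `<=` B & m B = outer A].
Proof. by rewrite /outer; case: cid => H [mH AH hH]; exists H. Qed.

(** Continuity from below holds for arbitrary increasing sets: intersecting the hulls from index [n]
    on gives increasing measurable covers, each contained in the hull of [A n]. *)
Lemma outer_cvg (A : nat -> set T) (eps : R) : (forall n, A n `<=` A n.+1) -> 0 < eps ->
  exists n, outer (\bigcup_n A n) - eps < outer (A n).
Proof.
move=> AS eps0.
have /choice[H hH] := fun n => outer_hull (A n).
have mH n : measurable (H n) by case: (hH n).
pose C n := \bigcap_(k in [set k | (n <= k)%N]) H k.
have mC n : measurable (C n) by apply: bigcap_measurable => //; exists n => /=.
have CS n k : (n <= k)%N -> C n `<=` C k.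
  by move=> nk x h l /= kl; apply: h => /=; exact: leq_trans kl.
have AC n : A n `<=` C n.
  move=> x Ax k /= nk; have [_ h _] := hH k; apply: h.
  elim: k nk => [|k IH]; first by rewrite leqn0 => /eqP <-.
  by rewrite leq_eqVlt ltnS => /predU1P[<-//|/IH]; exact: AS.
have mU := bigcupT_measurable C mC.
have cv : (m (C n)) @[n --> \oo] --> m (\bigcup_n C n).
  apply: fine_cvg; rewrite -mE//; apply: nondecreasing_cvg_mu => //.
  by move=> n k nk; rewrite subsetEset; exact: CS.
have U_le : outer (\bigcup_n A n) <= m (\bigcup_n C n).
  by apply: outer_le => // x [n _ /AC]; exists n.
have /cvgrPdist_lt/(_ _ eps0)[n _ /(_ n (leqnn n)) /=] := cv.
rewrite ltr_distl => /andP[_ h]; exists n.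
have : m (C n) <= outer (A n).
  have [_ _ <-] := hH n; apply: m_le => //.
  by move=> x; apply => /=.
by move: h U_le; lra.
Qed.

End measurable_hull.

(** * Measurable projection and selection *)

Section projection.
Context d (T : measurableType d) (R : realType) (Z : completePseudoMetricType R).
Variables (mu : {finite_measure set T -> \bar R}) (dn : nat -> Z).
Hypothesis mu_complete : measure_is_complete mu.
Hypothesis dense_dn : forall z (e : R), 0 < e -> exists k, ball z e (dn k).

Let rad (j : nat) : R := j.+1%:R^-1.
Let rad_gt0 j : 0 < rad j. Proof. by rewrite invr_gt0. Qed.

(** Closures, because the second side of a rectangle has to be closed; the price is a doubled
    radius. *)
Let cell (j k : nat) : set Z := closure (ball (dn k) (rad j)).

Let cell_ball j k z : cell j k z -> ball (dn k) (rad j + rad j) z.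
Proof.
move=> /(_ _ (nbhsx_ballx z _ (rad_gt0 j)))[t [h1 h2]].
by apply: ball_triangle h1 _; exact: ball_sym.
Qed.

Section scheme.
Variable Q : nat -> (nat -> nat) -> set (T * Z).
Hypothesis Qdep : forall n s t, (forall i, (i < n)%N -> s i = t i) -> Q n s = Q n t.
Hypothesis Qrect : forall n s, rectangle (Q n s).
(** Along a branch the second coordinate is confined to arbitrarily small cells, so points chosen
    along a branch form a Cauchy sequence. *)
Hypothesis Qcell : forall j, exists n i, forall s w z, Q n s (w, z) -> cell j (s i) z.

(* [\bigcap_n approx k n] is measurable and, by [konig] and completeness of [Z],
   contained in the projection; suitable [k] nearly exhaust its outer measure. *)
Let approx (k : nat -> nat) n : set T :=
  [set w | exists z s, (forall i, (s i <= k i)%N) /\ forall m, (m <= n)%N -> Q m s (w, z)].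

(** Only finite prefixes matter, so the union runs over the countable type [seq nat]. For a fixed
    prefix, [z] can be chosen independently of [w]: a finite intersection of rectangles projects to
    the intersection of the first sides or to the empty set. *)
Let approx_measurable k n : measurable (approx k n).
Proof.
pose G (s : seq nat) := [set w | exists z, forall m, (m <= n)%N -> Q m (nth 0%N s) (w, z)].
have mG s : measurable (G s).
  have /choice[F /choice[C FC]] := fun m => Qrect m (nth 0%N s).
  have [[z Cz]|nC] := pselect (exists z, forall m, (m <= n)%N -> C m z).
    have -> : G s = \bigcap_(m in [set m | (m <= n)%N]) F m.
      apply/seteqP; split => w.
        by move=> [y h] m /= mn; have := h m mn; have [_ _ ->] := FC m => -[].
      by move=> h; exists z => m mn; have [_ _ ->] := FC m; split; [exact: h|exact: Cz].
    by apply: bigcap_measurable => [|m _]; [exists n => /=|case: (FC m)].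
  rewrite (_ : G s = set0)//; apply/seteqP; split => // w [z h]; apply: nC.
  by exists z => m mn; have := h m mn; have [_ _ ->] := FC m => -[].
have -> : approx k n = \bigcup_(s in [set s : seq nat | forall i, (nth 0%N s i <= k i)%N]) G s.
  apply/seteqP; split => w.
    move=> [z [s [sk h]]]; exists (mkseq s n).
      move=> i; have [iltn|nlei] := ltnP i n; first by rewrite nth_mkseq.
      by rewrite nth_default// size_mkseq.
    exists z => m mn; rewrite -(Qdep (s := s)); first exact: h.
    by move=> i im; rewrite nth_mkseq// (leq_trans im).
  by move=> [s sk [z h]]; exists z, (nth 0%N s).
rewrite bigcup_mkcond; apply: countable_bigcupT_measurable => [|s]; first exact: countableP.
by case: ifPn.
Qed.

Let P := [set w | exists z s, forall n, Q n s (w, z)].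

Let approx_cap k : \bigcap_n approx k n `<=` P.
Proof.
move=> w hw.
have /choice[z /choice[s hs]] := fun n => hw n I.
have [t [tk ht]] := konig (fun n => (hs n).1).
have /choice[n hn] : forall N, exists n, (N <= n)%N /\ forall i, (i < N)%N -> s n i = t i.
  by move=> N; have [n Nn h] := ht N N; exists n.
have Qt N m : (m <= N)%N -> Q m t (w, z (n N)).
  move=> mN; have [Nn h] := hn N.
  rewrite -(Qdep (s := s (n N))); first by apply: (hs _).2; exact: leq_trans Nn.
  by move=> i im; apply: h; exact: leq_trans mN.
have cz : cvg ((z \o n) @ \oo).
  apply: cauchy_cvg; apply/cauchy_ballP => e e0.
  have [j _ /(_ j (leqnn j)) /= je] := near_infty_natSinv_lt (PosNum (divr_gt0 e0 (ltr0n R 4))).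
  have [m [i hmi]] := Qcell j.
  have near_cell : \forall N \near \oo, ball (dn (t i)) (rad j + rad j) (z (n N)).
    by exists m => //= N mN; apply: cell_ball; apply: hmi; exact: Qt.
  exists ([set y | ball (dn (t i)) (rad j + rad j) y], [set y | ball (dn (t i)) (rad j + rad j) y]).
    by split; exact: near_cell.
  move=> [x y] [/= hx hy]; apply: le_ball (ball_triangle (ball_sym hx) hy).
  have : rad j < e / 4 by exact: je.
  lra.
exists (lim ((z \o n) @ \oo)), t => m.
have [F [C [mF cC QE]]] := Qrect m t.
have Fw : F w by have := Qt m m (leqnn m); rewrite QE => -[].
rewrite QE; split => //=.
apply: (closed_cvg _ cC _ _ cz).
by exists m => //= N mN; have := Qt N m mN; rewrite QE => -[].
Qed.

Let mm B := fine (mu B).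

(** The bounds [k n] are fixed one at a time. Letting the bound on the term [n] grow exhausts the
    current set, so by [outer_cvg] some finite bound loses at most [e / 2 ^ n.+1]; all losses
    together stay below [e]. *)
Let inner (e : R) : 0 < e -> exists K, [/\ measurable K, K `<=` P & outer mu P - e <= mm K].
Proof.
move=> e0.
pose B (k : nat -> nat) n := [set w | exists z s,
  (forall i, (i < n)%N -> (s i <= k i)%N) /\ forall m, Q m s (w, z)].
pose upd (k : nat -> nat) n a i := if i == n then a else k i.
pose del n := e / (2 ^ n.+1)%:R.
have [||k [k0 _ hk]] := @dependent_choice_nat _ (fun nk => True)
    (fun _ nk nk' => nk'.1 = nk.1.+1 /\ (exists a, nk'.2 = upd nk.2 nk.1 a) /\
     outer mu (B nk.2 nk.1) - del nk.1 < outer mu (B nk'.2 nk'.1)) (0%N, fun=> 0%N).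
- by [].
- move=> _ [n k] _.
  pose An a := B (upd k n a) n.+1.
  have AS a : An a `<=` An a.+1.
    move=> w [z [s [h1 h2]]]; exists z, s; split => // i iltn.
    have := h1 i iltn; rewrite /upd; case: eqVneq => // _ sa; exact: leqW.
  have [|a ha] := outer_cvg mu AS (eps := del n).
    by rewrite divr_gt0// ltr0n expn_gt0.
  exists (n.+1, upd k n a); split => //; split => //; split; first by exists a.
  move: ha => /=; congr (outer mu _ - _ < _); apply/seteqP; split => w.
    move=> [a' _ [z [s [h1 h2]]]]; exists z, s; split => // i iltn.
    by have := h1 i (ltnW iltn); rewrite /upd ltn_eqF.
  move=> [z [s [h1 h2]]]; exists (s n) => //; exists z, s; split => // i.
  by rewrite ltnS leq_eqVlt /upd; case: eqVneq => [->//|_ /= iltn]; exact: h1.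
have kn n : (k n).1 = n by elim: n => [|n IH]; [rewrite k0|case: (hk n) => -> _; rewrite IH].
pose K i := (k i.+1).2 i.
have kK n i : (i < n)%N -> (k n).2 i = K i.
  elim: n => // n IH; rewrite ltnS leq_eqVlt => /predU1P[->//|iltn].
  have [_ [[a ->] _]] := hk n; rewrite /upd kn ltn_eqF//; exact: IH.
have BK n : B (k n).2 (k n).1 = B K n.
  rewrite kn; apply/seteqP; split => w [z [s [h1 h2]]]; exists z, s; split => // i iltn.
    by rewrite -(kK n)//; exact: h1.
  by rewrite (kK n)//; exact: h1.
have PB : P = B K 0%N.
  apply/seteqP; split => w; first by move=> [z [s h]]; exists z, s.
  by move=> [z [s [_ h]]]; exists z, s.
have Bn n : outer mu P - e * (1 - (2 ^ n)%:R^-1) <= outer mu (B K n).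
  elim: n => [|n IH]; first by rewrite -PB expn0 invr1 subrr mulr0 subr0.
  have [_ [_]] := hk n; rewrite !BK kn /del => h; apply/ltW; apply: le_lt_trans h.
  move: IH; rewrite expnS natrM invfM; set q := (2 ^ n)%:R^-1.
  have -> : e * (2^-1 * q) = e * q / 2 by ring.
  by move=> ?; lra.
have Bapp n : B K n `<=` approx K n.
  move=> w [z [s [h1 h2]]]; exists z, (fun i => if (i < n)%N then s i else 0%N); split.
    by move=> i; case: ifPn => // iltn; exact: h1.
  by move=> m mn; rewrite -(Qdep (s := s))// => i im; rewrite (leq_trans im).
have mcap := bigcapT_measurable (approx_measurable K).
exists (\bigcap_n approx K n); split; [by []|exact: approx_cap|].
have cv : mm (approx K n) @[n --> \oo] --> mm (\bigcap_n approx K n).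
  apply: fine_cvg; rewrite fineK ?fin_num_measure//; apply: nonincreasing_cvg_mu => //.
    by rewrite ltey_eq fin_num_measure.
  move=> n m nm; rewrite subsetEset => w [z [s [h1 h2]]]; exists z, s; split => // j jn.
  by apply: h2; exact: leq_trans nm.
apply: (cvgr_to_ge cv); apply: nearW => n.
have := outer_le mu (approx_measurable K n) (Bapp n); have := Bn n; rewrite /mm.
have : 0 <= e * (2 ^ n)%:R^-1 by rewrite mulr_ge0 ?invr_ge0// ltW.
rewrite mulrBr mulr1; set q := e * _; lra.
Qed.

(** [P] lies between a union of inner approximations and a measurable hull of equal measure;
    completeness of [mu] makes the difference measurable. *)
Lemma projection_scheme : measurable P.
Proof.
have /choice[K hK] : forall n : nat, exists K, [/\ measurable K, K `<=` P & outer mu P - rad n <= mm K].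
  by move=> n; exact: inner.
have [H [mH PH HE]] := outer_hull mu P.
have mK : measurable (\bigcup_n K n) by apply: bigcupT_measurable => n; case: (hK n).
have KP : \bigcup_n K n `<=` P by move=> w [n _]; case: (hK n) => _ h _ /h.
have mHK := measurableD mH mK.
rewrite -(setDUK KP); apply: measurableU => //; apply: mu_complete.
exists (H `\` \bigcup_n K n); split => //; last by apply: setSD.
have fH := fin_num_measure mu _ mH; have fK := fin_num_measure mu _ mK.
have KH : \bigcup_n K n `<=` H by exact: subset_trans PH.
rewrite measureD//; last by rewrite ltey_eq fH.
rewrite (setIidr KH) [X in (X - _)%E](_ : _ = mu (\bigcup_n K n)) ?subee//.
apply/eqP; rewrite eq_le; apply/andP; split; last by rewrite le_measure ?inE.
rewrite -(fineK fH) -(fineK fK) lee_fin [leLHS]HE.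
apply/ler_addgt0Pr => e e0.
have [n _ /(_ n (leqnn n)) /= ne] := near_infty_natSinv_lt (PosNum e0).
have [mKn KnP hKn] := hK n.
have : mm (K n) <= mm (\bigcup_n K n).
  rewrite -lee_fin !fineK ?fin_num_measure//; apply: le_measure; rewrite ?inE//.
  exact: bigcup_sup.
have : rad n < e by exact: ne.
rewrite /mm; move: hKn; rewrite /mm; lra.
Qed.

End scheme.

Let in_cell j z : exists k, cell j k z.
Proof.
have [k h] := dense_dn z (rad_gt0 j).
by exists k; apply: subset_closure; exact: ball_sym.
Qed.

Lemma measurable_projection (M : set (T * Z)) :
  measurable (M : set (T * borel Z)) -> measurable [set w | exists z, M (w, z)].
Proof.
move=> /souslin_measurable[Q0 [Q0dep Q0rect Q0E]].
(* Even positions of [s] feed the given scheme and odd positions name a cell of each radius, which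
   supplies [Qcell]. *)
pose Q n (s : nat -> nat) : set (T * Z) := if n is k.+1 then
  (if odd k then setT `*` cell k./2 (s k) else Q0 k./2 (s \o double)) else setT.
have -> : [set w | exists z, M (w, z)] = [set w | exists z s, forall n, Q n s (w, z)].
  apply/seteqP; split => w [z].
    move=> /Q0E[s hs]; have /choice[c hc] := fun j => in_cell j z.
    exists z, (fun i => if odd i then c i./2 else s i./2) => -[//|n] /=.
    case: ifPn => [no|_]; first by rewrite no; split.
    rewrite (Q0dep _ _ s)//= => i _.
    by rewrite odd_double/= doubleK.
  move=> [s hs]; exists z; apply/Q0E; exists (s \o double) => n.
  by have := hs n.*2.+1; rewrite /= odd_double/= doubleK.
apply: projection_scheme => [n s t st|n s|j].
- case: n st => [//|n] st /=; case: ifPn => [no|no]; first by rewrite st.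
  by apply: Q0dep => i ilt /=; apply: st; rewrite ltnS; lia.
- case: n => [|n] /=; first exact: rectangleT.
  case: ifPn => _; last exact: Q0rect.
  by exists setT, (cell n./2 (s n)); split => //; exact: closed_closure.
- exists j.*2.+2, j.*2.+1 => s w z /=.
  by rewrite odd_double/= uphalf_double => -[].
Qed.

(** Cells of decreasing radius are chosen greedily, each time the one of least index for which the
    section still meets all the chosen cells. The choices have measurable level sets by projection;
    completeness gives the limit and closedness of the section keeps it in [M]. *)
Lemma measurable_selection (M : set (T * Z)) :
  measurable (M : set (T * borel Z)) ->
  (forall w, closed [set z | M (w, z)]) -> (forall w, exists z, M (w, z)) ->
  exists f : T -> Z, measurable_fun setT (f : T -> borel Z) /\ forall w, M (w, f w).
Proof.
move=> mM cM neM.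
pose E (s : seq nat) := [set w | exists z, (M `&` [set x | forall j, (j < size s)%N ->
  cell j (nth 0%N s j) x.2]) (w, z)].
have mE s : measurable (E s).
  apply: measurable_projection; apply: measurableI => //.
  rewrite (_ : [set x | _] = \bigcap_(j in [set j | (j < size s)%N])
      (snd @^-1` (cell j (nth 0%N s j)))); last by apply/seteqP; split.
  apply: bigcap_measurableType => j _.
  rewrite -[X in measurable X]setTI; apply: (@measurable_snd _ _ T (borel Z)) => //.
  rewrite -[cell _ _]setCK; apply: measurableC; apply: sub_sigma_algebra.
  by apply: closed_openC; exact: closed_closure.
have Enext s w : E s w -> exists k, `[< E (rcons s k) w >].
  move=> [z [Mz hz]]; have [k hk] := in_cell (size s) z.
  exists k; apply/asboolP; exists z; split => // j; rewrite size_rcons ltnS leq_eqVlt nth_rcons.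
  by move=> /predU1P[->|/[dup] js ->]; [rewrite ltnn eqxx|exact: hz].
pose next s w := if pselect (E s w) is left h then ex_minn (Enext s w h) else 0%N.
pose c := fix c n w := if n is k.+1 then rcons (c k w) (next (c k w) w) else [::].
have csize n w : size (c n w) = n by elim: n => //= n IH; rewrite size_rcons IH.
have Ec n w : E (c n w) w.
  elim: n => [|n IH] /=; first by have [z Mz] := neM w; exists z; split.
  rewrite /next; case: pselect => // h; case: ex_minnP => k /asboolP Ek _; exact: Ek.
have mc n s : measurable [set w | c n w = s].
  elim: n s => [|n IH] s.
    case: s => [|a s].
      by rewrite (_ : [set _ | _] = setT)//; apply/seteqP; split.
    by rewrite (_ : [set _ | _] = set0)//; apply/seteqP; split.
  case/lastP: s => [|s k].
    rewrite (_ : [set _ | _] = set0)//; apply/seteqP; split => // w /=.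
    by case: (c n w).
  rewrite (_ : [set _ | _] = [set w | c n w = s] `&` E (rcons s k) `&`
      \bigcap_(l in [set l | (l < k)%N]) ~` E (rcons s l)).
    apply: measurableI; first exact: measurableI.
    by apply: bigcap_measurableType => l _; exact: measurableC.
  apply/seteqP; split => w /=.
    move=> /rcons_inj[cs nk]; rewrite cs in nk; move: nk.
    rewrite /next; case: pselect => [h|]; last by rewrite -cs => nE; have := Ec n w.
    case: ex_minnP => l /asboolP El lmin <-.
    split; first by split.
    move=> l' /= ll' El'; have := lmin l'; rewrite leqNgt ll' => hh.
    by have := hh (asboolT El').
  move=> [[cs Ek] hk]; rewrite cs; congr rcons.
  rewrite /next; case: pselect => [h|]; last by rewrite -cs => nE; have := Ec n w.
  case: ex_minnP => l /asboolP El lmin.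
  apply/eqP; rewrite eqn_leq lmin; last exact/asboolP.
  by rewrite leqNgt; apply/negP => lk; exact: (hk l lk).
pose idx j w := nth 0%N (c j.+1 w) j.
have nth_c n j w : (j < n)%N -> nth 0%N (c n w) j = idx j w.
  elim: n => // n IH; rewrite ltnS leq_eqVlt => /predU1P[->//|jn].
  by rewrite [c n.+1 w]/= nth_rcons csize jn IH.
have /choice[f hf] : forall w, exists z, M (w, z) /\ forall j, cell j (idx j w) z.
  move=> w; have /choice[z hz] := fun n => Ec n w.
  have zc n j : (j < n)%N -> cell j (idx j w) (z n).
    by move=> jn; have [_ h] := hz n; rewrite -(nth_c n)//; apply: h; rewrite csize.
  have cz : cvg (z @ \oo).
    apply: cauchy_cvg; apply/cauchy_ballP => e e0.
    have [j _ /(_ j (leqnn j)) /= je] := near_infty_natSinv_lt (PosNum (divr_gt0 e0 (ltr0n R 4))).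
    have near_cell : \forall N \near \oo, ball (dn (idx j w)) (rad j + rad j) (z N).
      by exists j.+1 => //= N jN; apply: cell_ball; apply: zc.
    exists ([set y | ball (dn (idx j w)) (rad j + rad j) y],
            [set y | ball (dn (idx j w)) (rad j + rad j) y]).
      by split; exact: near_cell.
    move=> [x y] [/= hx hy]; apply: le_ball (ball_triangle (ball_sym hx) hy).
    have : rad j < e / 4 by exact: je.
    lra.
  exists (lim (z @ \oo)); split.
    by apply: (closed_cvg _ (cM w) _ _ cz); apply: nearW => n; case: (hz n).
  move=> j; apply: (closed_cvg _ (@closed_closure _ _) _ _ cz).
  by exists j.+1 => //= N jN; exact: zc.
exists f; split; last by move=> w; case: (hf w).
apply: (@measurability _ _ _ (borel Z) setT f (@open Z)) => // _ [U oU <-]; rewrite setTI.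
(* Whether [f w] lies in [U] is decided by finitely many chosen indices, and there are only
   countably many finite lists of them. *)
rewrite (_ : _ @^-1` _ = \bigcup_(s in [set s | exists n, size s = n.+1 /\
    ball (dn (last 0%N s)) (rad n + rad n) `<=` U]) [set w | c (size s) w = s]).
  by rewrite bigcup_mkcond; apply: countable_bigcupT_measurable => [|s]; [exact: countableP|case: ifPn].
apply/seteqP; split => w /=.
  move=> Ufw; have /nbhs_ballP[e /= e0 feU] : nbhs (f w) U by exact: open_nbhs_nbhs.
  have [n _ /(_ n (leqnn n)) /= ne] := near_infty_natSinv_lt (PosNum (divr_gt0 e0 (ltr0n R 4))).
  exists (c n.+1 w); last by rewrite csize.
  exists n; split; first by rewrite csize.
  have [_ /(_ n) /cell_ball hn] := hf w.
  rewrite -nth_last csize/= -/(idx n w) => y hy; apply: feU.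
  apply: le_ball (ball_triangle (ball_sym hn) hy).
  have : rad n < e / 4 by exact: ne.
  lra.
move=> [s [n [sn sU]] cs]; apply: sU.
have [_ /(_ n) /cell_ball hn] := hf w.
by rewrite -nth_last sn/= -cs sn -/(idx n w).
Qed.

End projection.

(** * Lower semicontinuity and domination by convex combinations *)

HB.instance Definition _ (U V : pnbhsType) := Pointed.on (U * V)%type.
HB.instance Definition _ (U V : ptopologicalType) := Pointed.on (U * V)%type.
HB.instance Definition _ (U V : puniformType) := Pointed.on (U * V)%type.

Lemma prod_complete (U V : completeType) (F : set_system (U * V)%type) :
  ProperFilter F -> cauchy F -> cvg F.
Proof.
move=> FF Fc.
have c1 : cauchy (fst @ F).
  move=> E entE; rewrite near_simpl -near2E near_map2; apply: Fc.
  exists (E, setT); first by split => //; exact: filterT.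
  by move=> [[a a'] [b b']] [/= h _]; exists ((a, b), (a', b')).
have c2 : cauchy (snd @ F).
  move=> E entE; rewrite near_simpl -near2E near_map2; apply: Fc.
  exists (setT, E); first by split => //; exact: filterT.
  by move=> [[a a'] [b b']] [/= _ h]; exists ((a, b), (a', b')).
have /cauchy_cvg h1 := c1; have /cauchy_cvg h2 := c2.
apply/cvg_ex; exists (lim (fst @ F), lim (snd @ F)).
move=> P [[P1 P2] [/= n1 n2] sP].
have g1 : \forall p \near F, P1 p.1 := h1 _ n1.
have g2 : \forall p \near F, P2 p.2 := h2 _ n2.
by apply: filterS2 g1 g2 => -[x y] /= ? ?; exact: sP.
Qed.

HB.instance Definition _ (U V : completeType) :=
  Uniform_isComplete.Build (U * V)%type (@prod_complete U V).

HB.instance Definition _ (R : numFieldType) (U V : completePseudoMetricType R) :=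
  Uniform_isComplete.Build (U * V)%type cauchy_cvg.

Section lower_semicontinuity.
Context (R : realType) (Y : topologicalType).

Definition lsc_on (K : set Y) (g : Y -> R) := forall x t, K x -> t < g x ->
  \forall y \near x, K y -> t < g y.

(** Any cluster point of the filter generated by the sublevel sets is a minimiser. *)
Lemma lsc_min (K : set Y) (g : Y -> R) : compact K -> K !=set0 -> lsc_on K g ->
  exists2 x, K x & forall y, K y -> g x <= g y.
Proof.
move=> cK [x0 Kx0] lg.
pose F := filter_from K (fun z => [set y | K y /\ g y <= g z]).
have FF : ProperFilter F.
  apply: filter_from_proper; last by move=> z Kz; exists z; split.
  apply: filter_from_filter; first by exists x0.
  move=> i j Ki Kj; have [ij|ji] := leP (g i) (g j).
    by exists i => // y [Ky yi]; split; split => //; exact: le_trans ij.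
  by exists j => // y [Ky yi]; split; split => //; apply: le_trans (ltW ji).
have [|x [Kx clx]] := cK F FF.
  by exists x0 => // y [].
exists x => // z Kz; rewrite leNgt; apply/negP => zx.
have Fz : F [set y | K y /\ g y <= g z] by exists z.
have [y [[Ky yz] /(_ Ky)]] := clx _ _ Fz (lg x _ Kx zx).
by rewrite ltNge yz.
Qed.

Lemma inf_compact_lsc (A : set Y) (g : Y -> R) : hausdorff_space Y ->
  inf_compact A g -> lsc_on A g.
Proof.
move=> hY ig x t Ax tx.
have cl : closed [set y | A y /\ g y <= t] by apply: compact_closed => //; exact: ig.
have : nbhs x (~` [set y | A y /\ g y <= t]).
  by apply: open_nbhs_nbhs; split; [exact: closed_openC|move=> /= [_]; rewrite leNgt tx].
apply: filterS => y h Ay; rewrite ltNge; apply/negP => yt; exact: h.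
Qed.

Lemma lsc_onD (A : set Y) (f g : Y -> R) : lsc_on A f -> lsc_on A g -> lsc_on A (f \+ g).
Proof.
move=> lf lg x t Ax tx.
pose e := (f x + g x - t) / 2.
have e0 : 0 < e by rewrite divr_gt0// subr_gt0.
have h1 : f x - e < f x by rewrite ltrBlDr ltrDl.
have h2 : g x - e < g x by rewrite ltrBlDr ltrDl.
apply: filterS2 (lf x _ Ax h1) (lg x _ Ax h2) => y k1 k2 Ay.
by have := k1 Ay; have := k2 Ay; rewrite /= /e; lra.
Qed.

Lemma lsc_onZ (A : set Y) (c : R) (f : Y -> R) : 0 <= c -> lsc_on A f ->
  lsc_on A (fun x => c * f x).
Proof.
rewrite le_eqVlt => /predU1P[<- _ x t Ax|c0 lf x t Ax].
  by rewrite mul0r => t0; apply: nearW => y _; rewrite mul0r.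
rewrite mulrC -ltr_pdivrMr// => h; apply: filterS (lf x _ Ax h) => y hy Ay.
by rewrite mulrC -ltr_pdivrMr//; exact: hy.
Qed.

Lemma lsc_on_sum (A : set Y) (n : nat) (f : 'I_n -> Y -> R) :
  (forall i, lsc_on A (f i)) -> lsc_on A (fun x => \sum_i f i x).
Proof.
move=> lf; elim: (index_enum _) => [|i r IH].
  by under eq_fun do rewrite big_nil; move=> x t Ax t0; apply: nearW.
by under eq_fun do rewrite big_cons; exact: lsc_onD.
Qed.

End lower_semicontinuity.

(** [N.+2] points of an [N]-dimensional space are affinely dependent; the column of ones in [M]
    makes the dependence [u] sum to zero. Moving the weights along [- u] up to the least ratio
    [l j / u j] with [u j] positive cancels one of them and keeps the others nonnegative. *)
Lemma caratheodory_reduction (R : realFieldType) (N : nat) (l : 'I_N.+2 -> R)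
    (p : 'I_N.+2 -> 'I_N -> R) : (forall j, 0 <= l j) -> \sum_j l j = 1 ->
  exists j0 l', [/\ l' j0 = 0, forall j, 0 <= l' j, \sum_j l' j = 1 :> R &
    forall i, \sum_j l' j * p j i = \sum_j l j * p j i].
Proof.
move=> l0 l1.
pose M := \matrix_(j < N.+2, k < N.+1) if unlift ord0 k is Some i then p j i else 1.
have [u [u0 uM]] : exists u : 'rV[R]_N.+2, u != 0 /\ u *m M = 0.
  have : kermx M != 0.
    rewrite kermx_eq0 /row_free neq_ltn; apply/orP; left.
    by rewrite ltnS rank_leq_col.
  move=> /rowV0Pn[u ukM u0]; exists u; split => //; exact/sub_kermxP.
have usum : \sum_j u 0 j = 0.
  have := congr1 (fun A : 'rV_N.+1 => A 0 ord0) uM; rewrite !mxE => h; rewrite -[RHS]h.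
  by apply: eq_bigr => j _; rewrite mxE unlift_none mulr1.
have up i : \sum_j u 0 j * p j i = 0.
  have := congr1 (fun A : 'rV_N.+1 => A 0 (lift ord0 i)) uM; rewrite !mxE => h; rewrite -[RHS]h.
  by apply: eq_bigr => j _; rewrite mxE liftK.
have [j1 uj1] : exists j, 0 < u 0 j.
  apply/not_existsP => h; move/negP: u0; apply; apply/eqP/rowP => j; rewrite mxE.
  have un k : 0 <= - u 0 k by rewrite oppr_ge0 leNgt; apply/negP/h.
  have : \sum_k - u 0 k == 0 by rewrite sumrN usum oppr0.
  by rewrite psumr_eq0// => /allP/(_ j); rewrite mem_index_enum oppr_eq0 => /(_ isT)/eqP.
have [j0 uj0 minj0] := @Order.TotalTheory.arg_minP _ _ _ j1 (fun j => 0 < u 0 j)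
  (fun j => l j / u 0 j) uj1.
pose t := l j0 / u 0 j0; have t0 : 0 <= t by rewrite divr_ge0// ltW.
exists j0, (fun j => l j - t * u 0 j); split.
- by rewrite /t divfK ?subrr// gt_eqF.
- move=> j; rewrite subr_ge0; have [uj|uj] := ltP 0 (u 0 j).
    by rewrite -ler_pdivlMr//; exact: minj0.
  by rewrite (le_trans _ (l0 j))// mulr_ge0_le0.
- by rewrite sumrB l1 -mulr_sumr usum mulr0 subr0.
- move=> i; under eq_bigr do rewrite mulrBl -mulrA.
  by rewrite sumrB -mulr_sumr up mulr0 subr0.
Qed.

Lemma coord_rV_continuous (T : topologicalType) (n : nat) (j : 'I_n) :
  continuous (fun z : 'rV[T]_n => z ord0 j).
Proof.
move=> z P nP; exists (fun i k => [set y | k = j -> P y]).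
  move=> i k; have [->|kj] := eqVneq k j.
    by rewrite ord1; apply: filterS nP => y Py.
  by apply: filterS filterT => y _ kj'; move: kj; rewrite kj' eqxx.
by move=> y h; exact: h.
Qed.

Lemma lsc_on_comp (R : realType) (Y Y' : topologicalType) (K : set Y) (A : set Y')
    (p : Y -> Y') (g : Y' -> R) : continuous p -> (forall y, K y -> A (p y)) ->
  lsc_on A g -> lsc_on K (g \o p).
Proof.
move=> cp KA lg x t Kx tx.
have h : \forall y \near x, A (p y) -> t < g (p y) := cp x _ (lg _ t (KA _ Kx) tx).
by apply: filterS h => y h Ky; exact/h/KA.
Qed.

Lemma lsc_onM (R : realType) (Y : topologicalType) (K : set Y) (l g : Y -> R) :
  continuous l -> (forall y, K y -> 0 <= l y) -> (forall y, K y -> 0 <= g y) ->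
  lsc_on K g -> lsc_on K (fun y => l y * g y).
Proof.
move=> cl l0 g0 lg x t Kx tx.
have [t0|t0] := ltP t 0.
  by apply: nearW => y Ky; apply: lt_le_trans t0 _; rewrite mulr_ge0// ?l0 ?g0.
have lx : 0 < l x.
  rewrite lt_neqAle l0// andbT; apply/eqP => l0x.
  by move: tx; rewrite -l0x mul0r ltNge t0.
pose r := (t / l x + g x) / 2.
have tl : t / l x < g x by rewrite ltr_pdivrMr// mulrC.
have tl0 : 0 <= t / l x by rewrite divr_ge0// ltW.
have r0 : 0 < r by rewrite /r; lra.
have rg : r < g x by rewrite /r; lra.
have rt : t / r < l x.
  by rewrite ltr_pdivrMr// mulrC -ltr_pdivrMr// /r; lra.
have nl : \forall y \near x, t / r < l y.
  exact: (cvgr_gt _ (cl x) _ rt).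
apply: filterS2 nl (lg x r Kx rg) => y h1 h2 Ky.
have := h2 Ky => h3; rewrite ltr_pdivrMr// in h1.
apply: (lt_le_trans h1); rewrite ler_wpM2l ?l0//; exact: ltW.
Qed.

Lemma lsc_on_excess (R : realType) (Y : topologicalType) (K : set Y) (f : Y -> R) (w : R) :
  lsc_on K f -> lsc_on K (fun y => Num.max 0 (f y - w) ^+ 2).
Proof.
move=> lf x t Kx tx; have [t0|t0] := ltP t 0.
  by apply: nearW => y _; apply: lt_le_trans t0 _; exact: sqr_ge0.
have h : Num.sqrt t < f x - w.
  rewrite ltNge; apply/negP => fs; move: tx; rewrite ltNge => /negP; apply.
  by rewrite -[leRHS]sqr_sqrtr// lerXn2r// ?nnegrE ?le_max ?lexx// ge_max sqrtr_ge0.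
have h' : w + Num.sqrt t < f x by move: h; lra.
apply: filterS (lf x _ Kx h') => y hy Ky; have := hy Ky => hy'.
have hs : Num.sqrt t < f y - w by move: hy'; lra.
rewrite (max_idPr _); last by rewrite (le_trans (sqrtr_ge0 t))// ltW.
by rewrite -[ltLHS]sqr_sqrtr// ltrXn2r// ?nnegrE ?(le_trans (sqrtr_ge0 t)) ?ltW.
Qed.

Lemma rV_fst_continuous (X Y : topologicalType) (n : nat) (j : 'I_n) :
  continuous (fun z : 'rV[(X * Y)%type]_n => (z ord0 j).1).
Proof.
move=> z; apply: (@continuous_comp _ (X * Y)%type X (fun z : 'rV_n => z ord0 j) fst).
  exact: coord_rV_continuous.
exact: cvg_fst.
Qed.

Lemma rV_snd_continuous (X Y : topologicalType) (n : nat) (j : 'I_n) :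
  continuous (fun z : 'rV[(X * Y)%type]_n => (z ord0 j).2).
Proof.
move=> z; apply: (@continuous_comp _ (X * Y)%type Y (fun z : 'rV_n => z ord0 j) snd).
  exact: coord_rV_continuous.
exact: cvg_snd.
Qed.

(** * Convex combinations lying below a given vector *)

Section convex_domination.
Context (R : realType) (X : ptopologicalType) (N : nat).
Variables (A : set X) (v : 'I_N -> X -> R) (w : 'I_N -> R).
Hypotheses (cA : compact A) (v0 : forall i x, A x -> 0 <= v i x)
  (lv : forall i, lsc_on A (v i))
  (dom : forall al : 'I_N -> R, (forall i, 0 <= al i) ->
    exists2 x, A x & \sum_i al i * v i x <= \sum_i al i * w i).

Let Z := 'rV[(X * R)%type]_N.+1.

Let K : set Z := [set z | (forall j, (A `*` `[0, 1]%classic) (z ord0 j)) /\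
  \sum_j (z ord0 j).2 = 1].

Let compact_K : compact K.
Proof.
have -> : K = [set z : Z | forall j, (A `*` `[0, 1]%classic) (z ord0 j)] `&`
  ((fun z : Z => \sum_j (z ord0 j).2) @^-1` [set 1]) by [].
apply: compact_closedI.
  by apply: (@rV_compact (X * R)%type _ (fun=> A `*` `[0, 1]%classic)) => j; apply: compact_setX => //; exact: segment_compact.
apply: preimage_closed; last exact: closed_eq.
by move=> z _; apply: (cvg_sumr (nbhs_filter z)) => j _; exact: rV_snd_continuous.
Qed.

Let s i (z : Z) := \sum_j (z ord0 j).2 * v i (z ord0 j).1.

Let lsc_s i : lsc_on K (s i).
Proof.
apply: lsc_on_sum => j; apply: lsc_onM; first exact: rV_snd_continuous.
- by move=> z [/(_ j)[_ /=]]; rewrite in_itv/= => /andP[].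
- by move=> z [/(_ j)[Az _] _]; exact: v0.
- have KA (z : Z) : K z -> A (z ord0 j).1 by move=> [/(_ j)[]].
  exact: (lsc_on_comp (@rV_fst_continuous X R _ j) KA (@lv i)).
Qed.

Let exc i z := Num.max 0 (s i z - w i).

(** The squared distance from the combination [s ^~ z] to the orthant of vectors below [w]. *)
Let Phi z := \sum_i exc i z ^+ 2.

Let lsc_Phi : lsc_on K Phi.
Proof. by apply: lsc_on_sum => i; apply: lsc_on_excess; exact: lsc_s. Qed.

Let K_neq0 : K !=set0.
Proof.
have [x Ax _] := dom (fun=> lexx 0).
exists (\row_j (x, (j == ord0)%:R)); split => [j|].
  rewrite mxE; split => //=; rewrite in_itv/=.
  by case: eqVneq => _; rewrite ?lexx ?ler01.
under eq_bigr do rewrite mxE/=.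
by rewrite (bigD1 ord0)//= big1 ?addr0// => j /negPf ->.
Qed.

(* Moving a little mass of [z] towards [x] costs one more point, which
   Caratheodory's reduction removes. *)
Let shift_mass z x (t : R) : K z -> A x -> 0 <= t <= 1 ->
  exists2 z', K z' & forall i, s i z' = (1 - t) * s i z + t * v i x.
Proof.
move=> [Kz z1] Ax /andP[t0 t1].
pose l (j : 'I_N.+2) := if unlift ord0 j is Some j' then (1 - t) * (z ord0 j').2 else t.
pose q (j : 'I_N.+2) := if unlift ord0 j is Some j' then (z ord0 j').1 else x.
have l0 j : 0 <= l j.
  rewrite /l; case: unliftP => [j' _|//]; rewrite mulr_ge0 ?subr_ge0//.
  by have [_ /=] := Kz j'; rewrite in_itv/= => /andP[].
have l1 : \sum_j l j = 1.
  rewrite big_ord_recl /l unlift_none; under eq_bigr do rewrite liftK.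
  by rewrite -mulr_sumr z1; ring.
have [j0 [l' [l'0 l'ge l'1 l'E]]] := caratheodory_reduction (fun j i => v i (q j)) l0 l1.
have drop (h : 'I_N.+2 -> R) : h j0 = 0 -> \sum_j h j = \sum_j h (lift j0 j).
  by move=> h0; rewrite (bigD1_ord j0)//= h0 add0r.
exists (\row_j (q (lift j0 j), l' (lift j0 j))).
  split=> [j|]; last first.
    by under eq_bigr do rewrite mxE/=; rewrite -drop.
  rewrite mxE; split => /=.
    by rewrite /q; case: unliftP => // j' _; case: (Kz j').
  rewrite in_itv/= l'ge/= -l'1 (bigD1 (lift j0 j))//= lerDl.
  by apply: sumr_ge0.
move=> i; rewrite /s; under eq_bigr do rewrite mxE/=.
rewrite -(drop (fun j => l' j * v i (q j))) ?l'0 ?mul0r// l'E.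
rewrite big_ord_recl /l /q unlift_none; under eq_bigr do rewrite liftK.
by rewrite addrC mulr_sumr; congr (_ + _); apply: eq_bigr => j _; rewrite mulrA.
Qed.

(** [Phi] attains its minimum. The hypothesis in the direction of the excess vector at the minimiser
    provides a point of [A] towards which [Phi] would decrease to first order unless it were already
    zero. *)
Lemma convex_domination : exists z : 'rV[(X * R)%type]_N.+1,
  [/\ forall j, A (z ord0 j).1, forall j, 0 <= (z ord0 j).2,
      \sum_j (z ord0 j).2 = 1 &
      forall i, \sum_j (z ord0 j).2 * v i (z ord0 j).1 <= w i].
Proof.
have [z Kz zmin] := lsc_min compact_K K_neq0 lsc_Phi.
have [Kz1 Kz2] := Kz.
exists z; split => // [j|j|i].
- by case: (Kz1 j).
- by have [_ /=] := Kz1 j; rewrite in_itv/= => /andP[].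
have r0 k : 0 <= exc k z by rewrite le_max lexx.
have [x Ax hx] := dom r0.
pose D := \sum_k (v k x - s k z) ^+ 2.
have D0 : 0 <= D by apply: sumr_ge0 => k _; exact: sqr_ge0.
have m0 : 0 <= Phi z by apply: sumr_ge0 => k _; exact: sqr_ge0.
have excE k : exc k z * (s k z - w k) = exc k z ^+ 2.
  by rewrite /exc; case: (leP 0 (s k z - w k)) => _; rewrite ?expr2// !mul0r.
have cross : \sum_k exc k z * (v k x - s k z) <= - Phi z.
  have E : Phi z = \sum_k exc k z * s k z - \sum_k exc k z * w k.
    by rewrite -sumrB; apply: eq_bigr => k _; rewrite -mulrBr excE.
  by under eq_bigr do rewrite mulrBr; rewrite sumrB E; move: hx; lra.
have Phi_le t : 0 <= t <= 1 -> Phi z <= Phi z + 2 * t * (- Phi z) + t ^+ 2 * D.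
  move=> t01; have [z' Kz' sz'] := shift_mass Kz Ax t01.
  apply: (le_trans (zmin _ Kz')).
  apply: (@le_trans _ _ (\sum_k (exc k z + t * (v k x - s k z)) ^+ 2)).
    (* The excess dominates [s k z - w k], so replacing the latter by the former in the shifted
       combination can only raise the bound. *)
    apply: ler_sum => k _; rewrite /exc sz'.
    set a := Num.max 0 (s k z - w k).
    have ha : s k z - w k <= a by rewrite le_max lexx orbT.
    set b := a + _.
    have hb : (1 - t) * s k z + t * v k x - w k <= b by rewrite /b; move: ha; lra.
    rewrite -[leRHS]real_normK ?num_real// lerXn2r ?nnegrE ?le_max ?lexx//.
    by rewrite ge_max normr_ge0/= (le_trans hb)// ler_norm.
  have -> : \sum_k (exc k z + t * (v k x - s k z)) ^+ 2 =
      Phi z + 2 * t * \sum_k exc k z * (v k x - s k z) + t ^+ 2 * D.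
    rewrite /Phi /D !mulr_sumr -!big_split/=; apply: eq_bigr => k _; ring.
  case/andP: t01 => t0 _; rewrite lerD2r lerD2l ler_wpM2l// mulr_ge0//.
have Phi0 : Phi z = 0.
  apply/eqP; rewrite eq_le m0 andbT leNgt; apply/negP => mpos.
  have den : 0 < Phi z + D + 1 by move: mpos D0; lra.
  (* Small enough that [t * D <= Phi z], so that the gain [2 t Phi z] beats the quadratic error
     [t ^+ 2 * D]. *)
  pose t := Phi z / (Phi z + D + 1).
  have t0 : 0 < t by rewrite divr_gt0.
  have tE : t * (Phi z + D + 1) = Phi z by rewrite /t divfK// gt_eqF.
  have t1 : t <= 1 by rewrite ler_pdivrMr// mul1r; move: D0; lra.
  have := Phi_le t; rewrite ltW//= => /(_ t1).
  have tD : t * D <= Phi z by rewrite -[leRHS]tE ler_pM2l//; move: mpos; lra.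
  have : t * (t * D) <= t * Phi z by rewrite ler_pM2l.
  have : 0 < t * Phi z by rewrite mulr_gt0.
  rewrite expr2; lra.
have : exc i z ^+ 2 == 0.
  move/eqP : Phi0; rewrite psumr_eq0 => [/allP/(_ i)|k _]; last exact: sqr_ge0.
  by rewrite mem_index_enum; exact.
rewrite sqrf_eq0 /exc => /eqP h; rewrite -subr_le0 -[leRHS]h.
by rewrite le_max lexx orbT.
Qed.

End convex_domination.

(** * Almost everywhere convergence in nested convex sets *)

Section nested_convex.
Context d (T : measurableType d) (R : realType) (mu : {finite_measure set T -> \bar R}).
Variables (N : nat) (C : nat -> set (T -> 'I_N -> R)).
Hypotheses (mC : forall k w, C k w -> forall i, measurable_fun setT (w ^~ i))
  (C0 : forall k w, C k w -> forall x i, 0 <= w x i)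
  (Cnest : forall k, C k.+1 `<=` C k) (Cne : forall k, C k !=set0)
  (Cmid : forall k w w', C k w -> C k w' -> C k (fun x i => (w x i + w' x i) / 2)).

Let E (w : T -> 'I_N -> R) := \int[mu]_x \sum_i expR (- w x i).

Let z (w : T -> 'I_N -> R) x i := expR (- (w x i) / 2).

Let mz k w i : C k w -> measurable_fun setT (fun x => z w x i).
Proof.
move=> Cw; apply: measurableT_comp; first exact: measurable_expR.
apply: measurable_funM => //; apply: measurableT_comp => //; exact: mC Cw i.
Qed.

Let z01 k w x i : C k w -> 0 <= z w x i <= 1.
Proof.
move=> Cw; rewrite expR_ge0/= -expR0 ler_expR mulNr oppr_le0 divr_ge0//.
exact: C0 Cw x i.
Qed.

Let zE w x i : expR (- w x i) = z w x i ^+ 2.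
Proof. by rewrite /z expr2 -expRD; congr expR; lra. Qed.

Let bnd (h : T -> R) (M : R) : measurable_fun setT h -> (forall x, `|h x| <= M) ->
  mu.-integrable setT (EFin \o h).
Proof. by move=> mh hM; exact: (bounded_integrable mu mh hM). Qed.

Let iE k w : C k w -> mu.-integrable setT (EFin \o (fun x => \sum_i expR (- w x i))).
Proof.
move=> Cw; apply: (bnd (M := \sum_(i < N) 1)).
  apply: measurable_sum => i; under eq_fun do rewrite zE.
  by apply: measurable_funX; exact: mz Cw.
move=> x; rewrite ger0_norm; last by apply: sumr_ge0 => i _; exact: expR_ge0.
by apply: ler_sum => i _; rewrite zE exprn_ile1//; case/andP: (z01 x i Cw).
Qed.

Let M := \int[mu]_x (\sum_(i < N) (1 : R)).

Let E_le k w : C k w -> E w <= M.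
Proof.
move=> Cw; apply: le_Rintegral => //; first exact: iE Cw.
  exact: finite_measure_integrable_cst.
move=> x _; apply: ler_sum => i _; rewrite zE exprn_ile1//; by case/andP: (z01 x i Cw).
Qed.

Let E_ge0 w : 0 <= E w.
Proof. by apply: Rintegral_ge0 => x _; apply: sumr_ge0 => i _; exact: expR_ge0. Qed.

Let Cle k l : (k <= l)%N -> C l `<=` C k.
Proof.
elim: l => [|l IH]; first by rewrite leqn0 => /eqP ->.
rewrite leq_eqVlt ltnS => /predU1P[->//|/IH h] w /Cnest; exact: h.
Qed.

Let J k := inf (E @` C k).

Let infJ k : has_inf (E @` C k).
Proof.
split; first by have [w Cw] := Cne k; exists (E w), w.
by exists 0 => _ [w _ <-]; exact: E_ge0.
Qed.

Let J_le k w : C k w -> J k <= E w.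
Proof. by move=> Cw; apply: ge_inf; [case: (infJ k)|exists w]. Qed.

Let J_near k (e : R) : 0 < e -> exists2 w, C k w & E w < J k + e.
Proof.
by move=> e0; have [_ [w Cw <-] h] := inf_adherent e0 (infJ k); exists w.
Qed.

Let supJ : has_sup (range J).
Proof.
split; first by exists (J 0%N), 0%N.
exists M => _ [k _ <-]; have [w Cw] := Cne k.
exact: le_trans (J_le Cw) (E_le Cw).
Qed.

Let J_nd k l : (k <= l)%N -> J k <= J l.
Proof.
move=> kl; apply: lb_le_inf; first by case: (infJ l).
by move=> _ [w Cw <-]; apply: J_le; exact: Cle kl _ Cw.
Qed.

(* The identity [exp(-a) + exp(-b) - 2 exp(-(a+b)/2) = (exp(-a/2) - exp(-b/2))^2]
   makes near-minimisers of [E] close to each other. *)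
Let parallelogram k w w' : C k w -> C k w' ->
  \int[mu]_x (\sum_i (z w' x i - z w x i) ^+ 2) =
  E w + E w' - 2 * E (fun x i => (w x i + w' x i) / 2).
Proof.
move=> Cw Cw'; have Cm := Cmid Cw Cw'.
rewrite /E -RintegralZl//; last exact: iE Cm.
rewrite -RintegralD//; [|exact: iE Cw|exact: iE Cw'].
rewrite -RintegralB//; first last.
- exact: (integrableZl measurableT _ (iE Cm)).
- exact: (integrableD measurableT (iE Cw) (iE Cw')).
apply: eq_Rintegral => x _; rewrite mulr_sumr -big_split -sumrB/=.
apply: eq_bigr => i _; rewrite (zE w) (zE w') /z.
have -> : expR (- ((w x i + w' x i) / 2)) = expR (- w x i / 2) * expR (- w' x i / 2).
  by rewrite -expRD; congr expR; lra.
ring.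
Qed.

(** The infima of [E] over the shrinking sets increase to a finite limit. Near-minimisers taken
    close to that limit have midpoints of nearly the same energy, so successive values of
    [exp(-w/2)] are within a multiple of [2^-k] in L^2, and their differences are absolutely
    summable almost everywhere. *)
Lemma nested_convex_cvg : exists w : nat -> T -> 'I_N -> R,
  (forall k, C k (w k)) /\
  {ae mu, forall x, forall i, cvgn (fun k => expR (- (w k x i) / 2))}.
Proof.
pose q k : R := 4^-1 ^+ k.
have q0 k : 0 < q k by rewrite exprn_gt0.
have qS k : q k.+1 = 4^-1 * q k by rewrite /q exprS.
have /choice[n hn] : forall k, exists n, (k <= n)%N /\ sup (range J) - q k < J n.
  move=> k; have [_ [n _ <-] h] := sup_adherent (q0 k) supJ.
  exists (maxn k n); split; first exact: leq_maxl.
  by apply: (lt_le_trans h); apply: J_nd; exact: leq_maxr.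
have /choice[w hw] : forall k, exists w, C (n k) w /\ E w < J (n k) + q k.
  by move=> k; have [w Cw h] := J_near (n k) (q0 k); exists w.
have Ck k : C k (w k) by apply: (Cle (hn k).1); exact: (hw k).1.
exists w; split => //.
have Jsup k : J k <= sup (range J) by apply: sup_upper_bound => //; exists k.
pose D k := \int[mu]_x (\sum_i (z (w k.+1) x i - z (w k) x i) ^+ 2).
have hD k : D k <= 4 * q k.
  (* The midpoint is known to lie only in the larger of the two sets; its infimum is still within
     [q k] of the limit. *)
  pose l := minn (n k) (n k.+1).
  have C1 : C l (w k) by apply: (Cle (geq_minl _ _)); exact: (hw k).1.
  have C2 : C l (w k.+1) by apply: (Cle (geq_minr _ _)); exact: (hw k.+1).1.
  rewrite /D (parallelogram C1 C2).
  have h0 := J_le (Cmid C1 C2).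
  have hl : sup (range J) - q k < J l.
    rewrite /l /minn; case: ifPn => _; first exact: (hn k).2.
    have := (hn k.+1).2; have := q0 k; rewrite qS; lra.
  have := (hw k).2; have := (hw k.+1).2; have := Jsup (n k); have := Jsup (n k.+1).
  have := q0 k; rewrite qS; lra.
suff H i : {ae mu, forall x, cvgn (fun k => z (w k) x i)} by exact: filter_forall.
pose h k x := `|z (w k.+1) x i - z (w k) x i|.
have md k : measurable_fun setT (fun x => z (w k.+1) x i - z (w k) x i).
  by apply: measurable_funB; [exact: mz (Ck k.+1)|exact: mz (Ck k)].
have mh k : measurable_fun setT (h k) by exact: measurableT_comp.
have d1 k x j : `|z (w k.+1) x j - z (w k) x j| <= 1.
  have := z01 x j (Ck k); have := z01 x j (Ck k.+1); rewrite ler_norml; lra.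
have ih k : mu.-integrable setT (EFin \o h k).
  by apply: (bnd (M := 1)) => // x; rewrite normr_id; exact: d1.
pose r k : R := 2^-1 ^+ k.
have r0 k : 0 < r k by rewrite exprn_gt0.
pose m1 := \int[mu]_x (1 : R).
have m10 : 0 <= m1 by apply: Rintegral_ge0.
have hh k : \int[mu]_x h k x <= (m1 + 4) * r k.
  have isq : mu.-integrable setT (EFin \o (fun x => \sum_j (z (w k.+1) x j - z (w k) x j) ^+ 2)).
    apply: (bnd (M := \sum_(j < N) 1)).
      apply: measurable_sum => j; apply: measurable_funX.
      by apply: measurable_funB; [exact: mz (Ck k.+1)|exact: mz (Ck k)].
    move=> x; rewrite ger0_norm; last by apply: sumr_ge0 => j _; exact: sqr_ge0.
    by apply: ler_sum => j _; rewrite -real_normK ?num_real// exprn_ile1.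
  have i1 : mu.-integrable setT (EFin \o (cst (r k) : T -> R)).
    exact: finite_measure_integrable_cst.
  have i2 := integrableZl measurableT (r k)^-1 isq.
  (* The bound [b <= r + b ^+ 2 / r] for nonnegative [b] takes the place of the Cauchy-Schwarz
     inequality; [r k] is the square root of [q k]. *)
  apply: (@le_trans _ _ (\int[mu]_x (r k + (r k)^-1 * \sum_j (z (w k.+1) x j - z (w k) x j) ^+ 2))).
    apply: le_Rintegral => //; first exact: (integrableD measurableT i1 i2).
    move=> x _; rewrite /h.
    apply: (@le_trans _ _ (r k + (r k)^-1 * (z (w k.+1) x i - z (w k) x i) ^+ 2)).
      set a := _ - _; rewrite -(real_normK (num_real a)); have := normr_ge0 a.
      set b := `|a|; move=> b0.
      have : 0 <= (r k)^-1 * (b - r k) ^+ 2 by rewrite mulr_ge0 ?sqr_ge0 ?invr_ge0 ?ltW.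
      have -> : (r k)^-1 * (b - r k) ^+ 2 = (r k)^-1 * b ^+ 2 - 2 * b + r k.
        by field; rewrite gt_eqF.
      lra.
    rewrite lerD2l ler_wpM2l ?invr_ge0 ?(ltW (r0 k))// (bigD1 i)//= lerDl.
    by apply: sumr_ge0 => j _; exact: sqr_ge0.
  rewrite RintegralD// RintegralZl// -/(D k).
  have -> : \int[mu]_x r k = r k * m1.
    rewrite /m1 -RintegralZl//; first by apply: eq_Rintegral => x _; rewrite mulr1.
    exact: finite_measure_integrable_cst.
  have : (r k)^-1 * D k <= (r k)^-1 * (4 * q k) by rewrite ler_wpM2l ?invr_ge0 ?(ltW (r0 k)) ?hD.
  have -> : (r k)^-1 * (4 * q k) = 4 * r k.
    have -> : q k = r k * r k by rewrite /q /r -exprMn; congr (_ ^+ _); field.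
    by field; rewrite gt_eqF.
  lra.
have H : {ae mu, forall x, cvgn (series (h ^~ x))}.
  apply: (@ae_summable _ _ _ mu _ (2 * (m1 + 4))) => [//|k x|k]; first exact: normr_ge0.
  rewrite (eq_bigr (fun l : 'I_k => (\int[mu]_x (h l x))%:E)); last first.
    by move=> l _; rewrite /Rintegral fineK//; exact: (integrable_fin_num measurableT (ih l)).
  rewrite sumEFin lee_fin.
  apply: (@le_trans _ _ ((m1 + 4) * (2 - 2 * r k))); last first.
    have := r0 k; have := m10; move=> ? ?.
    by rewrite mulrC ler_wpM2r//; lra.
  elim: k => [|k IH]; first by rewrite big_ord0 /r expr0 mulr1 subrr mulr0.
  rewrite big_ord_recr/=; have := hh k; move: IH.
  have -> : r k.+1 = r k / 2 by rewrite /r exprSr.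
  lra.
apply: filterS H => x.
move=> H.
have : cvgn (series (fun k => z (w k.+1) x i - z (w k) x i)) by apply: normed_cvg.
have -> : series (fun k => z (w k.+1) x i - z (w k) x i) =
    (fun k => z (w k) x i - z (w 0%N) x i).
  apply/funext => k; rewrite seriesEnat/= telescope_sumr//.
move=> /cvg_ex[l cl]; apply/cvg_ex; exists (l + z (w 0%N) x i).
rewrite (_ : (fun k => z (w k) x i) = (fun k => z (w k) x i - z (w 0%N) x i + z (w 0%N) x i)).
  by apply: cvgD cl _; exact: cvg_cst.
by apply/funext => k; rewrite subrK.
Qed.

End nested_convex.

(** * Measurability for the topology of weak convergence *)

Lemma continuous_borel_measurable (X Y : ptopologicalType) (f : X -> Y) :
  continuous f -> measurable_fun setT (f : borel X -> borel Y).
Proof.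
move=> cf; apply: (@measurability _ _ (borel X) (borel Y) setT f (@open Y)) => // _ [U oU <-].
by rewrite setTI; apply: sub_sigma_algebra; move/continuousP : cf; apply.
Qed.

Lemma continuous_borel_measurableR (R : realType) (X : ptopologicalType) (f : X -> R) :
  continuous f -> measurable_fun setT (f : borel X -> R).
Proof.
move=> cf; apply: (measurability _ (RGenOpens.measurableE R)) => //.
move=> _ [_ [a [b ->]] <-]; rewrite setTI; apply: sub_sigma_algebra.
by move/continuousP : cf; apply; exact: interval_open.
Qed.

Section weak_topology_measurability.
Context (R : realType) (X : completeMetricType R).

(** Running maxima of the Urysohn functions that separate the complement of [U] from closed sets
    with union [U]; the maxima make the sequence monotone. *)
Lemma open_urysohn_approx (U : set X) : open U -> exists g : nat -> X -> R,
  [/\ forall n, continuous (g n), forall n x, 0 <= g n x <= 1,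
      forall x, {homo g^~ x : n m / (n <= m)%N >-> n <= m} &
      forall x, g n x @[n --> \oo] --> (\1_U x : R)].
Proof.
move=> oU; have [F [cF UE]] := open_bigcup_closed oU.
have /(@normal_separatorP R X) sep := @pseudometric_normal R X.
have sepn n : uniform_separator (~` U) (F n).
  apply: sep => //; first exact: open_closedC.
  apply/seteqP; split => // x [Ux Fx]; apply: Ux; rewrite UE; by exists n.
pose h n : X -> R := Urysohn (~` U) (F n).
have h01 n x : 0 <= h n x <= 1.
  have : `[0, 1]%classic (h n x) by apply: (@Urysohn_range X R (~` U) (F n)); exists x.
  by rewrite /= in_itv.
pose g := fix g n := if n is m.+1 then (fun x => Num.max (g m x) (h n x)) else h 0%N.
have g01 n x : 0 <= g n x <= 1.
  elim: n => [|n IH]; first exact: h01.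
  by have := h01 n.+1 x; rewrite /= le_max ge_max; lra.
have gS n x : g n x <= g n.+1 x by rewrite /= le_max lexx.
have gh n x : h n x <= g n x by case: n => //= n; rewrite le_max lexx orbT.
have gnd x : {homo g^~ x : n m / (n <= m)%N >-> n <= m}.
  by apply: homo_leq => // ? ? ?; exact: le_trans.
exists g; split => //.
- elim=> [|n IH]; first exact: Urysohn_continuous.
  move=> x; apply: continuous_max; [exact: IH|exact: Urysohn_continuous].
- move=> x; rewrite indicE; have [Ux|Ux] := pselect (U x).
    rewrite mem_set//=; have [n _ Fn] : (\bigcup_n F n) x by rewrite -UE.
    have hn1 : h n x = 1 by apply: (Urysohn_sub1 (sepn n)); exists x.
    apply: cvg_near_cst; exists n => //= m nm.
    apply/eqP; rewrite eq_le; case/andP: (g01 m x) => _ -> /=.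
    by rewrite -hn1 (le_trans (gh n x))// gnd.
  rewrite memNset//=; have g0 n : g n x = 0.
    have h0 m : h m x = 0 by apply: (Urysohn_sub0 (sepn m)); exists x.
    elim: n => [|n IH]; first exact: h0.
    by rewrite [LHS](_ : _ = Num.max (g n x) (h n.+1 x))// IH h0 maxxx.
  by under eq_fun do rewrite g0; exact: cvg_cst.
Qed.

Context d (Omega : measurableType d) (phi : Omega -> weak_probability R X).
Hypothesis mphi : measurable_fun setT (phi : Omega -> borel (weak_probability R X)).

Let m_eval_continuous (g : X -> R) : continuous g -> bounded_fun g ->
  measurable_fun setT (fun w => \int[prob_of (phi w)]_x g x).
Proof.
move=> cg bg.
have Bg : bounded_continuous g by split.
pose G : set_type (@bounded_continuous R X) := SigSub (mem_set Bg).
pose ev (P : weak_probability R X) : R := \int[prob_of P]_x g x.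
have cev : continuous ev.
  move=> P.
  apply: (@continuous_comp (weak_probability R X)
    {ptws set_type (@bounded_continuous R X) -> R} R (@integral_against R X) (fun f => f G)).
    exact: initial_continuous.
  exact: (@proj_continuous _ (fun=> R) G).
have mev : measurable_fun setT (ev : borel (weak_probability R X) -> R).
  exact: continuous_borel_measurableR.
exact: (measurableT_comp mev mphi).
Qed.

(** Dynkin induction from the open sets: the indicator of an open set is an increasing limit of
    bounded continuous functions, whose integrals are continuous for the weak topology. *)
Lemma weak_eval_measurable (B : set X) : measurable (B : set (borel X)) ->
  measurable_fun setT (fun w => prob_of (phi w) (B : set (borel X))).
Proof.
move=> mB.
apply: (@dynkin_induction _ (borel X) (@open X)
  (fun B => measurable_fun setT (fun w => prob_of (phi w) B))) => //.
- by move=> U V; exact: openI.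
- apply: (eq_measurable_fun (cst 1%E)) => // w _.
  by apply/esym; exact: (@probability_setT _ _ _ (prob_of (phi w))).
- move=> U oU; have [g [cg g01 gnd gU]] := open_urysohn_approx oU.
  have mg n : measurable_fun setT (g n : borel X -> R).
    by apply: continuous_borel_measurableR; exact: cg.
  have mU : measurable (U : set (borel X)) by exact: sub_sigma_algebra.
  pose I n w := (\int[prob_of (phi w)]_x (g n x)%:E)%E.
  apply: (emeasurable_fun_cvg I) => [n|w _].
    have bg : bounded_fun (g n).
      exists 1; split => // y y1 x _ /=; case/andP: (g01 n x) => h1 h2.
      by rewrite ger0_norm// (le_trans h2)// ltW.
    apply: (eq_measurable_fun (fun w => (\int[prob_of (phi w)]_x g n x)%:E)) => [w _|]; last first.
      by apply/measurable_EFinP; exact: m_eval_continuous.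
    rewrite /Rintegral fineK//.
    apply: integrable_fin_num => //.
    apply: measurable_bounded_integrable => //.
    by apply: le_lt_trans (probability_le1 (prob_of (phi w)) _) (ltry 1).
  have -> : prob_of (phi w) U = (\int[prob_of (phi w)]_x (\1_U x)%:E)%E.
    by rewrite integral_indic// setIT.
  rewrite /I.
  rewrite [X in _ --> X](_ : _ =
      \int[prob_of (phi w)]_x (limn (fun n => (g n x)%:E)))%E; last first.
    apply: eq_integral => x _; apply/esym/cvg_lim => //.
    by apply: cvg_EFin; [exact: nearW|exact: gU].
  apply: cvg_monotone_convergence => //.
  + by move=> n; exact/measurable_EFinP.
  + by move=> n x _; rewrite lee_fin; case/andP: (g01 n x).
  + by move=> x _ n m nm; rewrite lee_fin; exact: gnd.
- move=> S mS hS.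
  apply: (eq_measurable_fun (fun w => 1 - prob_of (phi w) S)%E) => [w _|].
    by apply/esym; exact: (@probability_setC _ _ _ (prob_of (phi w))).
  exact: emeasurable_funB.
- move=> F mF tF hF.
  apply: (emeasurable_fun_cvg (fun n w => \sum_(0 <= i < n) prob_of (phi w) (F i))%E) => [n|w _].
    exact: emeasurable_sum.
  by apply: measure_semi_sigma_additive => //; exact: bigcupT_measurable.
Qed.

(** [phi] seen as a probability kernel, for which integrals depending on a parameter are
    measurable. *)
Let k (w : Omega) : {measure set (borel X) -> \bar R} := prob_of (phi w).

HB.instance Definition _ := isKernel.Build _ _ Omega (borel X) R k weak_eval_measurable.

HB.instance Definition _ := Kernel_isProbability.Build _ _ Omega (borel X) R k
  (fun w => @probability_setT _ _ _ (prob_of (phi w))).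

Lemma weak_integral_measurable (h : Omega * X -> \bar R) :
  measurable_fun setT (h : Omega * borel X -> \bar R) -> (forall z, 0 <= h z)%E ->
  measurable_fun setT (fun w => \int[prob_of (phi w)]_x h (w, x))%E.
Proof. by move=> mh h0; exact: (@measurable_fun_integral_finite_kernel _ _ Omega (borel X) R h k h0 mh). Qed.

End weak_topology_measurability.

(** * Measurable domination and pure decisions *)

Lemma measurable_set_le d (T : measurableType d) (R : realType) (f g : T -> R) :
  measurable_fun setT f -> measurable_fun setT g -> measurable [set x | f x <= g x].
Proof.
move=> mf mg; rewrite [X in measurable X](_ : _ = (f \- g) @^-1` `]-oo, 0]); last first.
  by apply/seteqP; split => x /=; rewrite in_itv/= subr_le0.
by rewrite -[X in measurable X]setTI; apply: measurable_funB.
Qed.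

Lemma measurable_set_forall d (T : measurableType d) (I : finType) (P : I -> T -> Prop) :
  (forall i, measurable [set x | P i x]) -> measurable [set x | forall i, P i x].
Proof.
move=> mP; rewrite [X in measurable X](_ : _ = \bigcap_(i in setT) [set x | P i x]).
  by apply: fin_bigcap_measurable => // i _.
by apply/seteqP; split => x h i; [move=> _; exact: h|exact: h].
Qed.

Lemma lsc_on_closed (R : realType) (Y : topologicalType) (K : set Y) (g : Y -> R) (t : R) :
  closed K -> lsc_on K g -> closed [set y | K y /\ g y <= t].
Proof.
move=> clK lg y hy; have Ky : K y.
  by apply: clK => U /hy[z [[Kz _] Uz]]; exists z.
split => //; rewrite leNgt; apply/negP => tg.
by have [z [[Kz gz] /(_ Kz)]] := hy _ (lg y t Ky tg); rewrite ltNge gz.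
Qed.

Section dense_sequences.
Context (R : realType).

Definition dense_seq (Z : pseudoMetricType R) (dn : nat -> Z) :=
  forall (z : Z) (e : R), 0 < e -> exists k, ball z e (dn k).

Lemma separable_dense_seq (Z : pseudoPMetricType R) : separable_space Z ->
  exists dn : nat -> Z, dense_seq dn.
Proof.
move=> [D [cD dD]].
have /pfcard_geP[D0|[f]] := cD.
  have := dD setT (@ex_intro _ _ point I) openT.
  by rewrite D0 setI0 => -[].
exists f => z e e0.
have [|y [yB Dy]] := dD (ball z e)^° _ (open_interior _).
  by exists z; exact: nbhsx_ballx.
have [k _ fk] : (f @` setT) y by apply: (@surj _ _ _ _ f).
exists k; rewrite fk; exact: interior_subset.
Qed.

Lemma real_dense_seq : exists dn : nat -> R, dense_seq dn.
Proof.
exists (fun k => ratr (odflt 0 (unpickle k))) => z e e0.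
have ze : (z : R) < z + e by rewrite ltrDl.
have [q] := rat_in_itvoo ze.
rewrite in_itv/= => /andP[q1 q2]; exists (pickle q); rewrite pickleK/=.
by rewrite /ball/= ltr_distlC; lra.
Qed.

Lemma prod_dense_seq (U V : pseudoMetricType R) (du : nat -> U) (dv : nat -> V) :
  dense_seq du -> dense_seq dv ->
  exists dn : nat -> (U * V)%type, dense_seq dn.
Proof.
move=> hu hv.
exists (fun k => let ij := odflt (0, 0)%N (unpickle k) in (du ij.1, dv ij.2)) => -[x y] e e0.
have [i hi] := hu x e e0; have [j hj] := hv y e e0.
by exists (pickle (i, j)); rewrite pickleK.
Qed.

Lemma rV_dense_seq (Z : pseudoMetricType R) (n : nat) (dn : nat -> Z) :
  dense_seq dn -> exists dv : nat -> 'rV[Z]_n.+1, dense_seq dv.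
Proof.
move=> hd.
exists (fun k => \row_j dn (nth 0%N (odflt [::] (unpickle k)) j)) => z e e0.
have /choice[s hs] := fun j => hd (z ord0 j) e e0.
exists (pickle [seq s j | j <- enum 'I_n.+1]); rewrite pickleK/=; split => // i j.
by rewrite mxE ord1 (nth_map ord0) ?size_enum_ord// nth_ord_enum.
Qed.

End dense_sequences.

Section measurable_domination.
Context d (Omega : measurableType d) (R : realType) (X : completeMetricType R).
Variables (mu : {finite_measure set Omega -> \bar R}) (dn : nat -> X).
Hypotheses (mu_complete : measure_is_complete mu) (dense_dn : dense_seq dn).
Variables (A : Omega -> set X) (N : nat) (v : 'I_N -> Omega * X -> R).
Hypotheses (mA : measurable (corr_graph A : set (Omega * borel X)))
  (cA : forall w, compact (A w))
  (mv : forall i, measurable_fun setT (v i : Omega * borel X -> R))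
  (v0 : forall i z, 0 <= v i z)
  (lv : forall i w, lsc_on (A w) (fun x => v i (w, x))).

(** The point [y] may depend on the direction [al]. No point of the hull is named, so the condition
    can be checked one direction at a time; [convex_domination] recovers a convex combination below
    [w]. *)
Definition dominates_lower_hull (w : 'I_N -> R) (x : Omega) :=
  forall al : 'I_N -> R, (forall i, 0 <= al i) ->
    exists2 y, A x y & \sum_i al i * v i (x, y) <= \sum_i al i * w i.

(** [measurable_selection] is applied to the set of all suitable systems of [N.+1] points and
    weights. Its sections are closed because [A x] is compact and the combinations are lower
    semicontinuous. *)
Lemma measurable_convex_domination (w : Omega -> 'I_N -> R) :
  (forall i, measurable_fun setT (w ^~ i)) ->
  (forall x, dominates_lower_hull (w x) x) ->
  exists (y : 'I_N.+1 -> Omega -> X) (l : 'I_N.+1 -> Omega -> R),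
  [/\ forall j, pure_decisions A (y j),
      forall j, measurable_fun setT (l j), forall j x, 0 <= l j x,
      forall x, \sum_j l j x = 1 &
      forall i x, \sum_j l j x * v i (x, y j x) <= w x i].
Proof.
move=> mw dom; pose Z := 'rV[(X * R)%type]_N.+1.
pose pt j (z : Omega * Z) := (z.1, (z.2 ord0 j).1).
pose wt j (z : Omega * Z) := (z.2 ord0 j).2.
have mpt j : measurable_fun setT (pt j : Omega * borel Z -> Omega * borel X).
  apply/measurable_fun_pairP; split; first exact: measurable_fst.
  apply: (@measurableT_comp _ _ _ _ _ (borel X)
    (fun z : borel Z => (z ord0 j).1)) (@measurable_snd _ _ Omega (borel Z)).
  by apply: continuous_borel_measurable; exact: rV_fst_continuous.
have mwt j : measurable_fun setT (wt j : Omega * borel Z -> R).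
  apply: (@measurableT_comp _ _ _ _ _ _
    (fun z : borel Z => (z ord0 j).2)) (@measurable_snd _ _ Omega (borel Z)).
  by apply: continuous_borel_measurableR; exact: rV_snd_continuous.
pose M : set (Omega * Z) := [set z |
  [/\ forall j, A z.1 (pt j z).2 /\ 0 <= wt j z, \sum_j wt j z = 1 &
   forall i, \sum_j wt j z * v i (pt j z) <= w z.1 i]].
have mvpt i j : measurable_fun setT ((fun z => v i (pt j z)) : Omega * borel Z -> R).
  exact: (measurableT_comp (mv i) (mpt j)).
have mM : measurable (M : set (Omega * borel Z)).
  rewrite [X in measurable X](_ : _ = [set z : Omega * borel Z | forall j, A z.1 (pt j z).2] `&`
     [set z : Omega * borel Z | forall j, 0 <= wt j z] `&` [set z | \sum_j wt j z = 1] `&`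
     [set z | forall i, \sum_j wt j z * v i (pt j z) <= w z.1 i]); last first.
    apply/seteqP; split => z; first by move=> [h1 h2 h3]; split => //; split => //; split => j; case: (h1 j).
    by move=> [[[h1 h2] h3] h4]; split.
  apply: measurableI; first apply: measurableI; first apply: measurableI.
  - apply: measurable_set_forall => j; rewrite -[X in measurable X]setTI.
    exact: (mpt j measurableT (corr_graph A)).
  - by apply: measurable_set_forall => j; apply: measurable_set_le => //; exact: mwt.
  - rewrite [X in measurable X](_ : _ = setT `&` (fun z => \sum_j wt j z) @^-1` [set 1]).
      by apply: measurable_sum => // j; exact: mwt.
    by rewrite setTI.
  - apply: measurable_set_forall => i; apply: measurable_set_le.
      by apply: measurable_sum => // j; apply: measurable_funM; [exact: mwt|exact: mvpt].
    apply: (@measurableT_comp _ _ _ _ _ _ (w ^~ i)) => //; exact: (@measurable_fst _ _ Omega (borel Z)).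
have clM x : closed [set z | M (x, z)].
  pose K : set Z := [set z | (forall j, A x (z ord0 j).1) /\ forall j, 0 <= (z ord0 j).2].
  have clK : closed K.
    rewrite [K](_ : _ = \bigcap_j ((fun z : Z => (z ord0 j).1) @^-1` A x) `&`
       \bigcap_j ((fun z : Z => (z ord0 j).2) @^-1` [set t | 0 <= t])).
      apply: closedI; apply: closed_bigI => j _; apply: preimage_closed.
      + by move=> ? _; exact: rV_fst_continuous.
      + apply: compact_closed => //; exact: metric_hausdorff.
      + by move=> ? _; exact: rV_snd_continuous.
      + exact: closed_ge.
    apply/seteqP; split => z [h1 h2]; first by split => j _; [exact: h1|exact: h2].
    by split => j; [exact: h1|exact: h2].
  rewrite [X in closed X](_ : _ = ((fun z : Z => \sum_j (z ord0 j).2) @^-1` [set 1]) `&`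
    \bigcap_i [set z | K z /\ \sum_j (z ord0 j).2 * v i (x, (z ord0 j).1) <= w x i] `&` K).
    apply: closedI => //; apply: closedI.
      apply: preimage_closed; last exact: closed_eq.
      by move=> z _; apply: (cvg_sumr (nbhs_filter z)) => j _; exact: rV_snd_continuous.
    apply: closed_bigI => i _; apply: lsc_on_closed => //.
    apply: lsc_on_sum => j; apply: lsc_onM; first exact: rV_snd_continuous.
    - by move=> z [].
    - by move=> z _; exact: v0.
    - have KA (z : Z) : K z -> A x (z ord0 j).1 by case.
      exact: (@lsc_on_comp R Z X K (A x) _ (fun y => v i (x, y)) (@rV_fst_continuous X R _ j) KA (@lv i x)).
  apply/seteqP; split => z.
    move=> [h1 h2 h3]; have Kz : K z by split => j; case: (h1 j).
    by split => //; split => // i _; split.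
  move=> [[h1 h2] [h3 h4]]; split => // [j|i]; first by split; [exact: h3|exact: h4].
  by case: (h2 i I).
have neM x : exists z, M (x, z).
  have [z [h1 h2 h3 h4]] := convex_domination (@cA x) (fun i y _ => v0 i (x, y)) (fun i => @lv i x) (@dom x).
  by exists z; split; [move=> j; split; [exact: h1|exact: h2]|exact: h3|exact: h4].
have [dz hdz] : exists dz : nat -> Z, dense_seq dz.
  have [dr hdr] := real_dense_seq R.
  have [dp hdp] := prod_dense_seq dense_dn hdr.
  exact: (rV_dense_seq N hdp).
have [f [mf Mf]] := measurable_selection mu_complete hdz mM clM neM.
have mf2 : measurable_fun setT ((fun x => (x, f x)) : Omega -> Omega * borel Z).
  by apply/measurable_fun_pairP; split => //; exact: measurable_id.
exists (fun j x => (f x ord0 j).1), (fun j x => (f x ord0 j).2); split.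
- move=> j; split; last by move=> x; have [/(_ j)[]] := Mf x.
  exact: (measurableT_comp (@measurable_snd _ _ Omega (borel X))
    (measurableT_comp (mpt j) mf2)).
- by move=> j; exact: (measurableT_comp (mwt j) mf2).
- by move=> j x; have [/(_ j)[]] := Mf x.
- by move=> x; case: (Mf x).
- by move=> i x; case: (Mf x) => _ _; exact.
Qed.

End measurable_domination.

(** * Purification when only weighted integrals are finite *)

Section weighted_purification.
Context d e (T : measurableType d) (S : measurableType e) (R : realType).
Variables (mu : {finite_measure set T -> \bar R}) (pi : T -> S).
Hypothesis mpi : measurable_fun setT pi.

Let mpre B : measurable B -> measurable (pi @^-1` B).
Proof. by move=> mB; rewrite -[X in measurable X]setTI; exact: mpi. Qed.

(* [\bigcup_n F n] is a maximal set on which the conditional mean of [g] is finite;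
   off it any [th] with [th (pi x) * g x] integrable must vanish. *)
Lemma conditional_sigma_finite_part (g : T -> R) :
  measurable_fun setT g -> (forall x, 0 <= g x) ->
  exists F : nat -> set S, [/\ forall n, measurable (F n), trivIset setT F,
    forall n, (\int[mu]_(x in pi @^-1` F n) (g x)%:E < +oo)%E &
    forall th : S -> R, measurable_fun setT th -> (forall y, 0 <= th y) ->
      (\int[mu]_x (th (pi x) * g x)%:E < +oo)%E ->
      {ae mu, forall x, ~ (\bigcup_n F n) (pi x) -> th (pi x) = 0}].
Proof.
move=> mg g0; pose nu B := (\int[mu]_(x in pi @^-1` B) (g x)%:E)%E.
have mgE D : measurable_fun D (EFin \o g) by apply/measurable_funTS/measurable_EFinP.
(* Countable unions are allowed so that the class is stable under the unions formed by [exhaustion];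
   such a union may have infinite [nu]. *)
pose C := [set B | exists F : nat -> set S,
  [/\ forall n, measurable (F n), forall n, (nu (F n) < +oo)%E & B = \bigcup_n F n]].
have mC B : C B -> measurable B by move=> [F [mF _ ->]]; exact: bigcupT_measurable.
pose s B := fine (mu (pi @^-1` B)).
have fins B : measurable B -> mu (pi @^-1` B) = (s B)%:E.
  by move=> mB; rewrite fineK//; apply: fin_num_measure; exact: mpre.
have CU (F : nat -> set S) : (forall n, C (F n)) -> C (\bigcup_n F n).
  move=> /choice[G hG].
  exists (fun k => let ij := odflt (0, 0)%N (unpickle k) in G ij.1 ij.2); split.
  - by move=> k; case: (hG (odflt (0, 0)%N (unpickle k)).1).
  - by move=> k; case: (hG (odflt (0, 0)%N (unpickle k)).1).
  apply/seteqP; split => y [n _].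
    have [_ _ ->] := hG n; move=> [k _ Gy]; exists (pickle (n, k)) => //.
    by rewrite pickleK.
  move=> Gy; exists (odflt (0, 0)%N (unpickle n)).1 => //.
  have [_ _ ->] := hG (odflt (0, 0)%N (unpickle n)).1.
  by exists (odflt (0, 0)%N (unpickle n)).2.
have C1 B : measurable B -> (nu B < +oo)%E -> C B.
  by move=> mB fB; exists (fun=> B); split => //; rewrite bigcup_const//; exists 0%N.
have C0 : C set0 by apply: C1 => //; rewrite /nu preimage_set0 integral_set0.
have [] := @exhaustion R S C s (s setT).
- by exists set0.
- move=> D /mC mD; rewrite -lee_fin -!fins//; apply: le_measure; rewrite ?inE//; exact: mpre.
- move=> D E /mC mD /mC mE DE; rewrite -lee_fin -!fins//; apply: le_measure; rewrite ?inE//.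
  + exact: mpre.
  + exact: mpre.
  + by move=> x; exact: DE.
- by move=> F CF _; exact: CU.
move=> D CD Dmax; have mD := mC D CD.
(* Adjoining [E] to [D] stays in the class, so by maximality it adds no mass. *)
have negl E : measurable E -> (nu E < +oo)%E -> mu (pi @^-1` (E `\` D)) = 0%E.
  move=> mE fE.
  have CDE : C (D `|` E).
    by rewrite -bigcup2E; apply: CU => -[|[|n]] //=; exact: C1.
  have := Dmax _ CDE (@subsetUl _ _ _).
  rewrite -lee_fin -!fins//; last exact: measurableU.
  have -> : D `|` E = D `|` (E `\` D).
    apply/seteqP; split => y [?|]; [by left| |by left|by case; right].
    by have [?|?] := pselect (D y); [left|right].
  rewrite preimage_setU measureU; [|exact: mpre|by apply: mpre; exact: measurableD|]; last first.
    by apply/seteqP; split => // x [Dx [_ /(_ Dx)]].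
  move=> h; apply/eqP; rewrite eq_le measure_ge0 andbT.
  have fD : mu (pi @^-1` D) \is a fin_num by rewrite fins.
  by move: h; rewrite -[X in (_ <= X)%E -> _]adde0 leeD2lE.
have [F [mF fF DE]] := CD.
exists (seqDU F); split.
- exact: seqDU_measurable.
- exact: trivIset_seqDU.
- move=> n; apply: le_lt_trans (fF n); apply: ge0_subset_integral => //.
  + by apply: mpre; exact: seqDU_measurable.
  + exact: mpre.
  + by move=> x _; rewrite lee_fin.
  + by move=> x; exact: subset_seqDU.
move=> th mth th0 fth.
rewrite -seqDU_bigcup_eq -DE.
(* By Markov's inequality these sets have finite [nu], so each is almost contained in [D]; together
   they cover the points where [th] is positive. *)
pose E k := [set y | k.+1%:R^-1 <= th y].
have mE k : measurable (E k) by apply: measurable_set_le.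
have fE k : (nu (E k) < +oo)%E.
  apply: le_lt_trans (_ : k.+1%:R%:E * \int[mu]_x (th (pi x) * g x)%:E < +oo)%E; last first.
    by rewrite lte_mul_pinfty.
  have mtg : measurable_fun setT (fun x => (th (pi x) * g x)%:E).
    apply/measurable_EFinP; apply: measurable_funM => //; exact: (measurableT_comp mth).
  rewrite -ge0_integralZl//; last by move=> x _; rewrite lee_fin mulr_ge0.
  apply: (@le_trans _ _ (\int[mu]_(x in pi @^-1` E k) (k.+1%:R%:E * (th (pi x) * g x)%:E))%E).
    apply: ge0_le_integral => //.
    - exact: mpre.
    - by move=> x _; rewrite lee_fin.
    - by apply: (measurable_funS measurableT) => //; exact: measurable_funeM.
    - move=> x Ex; rewrite lee_fin mulrA ler_peMl//.
      by rewrite mulrC -ler_pdivrMr// div1r.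
  apply: ge0_subset_integral => //; first exact: mpre.
  - exact: measurable_funeM.
  - by move=> x _; rewrite -EFinM lee_fin mulr_ge0// mulr_ge0.
suff : mu.-negligible (~` [set x | ~ D (pi x) -> th (pi x) = 0]) by [].
apply: (@negligibleS _ _ _ mu (\bigcup_k (pi @^-1` (E k `\` D)))).
  move=> x /= /not_implyP[Dx tx].
  have tx0 : 0 < th (pi x) by rewrite lt_def th0 andbT; apply/eqP.
  have [k _ hk] := near_infty_natSinv_lt (PosNum tx0).
  by exists k => //=; split => //; apply: ltW; have := hk k (leqnn k).
apply: negligible_bigcup => k.
by apply/negligibleP; [apply: mpre; exact: measurableD|exact: negl].
Qed.

Hypothesis noatom : forall D, measurable D -> (0 < mu D)%E ->
  exists2 D1, measurable D1 & forall B, measurable B ->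
    mu ((D `&` D1) `+` (D `&` pi @^-1` B)) != 0%E.

Lemma weighted_purification (J N : nat) (lam : 'I_J.+1 -> T -> R)
    (g : 'I_N -> 'I_J.+1 -> T -> R) (w : 'I_N -> T -> R) :
  (forall j, measurable_fun setT (lam j)) -> (forall j x, 0 <= lam j x) ->
  (forall x, \sum_j lam j x = 1) ->
  (forall i j, measurable_fun setT (g i j)) -> (forall i j x, 0 <= g i j x) ->
  (forall i, measurable_fun setT (w i)) ->
  (forall i x, \sum_j lam j x * g i j x <= w i x) ->
  exists tau : T -> 'I_J.+1, (forall j, measurable (tau @^-1` [set j])) /\
  forall th : S -> R, measurable_fun setT th -> (forall y, 0 <= th y) ->
    (forall i, \int[mu]_x (th (pi x) * w i x)%:E < +oo)%E ->
    forall i, (\int[mu]_x (th (pi x) * g i (tau x) x)%:E <=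
               \int[mu]_x (th (pi x) * w i x)%:E)%E.
Proof.
move=> mlam lam0 lam1 mg g0 mw lamw.
have w0 i x : 0 <= w i x.
  by apply: le_trans (lamw i x); apply: sumr_ge0 => j _; rewrite mulr_ge0.
pose W x := \sum_i w i x.
have mW : measurable_fun setT W by exact: measurable_sum.
have W0 x : 0 <= W x by exact: sumr_ge0.
have [F [mF tF fF negF]] := conditional_sigma_finite_part mW W0.
pose h n i j x := \1_(pi @^-1` F n) x * g i j x.
have m1 n : measurable_fun setT (\1_(pi @^-1` F n) : T -> R).
  by apply: measurable_indic; exact: mpre.
have ind0 (D : set T) x : 0 <= \1_D x :> R by rewrite indicE.
have ih n i j : mu.-integrable setT (EFin \o (fun x => lam j x * h n i j x)).
  have mh : measurable_fun setT (fun x => lam j x * h n i j x).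
    by apply: measurable_funM => //; exact: measurable_funM.
  apply/integrableP; split; first exact/measurable_EFinP.
  apply: le_lt_trans (fF n); rewrite [leRHS]integral_mkcond.
  apply: ge0_le_integral => //.
  - by apply: measurableT_comp => //; exact/measurable_EFinP.
  - apply/(measurable_restrictT _ (mpre (mF n))).1/measurable_funTS/measurable_EFinP => //.
  - move=> x _; rewrite patchE /h /= indicE.
    case: ifPn => _; last by rewrite mul0r mulr0 normr0.
    rewrite mul1r lee_fin ger0_norm ?mulr_ge0//.
    apply: le_trans (_ : w i x <= _).
      by apply: le_trans (lamw i x); rewrite (bigD1 j)//= lerDl sumr_ge0// => k _; rewrite mulr_ge0.
    by rewrite /W (bigD1 i)//= lerDl sumr_ge0.
have /choice[tau0 htau0] := fun n => purification mpi noatom mlam lam0 lam1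
  (fun i j => measurable_funM (m1 n) (mg i j)) (fun i j x => mulr_ge0 (ind0 _ x) (g0 i j x)) (ih n).
pose U := \bigcup_n F n.
have mU : measurable U by exact: bigcupT_measurable.
have /choice[idx hidx] : forall x, exists n, U (pi x) -> F n (pi x).
  by move=> x; have [[n _ Fn]|nU] := pselect (U (pi x)); [exists n|exists 0%N].
(* Outside [U] the value is immaterial, so a constant keeps [tau] measurable. *)
pose tau x := if pselect (U (pi x)) then tau0 (idx x) x else ord0.
have tauE n x : F n (pi x) -> tau x = tau0 n x.
  move=> Fx; rewrite /tau; case: pselect => [Ux|[]]; last by exists n.
  by congr tau0; apply: (tF _ _ I I); exists (pi x); split => //; exact: hidx.
exists tau.
have mtau j : measurable (tau @^-1` [set j]).
  rewrite [X in measurable X](_ : _ = \bigcup_n (pi @^-1` F n `&` tau0 n @^-1` [set j]) `|`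
    (pi @^-1` (~` U) `&` (if j == ord0 then setT else set0))).
    apply: measurableU.
      by apply: bigcupT_measurable => n; apply: measurableI; [exact: mpre|exact: (htau0 n).1].
    by apply: measurableI; [apply: mpre; exact: measurableC|case: ifP].
  apply/seteqP; split => x.
    move=> /= tx; have [Ux|nU] := pselect (U (pi x)).
      by have [n _ Fx] := Ux; left; exists n => //; split => //=; rewrite -(tauE n).
    have t0 : tau x = ord0 by rewrite /tau; case: pselect.
    by right; split => //; rewrite -tx t0 eqxx.
  move=> [[n _ [Fx <-]]|[nU]]; first exact: tauE.
  by have [->|] := eqVneq j ord0; rewrite /= /tau; case: pselect.
split => // th mth th0 fth i.
have mgt := measurable_fun_select mtau (mg i).
pose k1 x := \1_(pi @^-1` U) x * g i (tau x) x.
pose k2 x := \1_(pi @^-1` U) x * w i x.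
have m1U : measurable_fun setT (\1_(pi @^-1` U) : T -> R).
  by apply: measurable_indic; exact: mpre.
have mth' : measurable_fun setT (th \o pi) by exact: measurableT_comp.
have split_int (k : T -> R) B : measurable B -> measurable_fun setT k -> (forall x, 0 <= k x) ->
    (\int[mu]_(x in pi @^-1` B) (\1_(pi @^-1` U) x * k x)%:E =
     \sum_(n <oo) \int[mu]_(x in pi @^-1` (B `&` F n)) (k x)%:E)%E.
  move=> mB mk k0.
  have -> : (\int[mu]_(x in pi @^-1` B) (\1_(pi @^-1` U) x * k x)%:E =
      \int[mu]_(x in pi @^-1` B `&` pi @^-1` U) (k x)%:E)%E.
    rewrite integral_mkcondr; apply: eq_integral => x _; rewrite patchE indicE.
    by case: ifP; rewrite ?mul1r ?mul0r.
  have -> : pi @^-1` B `&` pi @^-1` U = \bigcup_n (pi @^-1` (B `&` F n)).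
    by rewrite -preimage_setI setI_bigcupr preimage_bigcup.
  apply: ge0_integral_bigcup => //.
  - by move=> n; apply: mpre; exact: measurableI.
  - exact/measurable_funTS/measurable_EFinP.
  - by move=> x _; rewrite lee_fin.
  - move=> n n' _ _ [x [[_ Fn] [_ Fn']]]; apply: (tF _ _ I I); by exists (pi x).
have k12 B : measurable B ->
    (\int[mu]_(x in pi @^-1` B) (k1 x)%:E <= \int[mu]_(x in pi @^-1` B) (k2 x)%:E)%E.
  move=> mB; rewrite !split_int//; apply: lee_nneseries => [n _ _|n _].
    by apply: integral_ge0 => x _; rewrite lee_fin.
  have mBn : measurable (B `&` F n) by exact: measurableI.
  apply: (@le_trans _ _ (\int[mu]_(x in pi @^-1` (B `&` F n))
      (\1_(pi @^-1` F n) x * g i (tau0 n x) x)%:E)%E).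
    rewrite le_eqVlt; apply/orP; left; apply/eqP; apply: eq_integral => x.
    by rewrite inE => -[_ Fx]; rewrite (tauE n)// indicE mem_set// mul1r.
  apply: le_trans ((htau0 n).2 i _ mBn) _.
  apply: ge0_le_integral => //.
  - exact: mpre.
  - move=> x _; rewrite lee_fin sumr_ge0// => j _; rewrite !mulr_ge0//.
  - apply/measurable_funTS/measurable_EFinP; apply: measurable_sum => j.
    by apply: measurable_funM => //; exact: measurable_funM.
  - by apply/measurable_funTS/measurable_EFinP; exact: mw.
  - move=> x [_ Fx]; rewrite lee_fin; apply: le_trans (lamw i x).
    by apply: ler_sum => j _; rewrite /= indicE mem_set// mul1r.
apply: (@le_trans _ _ (\int[mu]_x (th (pi x) * k1 x)%:E)%E).
  rewrite le_eqVlt; apply/orP; left; apply/eqP; apply: ge0_ae_eq_integral => //.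
  - by apply/measurable_EFinP; exact: measurable_funM.
  - by apply/measurable_EFinP; apply: measurable_funM => //; exact: measurable_funM.
  - by move=> x _; rewrite lee_fin mulr_ge0.
  - by move=> x _; rewrite lee_fin !mulr_ge0.
  - have : (\int[mu]_x (th (pi x) * W x)%:E < +oo)%E.
      under eq_integral do rewrite mulr_sumr -sumEFin.
      rewrite ge0_integral_sum//; first exact: lte_sum_pinfty.
      + by move=> j; apply/measurable_EFinP; exact: measurable_funM.
      + by move=> j x _; rewrite lee_fin mulr_ge0.
    move=> /(negF th mth th0); apply: filterS => x hx _; rewrite /k1 indicE.
    have [Ux|nU] := pselect (U (pi x)); first by rewrite mem_set// mul1r.
    by rewrite hx// !mul0r.
apply: le_trans (pullout_le mpi _ _ _ _ k12 mth th0) _.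
- exact: measurable_funM.
- by move=> x; rewrite mulr_ge0.
- exact: measurable_funM.
- by move=> x; rewrite mulr_ge0.
apply: ge0_le_integral => //.
- by move=> x _; rewrite lee_fin !mulr_ge0.
- by apply/measurable_EFinP; apply: measurable_funM => //; exact: measurable_funM.
- by apply/measurable_EFinP; apply: measurable_funM => //; exact: mw.
- move=> x _; rewrite lee_fin ler_wpM2l// ler_piMl// indicE; by case: (_ \in _).
Qed.

End weighted_purification.

(** * From dominating functions to pure decisions *)

Section pure_domination.
Context d e (Omega : measurableType d) (S : measurableType e) (R : realType).
Context (X : completeMetricType R).
Variables (mu : {finite_measure set Omega -> \bar R}) (dn : nat -> X).
Hypotheses (mu_complete : measure_is_complete mu) (dense_dn : dense_seq dn).
Variable pi : Omega -> S.
Hypothesis mpi : measurable_fun setT pi.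
Hypothesis noatom : forall D, measurable D -> (0 < mu D)%E ->
  exists2 D1, measurable D1 & forall B, measurable B ->
    mu ((D `&` D1) `+` (D `&` pi @^-1` B)) != 0%E.
Variables (A : Omega -> set X) (N : nat) (v : 'I_N -> Omega * X -> R).
Hypotheses (mA : measurable (corr_graph A : set (Omega * borel X)))
  (A0 : forall w, A w !=set0) (cA : forall w, compact (A w))
  (mv : forall i, measurable_fun setT (v i : Omega * borel X -> R))
  (v0 : forall i z, 0 <= v i z)
  (lv : forall i w, lsc_on (A w) (fun x => v i (w, x))).
Variables (Par : Type) (r : Par -> S -> R).
Hypotheses (mr : forall p, measurable_fun setT (r p)) (r0 : forall p y, 0 <= r p y).

Lemma pure_decision_exists : exists f : Omega -> X, pure_decisions A f.
Proof.
have clA w : closed (A w).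
  by apply: compact_closed => //; exact: metric_hausdorff.
have [f [mf Af]] := measurable_selection mu_complete dense_dn mA clA A0.
by exists f; split.
Qed.

Lemma measurable_decision_pair (f : Omega -> X) : pure_decisions A f ->
  measurable_fun setT ((fun x => (x, f x)) : Omega -> Omega * borel X).
Proof.
by move=> [mf _]; apply/measurable_fun_pairP; split => //; exact: measurable_id.
Qed.

Lemma dominates_self (w : 'I_N -> R) x y : A x y -> (forall i, v i (x, y) <= w i) ->
  dominates_lower_hull A v w x.
Proof.
move=> Ay vw al al0; exists y => //; apply: ler_sum => i _; exact: ler_wpM2l.
Qed.

Let mrpi p : measurable_fun setT (r p \o pi). Proof. exact: measurableT_comp. Qed.

Lemma pure_domination_real (w : Omega -> 'I_N -> R) :
  (forall i, measurable_fun setT (w ^~ i)) ->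
  (forall x, dominates_lower_hull A v (w x) x) ->
  (forall p i, \int[mu]_x (w x i * r p (pi x))%:E < +oo)%E ->
  exists2 f, pure_decisions A f &
    forall p i, (\int[mu]_x (v i (x, f x) * r p (pi x))%:E <=
      \int[mu]_x (w x i * r p (pi x))%:E)%E.
Proof.
move=> mw dom fw.
have [y [l [yA ml l0 l1 lw]]] := measurable_convex_domination mu_complete dense_dn
  mA cA mv v0 lv mw dom.
have [tau [mtau htau]] := weighted_purification mpi noatom ml l0 l1
  (fun i j => measurableT_comp (mv i) (measurable_decision_pair (yA j)))
  (fun i j x => v0 i _) mw lw.
exists (fun x => y (tau x) x).
  split=> [|x]; last exact: (yA (tau x)).2.
  move=> _ B mB; rewrite setTI [X in measurable X](_ : _ =
      \bigcup_(j in [set: 'I_N.+1]) (tau @^-1` [set j] `&` y j @^-1` B)).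
    apply: fin_bigcup_measurable => // j _; apply: measurableI => //.
    by rewrite -[X in measurable X]setTI; apply: (yA j).1.
  by apply/seteqP; split => x /=; [exists (tau x)|move=> [j _ [<-]]].
move=> p i; have := htau (r p) (mr p) (r0 p) _ i.
under eq_integral do rewrite mulrC.
under [leRHS]eq_integral do rewrite mulrC.
apply => k; rewrite (le_lt_trans _ (fw p k))//.
by under eq_integral do rewrite mulrC.
Qed.

(** Where [W] is infinite, finiteness of the integral forces each [r p] to vanish almost everywhere,
    so [W] may be replaced there by real values without changing any of the integrals. *)
Lemma pure_domination (W : Omega -> 'I_N -> \bar R) :
  (forall i, measurable_fun setT (W ^~ i)) -> (forall x i, 0 <= W x i)%E ->
  {ae mu, forall x, (forall i, W x i \is a fin_num) ->
    dominates_lower_hull A v (fun i => fine (W x i)) x} ->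
  (forall p i, \int[mu]_x (W x i * (r p (pi x))%:E) < +oo)%E ->
  exists2 f, pure_decisions A f &
    forall p i, (\int[mu]_x (v i (x, f x) * r p (pi x))%:E <=
      \int[mu]_x (W x i * (r p (pi x))%:E))%E.
Proof.
move=> mW W0 [N0 [mN0 muN0 hN0]] fW.
have [f0 Af0] := pure_decision_exists.
pose good := ~` N0 `&` [set x | forall i, W x i \is a fin_num].
have mgood : measurable good.
  apply: measurableI; first exact: measurableC.
  apply: measurable_set_forall => i.
  rewrite -[X in measurable X]setTI; exact: emeasurable_fin_num.
(* The values of [v] at a fixed pure decision dominate the hull at every point, exceptional ones
   included. *)
pose w x i := if x \in good then fine (W x i) else v i (x, f0 x).
have mw i : measurable_fun setT (w ^~ i).
  apply: measurable_fun_ifT => //.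
  - apply: (measurable_fun_bool true); rewrite setTI [X in measurable X](_ : _ = good)//.
    by apply/seteqP; split => x /=; [move=> /set_mem|move=> /mem_set].
  - exact: measurableT_comp.
  - exact: (measurableT_comp (mv i) (measurable_decision_pair Af0)).
have dom x : dominates_lower_hull A v (w x) x.
  have [xg|xg] := boolP (x \in good); last first.
    by apply: (dominates_self (Af0.2 x)) => i; rewrite /w (negPf xg).
  have -> : w x = fun i => fine (W x i) by apply/funext => i; rewrite /w xg.
  move: xg; rewrite inE => -[nN0 finW]; apply: contrapT => h; apply: nN0; apply: hN0 => /=.
  by apply/not_implyP; split.
have mwr p i : measurable_fun setT (fun x => (w x i * r p (pi x))%:E).
  by apply/measurable_EFinP; apply: measurable_funM => //; exact: mrpi.
have mWr p i : measurable_fun setT (fun x => (W x i * (r p (pi x))%:E)%E).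
  by apply: emeasurable_funM => //; apply/measurable_EFinP; exact: mrpi.
have w0 x i : 0 <= w x i.
  by rewrite /w; case: ifP => _ //; exact: fine_ge0.
have wW p i : (\int[mu]_x (w x i * r p (pi x))%:E = \int[mu]_x (W x i * (r p (pi x))%:E))%E.
  apply: ge0_ae_eq_integral => //.
  - by move=> x _; rewrite lee_fin mulr_ge0.
  - by move=> x _; rewrite mule_ge0// lee_fin.
  have hfin : \forall x \ae mu, forall j, (W x j * (r p (pi x))%:E \is a fin_num)%E.
    apply: (@filter_forall _ _ (fun j x => (W x j * (r p (pi x))%:E)%E \is a fin_num)) => j.
    have /integrable_ae : mu.-integrable setT (fun x => W x j * (r p (pi x))%:E)%E.
      apply/integrableP; split => //.
      under eq_integral do rewrite gee0_abs ?mule_ge0 ?lee_fin//.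
      exact: fW.
    by move=> /(_ measurableT); apply: filterS => x; apply.
  have hN : \forall x \ae mu, ~ N0 x by exists N0; split => // x /contrapT.
  apply: filterS2 hN hfin => x nN0 hx _.
  have [rx|rx] := eqVneq (r p (pi x)) 0; first by rewrite rx mulr0 mule0.
  have fx j : W x j \is a fin_num.
    have := hx j; move: (W0 x j); case: (W x j) => //=.
    by move=> _; rewrite gt0_mulye// lte_fin lt_def rx r0.
  by rewrite /w mem_set//= EFinM fineK.
have [|f Af hf] := pure_domination_real mw dom.
  by move=> p i; rewrite wW.
by exists f => // p i; rewrite -wW; exact: hf.
Qed.

End pure_domination.

(* The limit may be [+oo]. *)
Lemma cvg_of_expR (R : realType) (w : nat -> R) :
  cvgn (fun k => expR (- (w k) / 2)) -> cvgn (fun k => (w k)%:E).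
Proof.
move=> /cvg_ex[z wz].
have z0 : 0 <= z.
  rewrite -(cvg_lim (@Rhausdorff R) wz); apply: limr_ge; first by apply/cvg_ex; exists z.
  by apply: nearW => k; exact: expR_ge0.
move: z0; rewrite le_eqVlt => /predU1P[z0|z0]; apply/cvg_ex.
  exists +oo%E; apply/cvgeyPge => M; rewrite -z0 in wz.
  have h : \forall k \near \oo, expR (- w k / 2) < expR (- M / 2).
    exact: (cvgr_lt _ wz _ (expR_gt0 (- M / 2))).
  by apply: filterS h => k; rewrite ltr_expR lee_fin; lra.
exists (-2 * ln z)%:E; apply: cvg_EFin; first exact: nearW.
have h : ln (expR (- (w k) / 2)) @[k --> \oo] --> ln z.
  by apply: (cvg_comp _ _ wz); exact: continuous_ln.
have -> : w = fun k => -2 * ln (expR (- (w k) / 2)).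
  by apply/funext => k; rewrite expRK; lra.
by apply: cvgMr.
Qed.

(** * Limits of bounds attained by pure decisions *)

Section pure_closure.
Context d e (Omega : measurableType d) (S : measurableType e) (R : realType).
Context (X : completeMetricType R).
Variables (mu : {finite_measure set Omega -> \bar R}) (dn : nat -> X).
Hypotheses (mu_complete : measure_is_complete mu) (dense_dn : dense_seq dn).
Variable pi : Omega -> S.
Hypothesis mpi : measurable_fun setT pi.
Hypothesis noatom : forall D, measurable D -> (0 < mu D)%E ->
  exists2 D1, measurable D1 & forall B, measurable B ->
    mu ((D `&` D1) `+` (D `&` pi @^-1` B)) != 0%E.
Variables (A : Omega -> set X) (N : nat) (v : 'I_N -> Omega * X -> R).
Hypotheses (mA : measurable (corr_graph A : set (Omega * borel X)))
  (A0 : forall w, A w !=set0) (cA : forall w, compact (A w))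
  (mv : forall i, measurable_fun setT (v i : Omega * borel X -> R))
  (v0 : forall i z, 0 <= v i z)
  (lv : forall i w, lsc_on (A w) (fun x => v i (w, x))).
Variables (Par : Type) (r : Par -> S -> R).
Hypotheses (mr : forall p, measurable_fun setT (r p)) (r0 : forall p y, 0 <= r p y).

(** In a given direction the better of the two points is below the average. *)
Lemma dominates_lower_hull_mid (w w' : 'I_N -> R) x :
  dominates_lower_hull A v w x -> dominates_lower_hull A v w' x ->
  dominates_lower_hull A v (fun i => (w i + w' i) / 2) x.
Proof.
move=> dw dw' al al0; have [y Ay hy] := dw al al0; have [y' Ay' hy'] := dw' al al0.
have -> : \sum_i al i * ((w i + w' i) / 2) =
    ((\sum_i al i * w i) + (\sum_i al i * w' i)) / 2.
  by rewrite -big_split mulr_suml; apply: eq_bigr => i _ /=; lra.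
have [yy|yy] := leP (\sum_i al i * v i (x, y)) (\sum_i al i * v i (x, y')).
  by exists y => //; lra.
by exists y' => //; lra.
Qed.

Lemma lower_hull_min (al : 'I_N -> R) x : (forall i, 0 <= al i) ->
  exists2 y, A x y & forall z, A x z ->
    \sum_i al i * v i (x, y) <= \sum_i al i * v i (x, z).
Proof.
move=> al0; apply: lsc_min => //.
by apply: lsc_on_sum => i; apply: lsc_onZ => //; exact: (@lv i x).
Qed.

(** In a given direction the minimiser over [A x] serves all indices [k], so no convergent
    subsequence of points has to be extracted. *)
Lemma dominates_lower_hull_lim (w : nat -> 'I_N -> R) (l : 'I_N -> R) x :
  (forall k, dominates_lower_hull A v (w k) x) ->
  (forall i, w k i @[k --> \oo] --> l i) -> dominates_lower_hull A v l x.
Proof.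
move=> dw wl al al0; have [y Ay ymin] := lower_hull_min x al0.
have sl : \sum_i al i * w k i @[k --> \oo] --> \sum_i al i * l i.
  by apply: cvg_sumr => i _; apply: cvgMr; exact: wl.
exists y => //; rewrite -(cvg_lim (@Rhausdorff R) sl).
apply: limr_ge; first by apply/cvg_ex; exists (\sum_i al i * l i).
apply: nearW => k; have [z Az] := dw k al al0; exact/le_trans/ymin.
Qed.

Lemma pure_closure (K : nat -> Par -> 'I_N -> R) (L : Par -> 'I_N -> R) :
  (forall k, exists2 g, pure_decisions A g &
    forall p i, (\int[mu]_x (v i (x, g x) * r p (pi x))%:E <= (K k p i)%:E)%E) ->
  (forall k p i, K k.+1 p i <= K k p i) ->
  (forall p i, K k p i @[k --> \oo] --> L p i) ->
  exists2 f, pure_decisions A f &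
    forall p i, (\int[mu]_x (v i (x, f x) * r p (pi x))%:E <= (L p i)%:E)%E.
Proof.
move=> Kg Knd KL.
have mrpi p : measurable_fun setT (r p \o pi) by exact: measurableT_comp.
(* The cost vectors of pure decisions are not stable under midpoints; enlarging them to all
   measurable functions above the hull makes the set so. *)
pose C k := [set w : Omega -> 'I_N -> R |
  [/\ forall i, measurable_fun setT (w ^~ i), forall x i, 0 <= w x i,
      forall x, dominates_lower_hull A v (w x) x &
      forall p i, (\int[mu]_x (w x i * r p (pi x))%:E <= (K k p i)%:E)%E]].
have [|||||w [Cw wcvg]] := @nested_convex_cvg _ _ R mu N C.
- by move=> k w [].
- by move=> k w [].
- move=> k w [? ? ? h]; split => // p i; apply: (le_trans (h p i)).
  by rewrite lee_fin.
- move=> k; have [g Ag hg] := Kg k; exists (fun x i => v i (x, g x)); split => //.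
  + by move=> i; exact: (measurableT_comp (mv i) (measurable_decision_pair Ag)).
  + by move=> x; apply: (dominates_self (Ag.2 x)).
- move=> k w w' [mw w0 dw hw] [mw' w'0 dw' hw']; split.
  + by move=> i; apply: measurable_funM => //; exact: measurable_funD.
  + by move=> x i; rewrite divr_ge0// addr_ge0.
  + by move=> x; exact: dominates_lower_hull_mid.
  + move=> p i.
    have mh (w1 : Omega -> 'I_N -> R) : (forall i, measurable_fun setT (w1 ^~ i)) ->
        measurable_fun setT (fun x => (w1 x i * r p (pi x))%:E).
      by move=> mw1; apply/measurable_EFinP; apply: measurable_funM => //; exact: mrpi.
    have -> : (\int[mu]_x ((w x i + w' x i) / 2 * r p (pi x))%:E =
        2^-1%:E * \int[mu]_x (w x i * r p (pi x))%:E +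
        2^-1%:E * \int[mu]_x (w' x i * r p (pi x))%:E)%E.
      rewrite -!ge0_integralZl//; try by [exact: mh|move=> x _; rewrite lee_fin mulr_ge0].
      rewrite -ge0_integralD//; try by [apply: measurable_funeM; exact: mh|
        move=> x _; rewrite -EFinM lee_fin mulr_ge0// mulr_ge0].
      by apply: eq_integral => x _; rewrite -!EFinM -EFinD; congr EFin; ring.
    have -> : (K k p i)%:E = (2^-1%:E * (K k p i)%:E + 2^-1%:E * (K k p i)%:E)%E.
      by rewrite -!EFinM -EFinD; congr EFin; field.
    by apply: leeD; apply: lee_wpmul2l => //; rewrite lee_fin.
have [W [mW W0 WE]] : exists W : Omega -> 'I_N -> \bar R,
   [/\ forall i, measurable_fun setT (W ^~ i), forall x i, (0 <= W x i)%E &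
    {ae mu, forall x i, (w k x i)%:E @[k --> \oo] --> W x i}].
  exists (fun x i => limn_einf (fun k => (w k x i)%:E)); split.
  - move=> i; apply: (@measurable_fun_limn_einf _ _ _ _ (fun k x => (w k x i)%:E)) => k.
    by apply/measurable_EFinP; case: (Cw k).
  - by move=> x i; apply: limn_einf_ge0 => k; rewrite lee_fin; case: (Cw k).
  - apply: filterS wcvg => x hx i.
    have /cvg_ex[l hl] := cvg_of_expR (hx i).
    by rewrite (cvg_limn_einf_sup hl).1.
have WK p i : (\int[mu]_x (W x i * (r p (pi x))%:E) <= (L p i)%:E)%E.
  apply: (@fatou_le _ _ _ mu _ (fun k x => w k x i * r p (pi x)) _
    (fun k => (K k p i)%:E)) => //.
  - by move=> k; apply: measurable_funM; [case: (Cw k)|exact: mrpi].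
  - by move=> k x; rewrite mulr_ge0//; case: (Cw k).
  - by apply: emeasurable_funM => //; apply/measurable_EFinP; exact: mrpi.
  - by move=> x; rewrite mule_ge0// lee_fin.
  - apply: filterS WE => x hx _; have h := cvgeZr (isT : (r p (pi x))%:E \is a fin_num) (hx i).
    by rewrite (cvg_limn_einf_sup h).1.
  - by move=> k; case: (Cw k).
  - by apply: cvg_EFin; [exact: nearW|exact: KL].
have [|p i|f Af hf] := pure_domination mu_complete dense_dn mpi noatom mA A0 cA mv v0 lv mr r0 mW W0.
- apply: filterS WE => x hx finW; apply: (@dominates_lower_hull_lim (w ^~ x)) => [k|i].
    by case: (Cw k).
  by have := hx i; rewrite -[W x i]fineK//; exact: fine_cvg.
- exact: le_lt_trans (WK p i) (ltry _).
by exists f => // p i; exact: le_trans (hf p i) (WK p i).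
Qed.

End pure_closure.

(** * The optimal pure decision *)

Section pure_of_randomized.
Context d e (Omega : measurableType d) (S : measurableType e) (R : realType).
Context (X : completeMetricType R).
Variables (mu : {finite_measure set Omega -> \bar R}) (dn : nat -> X).
Hypotheses (mu_complete : measure_is_complete mu) (dense_dn : dense_seq dn).
Variable A : Omega -> set X.
Hypotheses (mA : measurable (corr_graph A : set (Omega * borel X)))
  (A0 : forall w, A w !=set0) (cA : forall w, compact (A w)).

(** The minimal value is measurable because its strict sublevel sets are projections; the set of
    minimisers then has measurable graph and closed sections, and a selection exists. *)
Lemma argmin_selection (g : Omega * X -> R) :
  measurable_fun setT (g : Omega * borel X -> R) ->
  (forall w, lsc_on (A w) (fun x => g (w, x))) ->
  exists2 f, pure_decisions A f & forall w x, A w x -> g (w, f w) <= g (w, x).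
Proof.
move=> mg lg.
have clA w : closed (A w) by apply: compact_closed => //; exact: metric_hausdorff.
have /choice[y hy] : forall w, exists y, A w y /\ forall x, A w x -> g (w, y) <= g (w, x).
  by move=> w; have [y Ay hy] := lsc_min (@cA w) (A0 w) (@lg w); exists y.
pose c w := g (w, y w).
have mc : measurable_fun setT c.
  apply: (measurability _ (RGenInftyO.measurableE R)) => // _ [_ [t ->] <-].
  rewrite setTI [X in measurable X](_ : _ = [set w | exists z,
      (corr_graph A `&` g @^-1` `]-oo, t[) (w, z)]).
    apply: (measurable_projection mu_complete dense_dn); apply: measurableI => //.
    by rewrite -[X in measurable X]setTI; exact: mg.
  apply/seteqP; split => w /=; rewrite in_itv/=.
    by move=> ct; exists (y w); split; [exact: (hy w).1|rewrite /= in_itv].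
  by move=> [z [Az]]; rewrite /= in_itv/=; exact/le_lt_trans/(hy w).2.
pose M := corr_graph A `&` [set z | g z <= c z.1].
have mM : measurable (M : set (Omega * borel X)).
  apply: measurableI => //; apply: measurable_set_le => //.
  by apply: measurableT_comp => //; exact: (@measurable_fst _ _ Omega (borel X)).
have clM w : closed [set x | M (w, x)].
  exact: (lsc_on_closed (t := c w) (clA w) (@lg w)).
have neM w : exists x, M (w, x) by exists (y w); split; [exact: (hy w).1|exact: lexx].
have [f [mf Mf]] := measurable_selection mu_complete dense_dn mM clM neM.
exists f; first by split => // w; case: (Mf w).
move=> w x Ax; case: (Mf w) => _ /= h; exact: le_trans h ((hy w).2 _ Ax).
Qed.

Variables (N : nat) (v : 'I_N -> Omega * X -> R).
Hypotheses
  (mv : forall i, measurable_fun setT (v i : Omega * borel X -> R))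
  (v0 : forall i z, 0 <= v i z)
  (lv : forall i w, lsc_on (A w) (fun x => v i (w, x))).
Variable pi : Omega -> S.
Hypothesis mpi : measurable_fun setT pi.
Hypothesis noatom : forall D, measurable D -> (0 < mu D)%E ->
  exists2 D1, measurable D1 & forall B, measurable B ->
    mu ((D `&` D1) `+` (D `&` pi @^-1` B)) != 0%E.
Variables (Par : Type) (r : Par -> S -> R).
Hypotheses (mr : forall p, measurable_fun setT (r p)) (r0 : forall p y, 0 <= r p y).

(** In each direction the minimum over [A w] is at most the mean, as [P] is carried by [A w]. *)
Lemma mean_dominates (P : probability (borel X) R) (w : Omega) :
  P (A w) = 1%E -> (forall i, (\int[P]_x (v i (w, x))%:E)%E \is a fin_num) ->
  dominates_lower_hull A v (fun i => fine (\int[P]_x (v i (w, x))%:E)%E) w.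
Proof.
move=> PA fv al al0.
have [y Ay ymin] := lower_hull_min A0 cA lv w al0.
exists y => //.
have mvw i : measurable_fun setT ((fun x => v i (w, x)) : borel X -> R).
  exact: (measurableT_comp (mv i) (@pair1_measurable _ _ Omega (borel X) w)).
have mAw : measurable (A w : set (borel X)).
  have clA : closed (A w) by apply: compact_closed => //; exact: metric_hausdorff.
  rewrite -[A w]setCK; apply: measurableC; apply: sub_sigma_algebra.
  exact: closed_openC.
pose s x := \sum_i al i * v i (w, x).
have ms : measurable_fun setT (s : borel X -> R).
  by apply: measurable_sum => i; exact: measurable_funM.
have s0 x : 0 <= s x by apply: sumr_ge0 => i _; rewrite mulr_ge0.
rewrite -lee_fin.
have -> : (\sum_i al i * fine (\int[P]_x (v i (w, x))%:E)%E)%:E = (\int[P]_x (s x)%:E)%E.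
  under eq_integral do rewrite /s -sumEFin.
  rewrite -sumEFin ge0_integral_sum//.
  - apply: eq_bigr => i _; rewrite EFinM fineK// -ge0_integralZl//.
    + exact/measurable_EFinP.
    + by move=> x _; rewrite lee_fin.
    + by rewrite lee_fin.
  - by move=> i; apply/measurable_EFinP; exact: measurable_funM.
  - by move=> i x _; rewrite lee_fin mulr_ge0.
apply: (@le_trans _ _ (\int[P]_(x in A w) (cst (s y)%:E x))%E).
  by rewrite integral_cst// [X in (_ * X)%E](_ : _ = 1%E) ?mule1.
apply: (@le_trans _ _ (\int[P]_(x in A w) (s x)%:E)%E).
  apply: ge0_le_integral => //.
  + by move=> x _; rewrite lee_fin.
  + by apply/measurable_funTS/measurable_EFinP.
apply: ge0_subset_integral => //.
- by apply/measurable_EFinP.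
- by move=> x _; rewrite lee_fin.
Qed.

Lemma pure_of_randomized (phi : Omega -> weak_probability R X) (K : Par -> 'I_N -> R) :
  randomized_decisions A phi ->
  (forall p i, \int[mu]_w ((\int[prob_of (phi w)]_x (v i (w, x))%:E) * (r p (pi w))%:E)
    <= (K p i)%:E)%E ->
  exists2 f, pure_decisions A f &
    forall p i, (\int[mu]_w (v i (w, f w) * r p (pi w))%:E <= (K p i)%:E)%E.
Proof.
move=> [mphi phiA] hK.
have [||||f Af hf] := pure_domination mu_complete dense_dn mpi noatom mA A0 cA mv v0 lv mr r0
  (W := fun w i => (\int[prob_of (phi w)]_x (v i (w, x))%:E)%E).
- move=> i; apply: (weak_integral_measurable mphi (h := EFin \o v i)).
    by apply/measurable_EFinP.
  by move=> z; rewrite lee_fin.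
- by move=> w i; apply: integral_ge0 => x _; rewrite lee_fin.
- by apply: nearW => w; exact: mean_dominates.
- by move=> p i; exact: le_lt_trans (hK p i) (ltry _).
- by exists f => // p i; exact: le_trans (hf p i) (hK p i).
Qed.

End pure_of_randomized.

Lemma lsc_on_eq (R : realType) (Y : topologicalType) (K : set Y) (f g : Y -> R) :
  (forall y, K y -> f y = g y) -> lsc_on K f -> lsc_on K g.
Proof.
move=> fg lf x t Kx; rewrite -fg// => tf.
by apply: filterS (lf x t Kx tf) => y hy Ky; rewrite -fg//; exact: hy.
Qed.

Theorem theorem2 (R : realType)
    (d : measure_display) (Omega : measurableType d) (mu : probability Omega R)
    (mu_complete : measure_is_complete mu) (mu_nonatomic : nonatomic mu)
    (X : completeMetricType R) (X_separable : separable_space X)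
    (A : Omega -> set X) (A_nonempty : forall w, A w !=set0)
    (A_graph : measurable (corr_graph A : set (Omega * borel X)))
    (m : nat) (c : 'I_m -> Omega * X -> R) (u : Omega * X -> R)
    (c_ge0 : forall i w x, A w x -> 0 <= c i (w, x))
    (c_measurable : forall i,
      measurable_fun (corr_graph A : set (Omega * borel X))
        (c i : Omega * borel X -> R))
    (u_measurable :
      measurable_fun (corr_graph A : set (Omega * borel X))
        (u : Omega * borel X -> R))
    (c_inf_compact : forall i w, inf_compact (A w) (fun x => c i (w, x)))
    (u_inf_compact : forall w, inf_compact (A w) (fun x => - u (w, x)))
    (Lambda : Omega -> R) (Lambda_ge0 : forall w, 0 <= Lambda w)
    (Lambda_integrable : mu.-integrable setT (EFin \o Lambda))
    (u_bound : forall w x, A w x -> `|u (w, x)| <= Lambda w)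
    (Par : Type) (q : Par -> probability Omega R) (rho : Par -> Omega -> R)
    (q_dominated : forall p, q p `<< mu)
    (q_density : forall p, is_density mu (q p) (rho p))
    (u_objective : objective_well_defined A mu rho u)
    (a : 'I_m -> R) (a_ge0 : forall i, 0 <= a i)
    (feasible : randomized_feasible A mu rho c a !=set0)
    (no_atoms : forall D, ~ relative_atom mu (sigma_generated_by rho) D) :
  exists2 f : Omega -> X, pure_feasible A mu rho c a f &
    worst_utility mu rho u f =
      ereal_sup [set worst_utility mu rho u g
                | g in pure_feasible A mu rho c a].
Proof.
have mA := A_graph.
pose G := \bigcup_(p in [set: Par]) preimage_set_system setT (rho p) measurable.
pose S := g_sigma_algebraType G.
(* The identity, with [S] carrying the sigma-field generated by the densities: preimages under [pi]
   are exactly the members of G, and each density factors through [pi]. *)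
pose pi : Omega -> S := id.
have mrho p : measurable_fun setT (rho p) by case: (q_density p).
have rho0 p w : 0 <= rho p w by case: (q_density p).
have mr p : measurable_fun setT (rho p : S -> R).
  by move=> _ B mB; apply: sub_sigma_algebra; exists p => //; exists B.
have mpi : measurable_fun setT pi.
  move=> _ B mB; rewrite setTI; move: B mB; apply: smallest_sub.
    exact: sigma_algebra_measurable.
  by move=> _ [p _ [B mB <-]]; exact: mrho.
have noatom D : measurable D -> (0 < mu D)%E -> exists2 D1, measurable D1 &
    forall B, measurable B -> mu ((D `&` D1) `+` (D `&` pi @^-1` B)) != 0%E.
  move=> mD D0; apply: contrapT => h; apply: (no_atoms D); split => // D1 mD1.
  apply: contrapT => h1; apply: h; exists D1 => // B mB; apply/eqP => muB.
  by apply: h1; exists B.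
have [dn dense_dn] := separable_dense_seq X_separable.
have cA w : compact (A w).
  have -> : A w = [set x | A w x /\ - u (w, x) <= Lambda w].
    apply/seteqP; split => x; [move=> Ax; split => //|by case].
    by have := u_bound _ _ Ax; rewrite ler_norml lerNl => /andP[].
  exact: u_inf_compact.
have hX : hausdorff_space X by exact: metric_hausdorff.
(* Extension by zero off the graph makes the costs total, measurable and nonnegative; semicontinuity
   on [A w] sees only the original values. *)
pose cG i := c i \_ (corr_graph A).
have cGE i w x : A w x -> cG i (w, x) = c i (w, x).
  by move=> Ax; rewrite /cG patchE mem_set.
have mcG i : measurable_fun setT (cG i : Omega * borel X -> R).
  exact: ((measurable_restrictT _ mA).1 (c_measurable i)).
have cG0 i z : 0 <= cG i z.
  rewrite /cG patchE; case: ifP => //; case: z => w x /set_mem; exact: c_ge0.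
have lcG i w : lsc_on (A w) (fun x => cG i (w, x)).
  apply: lsc_on_eq (inf_compact_lsc hX (c_inf_compact i w)) => x Ax.
  by rewrite cGE.
have feasE f : pure_decisions A f ->
    (forall i, pure_worst_cost mu rho (c i) f <= (a i)%:E)%E <->
    (forall p i, (\int[mu]_w (cG i (w, f w) * rho p w)%:E <= (a i)%:E)%E).
  move=> [_ Af]; have cE p i : (\int[mu]_w (cG i (w, f w) * rho p w)%:E =
      \int[mu]_w (c i (w, f w) * rho p w)%:E)%E.
    by apply: eq_integral => w _; rewrite cGE.
  split=> [h p i|h i].
    by rewrite cE; apply: le_trans (h i); apply: ereal_sup_ubound; exists p.
  by apply: ge_ereal_sup => _ [p _ <-]; rewrite -cE.
have [phi [phiD phiC]] := feasible.
have [f1 Af1 hf1] : exists2 f, pure_decisions A f &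
    forall p i, (\int[mu]_w (cG i (w, f w) * rho p w)%:E <= (a i)%:E)%E.
  apply: (pure_of_randomized mu_complete dense_dn mA A_nonempty cA mcG cG0 lcG mpi noatom mr rho0 phiD (K := fun _ i => a i)) => p i.
  apply: le_trans (phiC i); apply: ereal_sup_ubound; exists p => //.
  apply: eq_integral => w _; congr (_ * _)%E; rewrite integral_mkcond.
  apply: eq_integral => x _; rewrite patchE /cG patchE.
  have -> : (x \in A w) = ((w, x) \in corr_graph A) by [].
  by case: ifP.
pose uG := u \_ (corr_graph A).
have uGE w x : A w x -> uG (w, x) = u (w, x).
  by move=> Ax; rewrite /uG patchE mem_set.
have muG : measurable_fun setT (uG : Omega * borel X -> R).
  exact: ((measurable_restrictT _ mA).1 u_measurable).
have lu w : lsc_on (A w) (fun x => - u (w, x)) by exact: inf_compact_lsc.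
have [f2 Af2 f2max] : exists2 f, pure_decisions A f &
    forall w x, A w x -> - uG (w, f w) <= - uG (w, x).
  apply: (argmin_selection mu_complete dense_dn mA A_nonempty cA (g := \- uG)).
    exact: measurableT_comp.
  by move=> w; apply: lsc_on_eq (@lu w) => x Ax; rewrite /= uGE.
pose b w := uG (w, f2 w).
have mb : measurable_fun setT b.
  exact: (measurableT_comp muG (measurable_decision_pair Af2)).
have ub w x : A w x -> uG (w, x) <= b w by move=> Ax; rewrite -lerN2; exact: f2max.
pose vb z := if z \in corr_graph A then b z.1 - uG z else 0.
have mvb : measurable_fun setT (vb : Omega * borel X -> R).
  apply: measurable_fun_ifT => //.
  - apply: (measurable_fun_bool true); rewrite setTI [X in measurable X](_ : _ = corr_graph A)//.
    by apply/seteqP; split => x /=; [move=> /set_mem|move=> /mem_set].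
  - apply: measurable_funB => //.
    exact: (measurableT_comp mb (@measurable_fst _ _ Omega (borel X))).
have vb0 z : 0 <= vb z.
  by rewrite /vb; case: ifP => //; case: z => w x /set_mem Ax; rewrite subr_ge0 ub.
have vbE w x : A w x -> vb (w, x) = b w - u (w, x).
  by move=> Ax; rewrite /vb mem_set//= uGE.
have lvb w : lsc_on (A w) (fun x => vb (w, x)).
  apply: (lsc_on_eq (f := cst (b w) \+ (fun x => - u (w, x)))) => [x Ax|].
    by rewrite vbE.
  apply: lsc_onD => // x t _ tb; exact: nearW.
(* The finite integral of the pointwise maximal utility. By [BE], the condition [t <= \int u rho_p]
   becomes the cost constraint [\int (b - u) rho_p <= B p - t], whose bound depends on [p]. *)
pose B p := fine (\int[mu]_w (u (w, f2 w) * rho p w)%:E)%E.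
have BE p g : pure_decisions A g ->
    (\int[mu]_w (vb (w, g w) * rho p w)%:E + \int[mu]_w (u (w, g w) * rho p w)%:E = (B p)%:E)%E.
  move=> Ag; have ib := u_objective _ p Af2; have ig := u_objective _ p Ag.
  rewrite /B fineK; last exact: integrable_fin_num.
  under [X in (X + _)%E]eq_integral => w _.
    rewrite (vbE _ _ (Ag.2 w)) /b (uGE _ _ (Af2.2 w)) mulrBl EFinB.
    over.
  by rewrite integralB// subeK//; exact: integrable_fin_num.
set V := ereal_sup _.
suff [f Af [fc fu]] : exists2 f, pure_decisions A f &
    (forall p i, (\int[mu]_w (cG i (w, f w) * rho p w)%:E <= (a i)%:E)%E) /\
    forall p, (V <= \int[mu]_w (u (w, f w) * rho p w)%:E)%E.
  have ff : pure_feasible A mu rho c a f by split => //; apply/feasE.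
  exists f => //; apply/eqP; rewrite eq_le; apply/andP; split.
    by apply: ereal_sup_ubound; exists f.
  by apply: le_ereal_inf_tmp => _ [p _ <-].
(* Without parameters all integral conditions are void; with one, [V] is at most [B p0] and cannot
   be [+oo]. *)
have [[p0]|noP] := pselect (inhabited Par); last first.
  by exists f1 => //; split => // p; exfalso; apply: noP.
have VB : (V <= (B p0)%:E)%E.
  apply: ge_ereal_sup => _ [g [Ag _] <-].
  apply: (@le_trans _ _ (\int[mu]_w (u (w, g w) * rho p0 w)%:E)%E).
    by apply: ereal_inf_lbound; exists p0.
  by rewrite -(BE p0 g Ag) leeDr// integral_ge0// => w _; rewrite lee_fin mulr_ge0.
case VE : V => [t| |].
(* The utility deficit becomes the last of [m.+1] costs. *)
- pose v (i : 'I_m.+1) := if unlift ord_max i is Some j then cG j else vb.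
  pose K (k : nat) p (i : 'I_m.+1) :=
    if unlift ord_max i is Some j then a j else B p - t + k.+1%:R^-1.
  pose L p (i : 'I_m.+1) := if unlift ord_max i is Some j then a j else B p - t.
  have mv i : measurable_fun setT (v i : Omega * borel X -> R).
    by rewrite /v; case: unliftP.
  have v0 i z : 0 <= v i z by rewrite /v; case: unliftP.
  have lv i w : lsc_on (A w) (fun x => v i (w, x)).
    by rewrite /v; case: unliftP => *; [exact: lcG|exact: lvb].
  have fu p g : pure_decisions A g ->
      (\int[mu]_w (u (w, g w) * rho p w)%:E)%E \is a fin_num.
    by move=> Ag; apply: integrable_fin_num => //; exact: u_objective.
  have [|||f Af hf] := @pure_closure _ _ Omega S R X mu dn mu_complete dense_dn pi mpi
    noatom A m.+1 v mA A_nonempty cA mv v0 lv Par rho mr rho0 K L.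
  (* A feasible decision whose worst utility exceeds [t - 1/(k+1)] meets the bounds [K k] for all
     parameters. *)
  + move=> k; have k0 : 0 < k.+1%:R^-1 :> R by rewrite invr_gt0.
    have Vfin : V \is a fin_num by rewrite VE.
    have [_ [g [Ag gc] <-] hg] := ub_ereal_sup_adherent k0 Vfin.
    exists g => // p i; rewrite /v /K; case: unliftP => [j _|_].
      exact: (feasE _ Ag).1.
    rewrite -/V VE in hg.
    have : (worst_utility mu rho u g <= \int[mu]_w (u (w, g w) * rho p w)%:E)%E.
      by apply: ereal_inf_lbound; exists p.
    move=> /(lt_le_trans hg); have := BE p g Ag.
    rewrite -(fineK (fu p g Ag)).
    case: (\int[mu]_w _)%E => [y| |] //= [<-].
    rewrite -EFinB lte_fin lee_fin.
    by move: (fine _) (_^-1) => I e; lra.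
  + move=> k p i; rewrite /K; case: unliftP => // _.
    by rewrite lerD2l lef_pV2 ?posrE// ler_nat.
  + move=> p i; rewrite /K /L; case: unliftP => [j _|_]; first exact: cvg_cst.
    rewrite -[X in _ --> X]addr0; apply: cvgD; first exact: cvg_cst.
    exact: cvg_harmonic.
  exists f => //; split => p.
    by move=> i; have := hf p (lift ord_max i); rewrite /v /L liftK.
  have := hf p ord_max; rewrite /v /L unlift_none; have := BE p f Af.
  rewrite -(fineK (fu p f Af)).
  case: (\int[mu]_w _)%E => [y| |] //= [<-].
  by rewrite !lee_fin; move: (fine _) => I; lra.
- by rewrite VE in VB.
(* If the value is [-oo], any feasible decision attains it. *)
- by exists f1 => //; split => // p; rewrite leNye.
Qed.
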